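(* Let $\{T_t\}_{t\ge0}$ be a (not necessarily linear) strongly continuous nonexpansive semigroup on a Hilbert space $L^2=L^2(X,m)$, with generator $A$. Suppose that $\{T_t\}_{t\ge0}$ has a bounded orbit. Let $\alpha\in(0,1]$ and let $\{\mu_t^{(\alpha)}:t\ge0\}$ be the convolution semigroup associated to the Bernstein function $f_\alpha(x)=x^\alpha$, $x\ge0$. Let $S_t$ be the subordination of $\{T_t\}_{t\ge0}$ defined by $$S_tu:=\int_0^{+\infty}T_su\,\mu_t^{(\alpha)}(\mathrm{d}s)$$ for all $t\ge0$ and all $u\in L^2$. Then the right derivative of $S_tu$ exists at $t=0$ for all $u\in D(A)$ and, setting $A^\alpha u:=\lim_{t\to0^+}\frac{u-S_tu}{t}$, the formula $$A^\alpha u=\frac{\alpha}{\Gamma(1-\alpha)}\int_0^\infty\frac{u-T_su}{s^{1+\alpha}}\,\mathrm{d}s$$ holds for any $u\in D(A)$ (when $\alpha<1$). Moreover the operator $A^\alpha:D(A)\to L^2$ is monotone, so that it admits a maximally monotone extension, which then defines a (not necessarily linear) strongly continuous nonexpansive semigroup $\{T_t^\alpha\}_{t\ge0}$ on $L^2$ (called the $\alpha$-subordinated semigroup).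
   Context: A strongly continuous semigroup on $L^2$ is a family of maps with $T_0=I$, $T_{t+s}=T_tT_s$, $t\mapsto T_tu$ continuous; it is nonexpansive if $\|T_tu-T_tv\|_2\le\|u-v\|_2$ for all $u,v\in L^2$, $t\ge0$. Its generator $A$ is the (possibly multivalued) maximal monotone operator, with domain $D(A)$, such that $u(t)=T_tu_0$ solves $\dot u+Au\ni0$, $u(0)=u_0$. The semigroup has a bounded orbit if $\sup_{t\ge0}\|T_tu\|_2<\infty$ for some $u\in L^2$ (by nonexpansivity all orbits are then bounded). A convolution semigroup of probability measures $\{\mu_t\}$ on $[0,+\infty)$ satisfies $\mu_t*\mu_s=\mu_{t+s}$ and $\mu_t\to\delta_0$ vaguely as $t\to0$; the one associated to the Bernstein function $f$ is determined by $\int_0^\infty e^{-sx}\mu_t(\mathrm{d}s)=e^{-tf(x)}$. $\Gamma$ is the Euler Gamma function. Integrals of $L^2$-valued functions are Bochner integrals and limits are in $L^2$. An operator $B$ with domain $D(B)$ is monotone if $(Bu-Bv,u-v)_{L^2}\ge0$ for all $u,v\in D(B)$. *)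

(* Defs.v *)
From HB Require Import structures.
From mathcomp Require Import all_boot all_order all_algebra generic_quotient.
From mathcomp Require Import all_classical all_reals all_analysis.
From mathcomp Require Import measurable_realfun.

Set Implicit Arguments.
Unset Strict Implicit.
Unset Printing Implicit Defensive.
Import Order.TTheory GRing.Theory Num.Theory.
Import numFieldNormedType.Exports.

Local Open Scope classical_set_scope.
Local Open Scope ring_scope.
Local Open Scope quotient_scope.

(* The library's L^2 space LspaceType2 m (measurable functions modulo equality
   m-almost everywhere, with finite L^2 norm) carries no algebraic structure;
   it is equipped here with the usual pointwise operations on representatives
   and with the library's norm 'N[m]_2. *)
Section L2_normed_module.
Context d (X : measurableType d) (R : realType).
Variable m : {measure set X -> \bar R}.

Local Notation L2 := (LspaceType2 m).
Local Notation L2fun := (LfunType m (lee1n 2)).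
Local Notation aeclass := {mfun_ m, X >-> measurableTypeR R}.
Implicit Types (x y z : L2) (f g : L2fun) (a b : R).

HB.instance Definition _ := gen_eqMixin L2.
HB.instance Definition _ := gen_choiceMixin L2.

Definition L2_fun x : X -> R := repr (x : aeclass).

Lemma L2_funP x : L2_fun x \in Lfun m 2%:E.
Proof.
rewrite inE; apply/andP; split; rewrite inE /=.
  exact: (@measurable_funPT _ _ _ _ (repr (x : aeclass))).
exact: (@Lebesgue_finite _ _ _ _ _ _ x).
Qed.

Definition L2_repr x : L2fun := Lfun_Sub (lee1n 2) (L2_funP x).

Let mfun_of f : {mfun X >-> measurableTypeR R} :=
  @mfun_Sub _ _ X (measurableTypeR R) f (mem_set (@measurable_funPT _ _ _ _ f)).

Definition L2_aeclass f : aeclass := \pi_aeclass (mfun_of f).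

Let L2_aeclass_ae f : (L2_aeclass f : X -> R) = f %[ae m].
Proof.
have /eqP : \pi_aeclass (repr (L2_aeclass f)) = L2_aeclass f by exact: reprK.
by rewrite eqmodE => /asboolP.
Qed.

Lemma ae_eq_Lnorm2 (f g : X -> R) :
  measurable_fun setT f -> measurable_fun setT g -> f = g %[ae m] ->
  'N[m]_2%:E[EFin \o f]%E = 'N[m]_2%:E[EFin \o g]%E.
Proof.
have mN (h : X -> R) : measurable_fun setT h ->
    measurable_fun setT (fun t => (`|(EFin \o h) t| `^ 2)%E).
  move=> mh; apply: (@measurableT_comp _ _ _ _ _ _ (fun y : \bar R => (y `^ 2)%E)).
    exact: measurable_poweR.
  by apply: measurableT_comp => //; exact/measurable_EFinP.
move=> mf mg fg; rewrite unlock /Lnorm; congr (_ `^ _)%E.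
apply: ae_eq_integral => //; [exact: mN|exact: mN|].
by apply: filterS fg => x /= fgx xT; rewrite fgx.
Qed.

Lemma L2_class_subproof f : finite_norm m 2%:E (L2_aeclass f).
Proof.
rewrite /finite_norm (@ae_eq_Lnorm2 _ f) ?L2_aeclass_ae//.
  exact: (@Lfunction_finite _ _ _ _ _ _ f).
exact: (@measurable_funPT _ _ _ _ (repr (L2_aeclass f))).
Qed.

Definition L2_class f : L2 := LebesgueSpace.Pack (LebesgueSpace.Class
  (isFinLebesgue.Axioms_ X R m 2%:E (lee1n 2) (L2_aeclass f)
     (L2_class_subproof f))).

Lemma L2_classK f : L2_fun (L2_class f) = f %[ae m].
Proof. exact: L2_aeclass_ae. Qed.

Lemma L2_eqP x y : L2_fun x = L2_fun y %[ae m] -> x = y.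
Proof.
case: x y => [x [[xP]]] [y [[yP]]] /= xy.
have exy : x = y.
  by rewrite -[LHS]reprK -[RHS]reprK; apply/eqP; rewrite eqmodE; exact/asboolP.
by case: _ / exy in yP xy *; rewrite (Prop_irrelevance xP yP).
Qed.

Definition L2_zero : L2 := L2_class 0.
Definition L2_opp x : L2 := L2_class (- L2_repr x).
Definition L2_add x y : L2 := L2_class (L2_repr x + L2_repr y).
Definition L2_scale a x : L2 := L2_class (a *: L2_repr x).

Lemma L2_zeroE : L2_fun L2_zero = cst 0 %[ae m].
Proof. exact: L2_classK. Qed.
Lemma L2_oppE x : L2_fun (L2_opp x) = (fun t => - L2_fun x t) %[ae m].
Proof. exact: L2_classK. Qed.
Lemma L2_addE x y :
  L2_fun (L2_add x y) = (fun t => L2_fun x t + L2_fun y t) %[ae m].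
Proof. exact: L2_classK. Qed.
Lemma L2_scaleE a x :
  L2_fun (L2_scale a x) = (fun t => a * L2_fun x t) %[ae m].
Proof. exact: L2_classK. Qed.

Lemma L2_addA : associative L2_add.
Proof.
move=> x y z; apply: L2_eqP.
apply: filterS (filterI
  (filterI (L2_addE x (L2_add y z)) (L2_addE (L2_add x y) z))
  (filterI (L2_addE x y) (L2_addE y z))) => t [[h1 h2] [h3 h4]] I.
by rewrite h1// h2// h3// h4// addrA.
Qed.
Lemma L2_addC : commutative L2_add.
Proof.
move=> x y; apply: L2_eqP.
apply: filterS2 (L2_addE x y) (L2_addE y x) => t h1 h2 I.
by rewrite h1// h2// addrC.
Qed.
Lemma L2_add0 : left_id L2_zero L2_add.
Proof.
move=> x; apply: L2_eqP.
apply: filterS2 (L2_addE L2_zero x) L2_zeroE => t h1 h2 I.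
by rewrite h1// h2// add0r.
Qed.
Lemma L2_addN : left_inverse L2_zero L2_opp L2_add.
Proof.
move=> x; apply: L2_eqP.
apply: filterS3 (L2_addE (L2_opp x) x) L2_zeroE (L2_oppE x) => t h1 h2 h3 I.
by rewrite h1// h2// h3// addNr.
Qed.

HB.instance Definition _ :=
  GRing.isZmodule.Build L2 L2_addA L2_addC L2_add0 L2_addN.

Lemma L2_scaleA a b x : L2_scale a (L2_scale b x) = L2_scale (a * b) x.
Proof.
apply: L2_eqP.
apply: filterS3 (L2_scaleE a (L2_scale b x)) (L2_scaleE b x)
  (L2_scaleE (a * b) x) => t h1 h2 h3 I.
by rewrite h1// h2// h3// mulrA.
Qed.
Lemma L2_scale1 : left_id 1 L2_scale.
Proof.
move=> x; apply: L2_eqP; apply: filterS (L2_scaleE 1 x) => t h I.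
by rewrite h// mul1r.
Qed.
Lemma L2_scaleDr : right_distributive L2_scale +%R.
Proof.
move=> a x y; apply: L2_eqP.
apply: filterS (filterI (filterI (L2_scaleE a (x + y)) (L2_addE x y))
  (filterI (L2_addE (L2_scale a x) (L2_scale a y))
    (filterI (L2_scaleE a x) (L2_scaleE a y)))) => t [[h1 h2] [h3 [h4 h5]]] I.
by rewrite h1// h2// h3// h4// h5// mulrDr.
Qed.
Lemma L2_scaleDl x : {morph L2_scale^~ x : a b / a + b}.
Proof.
move=> a b; apply: L2_eqP.
apply: filterS (filterI
  (filterI (L2_scaleE (a + b) x) (L2_addE (L2_scale a x) (L2_scale b x)))
  (filterI (L2_scaleE a x) (L2_scaleE b x))) => t [[h1 h2] [h3 h4]] I.
by rewrite h1// h2// h3// h4// mulrDl.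
Qed.

HB.instance Definition _ := GRing.Zmodule_isLmodule.Build R L2
  L2_scaleA L2_scale1 L2_scaleDr L2_scaleDl.

Definition L2_norm x : R := fine ('N[m]_2%:E[EFin \o L2_fun x])%E.

Let L2_norm_ae x (f : L2fun) : L2_fun x = f %[ae m] ->
  L2_norm x = fine ('N[m]_2%:E[EFin \o f])%E.
Proof.
move=> xf; rewrite /L2_norm (@ae_eq_Lnorm2 _ f)//.
exact: (@measurable_funPT _ _ _ _ (L2_repr x)).
Qed.

Lemma L2_normD x y : L2_norm (x + y) <= L2_norm x + L2_norm y.
Proof.
rewrite (@L2_norm_ae (x + y) (L2_repr x + L2_repr y)); last exact: L2_addE.
exact: (ler_LnormD (L2_repr x) (L2_repr y)).
Qed.

Lemma L2_normZ a x : L2_norm (a *: x) = `|a| * L2_norm x.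
Proof.
rewrite (@L2_norm_ae (a *: x) (a *: L2_repr x)); last exact: L2_scaleE.
rewrite (LnormZ (L2_repr x) a) -(finite_norm_fine (L2_repr x)).
by rewrite -EFinM /=.
Qed.

Lemma L2_norm0_eq0 x : L2_norm x = 0 -> x = 0.
Proof.
move=> x0; apply: L2_eqP.
have := @fine_Lnormr_eq0 _ _ _ _ _ _ (L2_repr x) x0.
move=> h; apply: filterS (filterI h L2_zeroE) => t [h1 h2] I.
by rewrite h2//; exact: h1.
Qed.

HB.instance Definition _ := Lmodule_isNormed.Build R L2
  L2_normD L2_normZ L2_norm0_eq0.

Definition L2_inner x y : R := \int[m]_t (L2_fun x t * L2_fun y t).

End L2_normed_module.

Section Bochner.
Context d (Y : measurableType d) (R : realType) (V : normedModType R).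
Variables (mu : {measure set Y -> \bar R}) (D : set Y).
Implicit Types (f s : Y -> V).

Definition Bochner_simple s : Prop :=
  finite_set (s @` D) /\
  forall v, measurable (D `&` s @^-1` [set v]) /\
            (v != 0 -> (mu (D `&` s @^-1` [set v]) < +oo)%E).

(* The value 0 may be taken on a set of infinite measure: that term is 0. *)
Definition Bochner_simple_integral s : V :=
  \sum_(v \in s @` D) fine (mu (D `&` s @^-1` [set v])) *: v.

Definition Bochner_approx f (sn : nat -> Y -> V) : Prop :=
  [/\ forall n, Bochner_simple (sn n),
      \forall y \ae mu, D y -> sn n y @[n --> \oo] --> f y &
      (\int[mu]_(y in D) `|f y - sn n y|%:E)%E @[n --> \oo] --> 0%E].

Definition Bochner_integrable f : Prop := exists sn, Bochner_approx f sn.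

Definition Bochner_integral f : V :=
  xget 0 [set I | exists2 sn, Bochner_approx f sn &
                    Bochner_simple_integral (sn n) @[n --> \oo] --> I].

End Bochner.

Section semigroups.
Context (R : realType) (V : normedModType R).

Definition nonexpansive_semigroup (T : R -> V -> V) : Prop :=
  [/\ forall u, T 0 u = u,
      forall (t s : R) u, 0 <= t -> 0 <= s -> T (t + s) u = T t (T s u),
      forall u, {within `[0, +oo[, continuous (T^~ u)} &
      forall (t : R) u v, 0 <= t -> `|T t u - T t v| <= `|u - v|].

Definition bounded_orbit (T : R -> V -> V) : Prop :=
  exists u, has_ubound [set `|T t u| | t in `[0, +oo[].

End semigroups.

(* Possibly multivalued operators are maps B : V -> set V; ip is the inner
   product of V. *)
Section operators.
Context (R : realType) (V : normedModType R) (ip : V -> V -> R).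
Implicit Types (A B : V -> set V).

Definition dom B : set V := [set u | B u !=set0].

Definition extends A B : Prop := forall u, A u `<=` B u.

Definition single_valued (D : set V) (F : V -> V) : V -> set V :=
  fun u => [set v | D u /\ v = F u].

Definition monotone_op B : Prop :=
  forall u v u' v', B u u' -> B v v' -> 0 <= ip (u' - v') (u - v).

Definition maximal_monotone B : Prop :=
  monotone_op B /\ forall B', monotone_op B' -> extends B B' -> extends B' B.

Definition absolutely_continuous (a b : R) (u : R -> V) : Prop :=
  forall e : R, 0 < e -> exists2 del : R, 0 < del &
    forall (n : nat) (x y : 'I_n -> R),
      (forall i, [/\ a <= x i, x i <= y i & y i <= b]) ->
      trivIset setT (fun i => `]x i, y i[%classic) ->
      \sum_(i < n) (y i - x i) < del ->
      \sum_(i < n) `|u (y i) - u (x i)| < e.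

(* Strong solutions of u' + B u \ni 0 in the sense of Brezis. *)
Definition strong_solution B (u : R -> V) : Prop :=
  [/\ {within `[0, +oo[, continuous u},
      forall a b : R, 0 < a -> a <= b -> absolutely_continuous a b u &
      {ae (@lebesgue_measure R), forall t : R, 0 < t ->
        derivable (u : R^o -> V) t 1 /\ B (u t) (- derive1 u t)}].

(* The generator of a semigroup acting on the whole of V is densely defined;
   without density, A would not be determined by the semigroup. *)
Definition generator (T : R -> V -> V) A : Prop :=
  [/\ maximal_monotone A, closure (dom A) = setT &
      forall u0, dom A u0 -> strong_solution A (T^~ u0)].

End operators.

Section subordinators.
Context (R : realType).
Implicit Type mu : R -> probability R R.

Definition convolution_semigroup mu : Prop :=
  [/\ forall t : R, 0 <= t -> mu t `[0, +oo[%classic = 1%E,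
      forall (t s : R) (E : set R), 0 <= t -> 0 <= s -> measurable E ->
        (mu t \x mu s)%E [set z | E (z.1 + z.2)] = mu (t + s) E &
      forall g : R -> R, continuous g ->
        compact (closure [set x | g x != 0]) ->
        \int[mu t]_(s in `[0, +oo[) g s @[t --> 0^'+] --> g 0].

Definition associated_to mu (f : R -> R) : Prop :=
  forall t x : R, 0 <= t -> 0 <= x ->
    \int[mu t]_(s in `[0, +oo[) expR (- (s * x)) = expR (- (t * f x)).

Definition Gamma (z : R) : R :=
  \int[lebesgue_measure]_(t in `]0, +oo[) (t `^ (z - 1) * expR (- t)).

Definition subordination (V : normedModType R) mu (T : R -> V -> V) t u : V :=
  Bochner_integral (mu t) `[0, +oo[ (T^~ u).

Definition subordinated_generator (V : normedModType R) (S : R -> V -> V) u : V :=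
  lim (t^-1 *: (u - S t u) @[t --> 0^'+]).

End subordinators.

(* Main.v *)
Require Import Defs.
From mathcomp Require Import all_boot all_order all_algebra.
From mathcomp Require Import all_classical all_reals all_analysis.
From mathcomp Require Import measurable_realfun ring lra.
Set Implicit Arguments.
Unset Strict Implicit.
Unset Printing Implicit Defensive.
Import Order.TTheory GRing.Theory Num.Theory.
Import numFieldNormedType.Exports.

Local Open Scope classical_set_scope.
Local Open Scope ring_scope.

(** The theorem rests on one fact about the measures mu_t alone: as t tends to
    0+, the measures mu_t / t converge to the measure c s^(-1-alpha) ds on
    ]0, +oo[, c = alpha / Gamma (1 - alpha), when tested on functions that are
    O(s) at 0 and bounded at infinity. For the functions 1 - exp(-k s) with k
    a natural number this is the Laplace transform of mu_t,
    (1 - exp(-t k^alpha)) / t --> k^alpha, together with the integral formula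
    for k^alpha [fractional_integral]. Testing with the vector-valued function
    phi(s) = u - T_s u gives at once the existence of the limit of
    (u - S_t u) / t and the formula for A^alpha u
    [fractional_power_limit].

    For u in D(A) the function phi is bounded, because orbits are, and
    Lipschitz with phi(0) = 0. To pass from exponentials to phi, put
    r = exp(-s) and f(r) = r phi(- ln r): f is Lipschitz on [0, 1] and vanishes
    at both ends, so its Bernstein polynomials, divided by r, approximate phi
    by combinations of the functions (1 - r) r^k with vector coefficients. The
    error is bounded by a scalar polynomial in r, divisible by 1 - r, whose
    integral against the limit measure is small [exp_approx_error]. This error
    bound is again an exponential polynomial, so the convergence on
    exponentials controls it for all small t; only linearity and positivity of
    the integrals are used [levy_convergence]. Vector-valued integrals enter
    through their inner products with vectors [Bochner_integral_weak].
    For alpha = 1, the Laplace transform at 1 and 2 forces mu_t to be the Dirac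
    mass at t [subordinator_dirac]; then S_t = T_t, and the limit is minus the
    right derivative of the orbit at 0.

    The Lipschitz bound is not part of the definition of a generator, which
    gives absolutely continuous orbits only. It is obtained by constructing the
    semigroup of a maximal monotone operator: Minty's theorem provides the
    resolvents [minty], Kobayashi's estimate makes the implicit Euler scheme
    converge [kobayashi], and its limit has Lipschitz orbits on the domain, with
    minus the element of minimal norm of A u as right derivative at 0
    [semigroup_lip, semigroup_right_derivative]. Strong solutions being unique
    [semigroup_unique], this semigroup is T.

    S_t is nonexpansive, hence u |-> u - S_t u is monotone, and so is the limit
    A^alpha; Zorn's lemma gives a maximal extension
    [maximal_monotone_extension], and the construction just described, applied
    to any such extension, gives the semigroup T^alpha and its uniqueness. The
    space L^2 is used only as a complete inner product space
    [L2_inner_product, L2_complete]. *)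

(** * Inner products *)

Record inner_product (R : realType) (V : normedModType R) (ip : V -> V -> R)
  : Prop := InnerProduct {
  ip_sym : forall x y, ip x y = ip y x ;
  ip_addl : forall x y z, ip (x + y) z = ip x z + ip y z ;
  ip_scalel : forall a x y, ip (a *: x) y = a * ip x y ;
  ip_sqr : forall x, ip x x = `|x| ^+ 2 }.

Definition seq_complete (R : realType) (V : normedModType R) : Prop :=
  forall x : nat -> V,
    (forall e : R, 0 < e -> exists N : nat, forall i j : nat,
       (N <= i)%N -> (N <= j)%N -> `|x i - x j| < e) ->
    exists l : V, x n @[n --> \oo] --> l.

Section inner_product_theory.
Context (R : realType) (V : normedModType R) (ip : V -> V -> R).
Hypothesis hip : inner_product ip.
Implicit Types (x y z : V) (a : R).

Lemma ipC x y : ip x y = ip y x. Proof. exact: (ip_sym hip). Qed.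
Lemma ipDl x y z : ip (x + y) z = ip x z + ip y z.
Proof. exact: (ip_addl hip). Qed.
Lemma ipZl a x y : ip (a *: x) y = a * ip x y.
Proof. exact: (ip_scalel hip). Qed.
Lemma ipDr x y z : ip z (x + y) = ip z x + ip z y.
Proof. by rewrite ipC ipDl !(ipC z). Qed.
Lemma ipZr a x y : ip y (a *: x) = a * ip y x.
Proof. by rewrite ipC ipZl (ipC y). Qed.
Lemma ipNl x y : ip (- x) y = - ip x y.
Proof. by rewrite -scaleN1r ipZl mulN1r. Qed.
Lemma ipNr x y : ip y (- x) = - ip y x.
Proof. by rewrite ipC ipNl (ipC y). Qed.
Lemma ip0l x : ip 0 x = 0.
Proof. by rewrite -(scale0r x) ipZl mul0r. Qed.
Lemma ipBl x y z : ip (x - y) z = ip x z - ip y z.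
Proof. by rewrite ipDl ipNl. Qed.
Lemma ipBr x y z : ip z (x - y) = ip z x - ip z y.
Proof. by rewrite ipDr ipNr. Qed.
Lemma ip_sqrE x : `|x| ^+ 2 = ip x x. Proof. by rewrite (ip_sqr hip). Qed.
Lemma ip_ge0 x : 0 <= ip x x. Proof. by rewrite -ip_sqrE sqr_ge0. Qed.

Lemma ip_suml I (r : seq I) (P : pred I) (F : I -> V) y :
  ip (\sum_(i <- r | P i) F i) y = \sum_(i <- r | P i) ip (F i) y.
Proof.
apply: (big_morph (fun v => ip v y)); last exact: ip0l.
by move=> u v; rewrite ipDl.
Qed.

Lemma cauchy_schwarz x y : `|ip x y| <= `|x| * `|y|.
Proof.
have [->|x0] := eqVneq x 0; first by rewrite ip0l !normr0 mul0r.
have nx : 0 < `|x| by rewrite normr_gt0.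
rewrite -(ler_pXn2r (n := 2)) ?nnegrE ?mulr_ge0//.
have := ip_ge0 (`|x| ^+ 2 *: y - ip x y *: x).
rewrite !(ipBl, ipBr, ipZl, ipZr) (ipC y x) -!ip_sqrE => h.
rewrite real_normK ?num_real// exprMn -subr_ge0.
rewrite -(pmulr_rge0 _ (exprn_gt0 2 nx)).
apply: le_trans h _; rewrite le_eqVlt; apply/orP; left; apply/eqP; ring.
Qed.

Lemma ip_le x y : ip x y <= `|x| * `|y|.
Proof. exact: le_trans (ler_norm _) (cauchy_schwarz _ _). Qed.

Lemma ip_ge x y : - (`|x| * `|y|) <= ip x y.
Proof. by rewrite lerNl; apply: le_trans (cauchy_schwarz x y); rewrite -normrN ler_norm. Qed.

Lemma ip_polar x y : ip x y = 4^-1 * (`|x + y| ^+ 2 - `|x - y| ^+ 2).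
Proof.
rewrite !ip_sqrE !(ipBl, ipBr, ipDl, ipDr, ipNl, ipNr) (ipC y x).
by field.
Qed.

(** Polarization reduces the continuity of [ip] to that of the norm. *)
Lemma cvg_ip T (F : set_system T) (FF : Filter F) (f g : T -> V) (a b : V) :
  f @ F --> a -> g @ F --> b -> (fun t => ip (f t) (g t)) @ F --> ip a b.
Proof.
move=> fa gb.
rewrite (_ : (fun t => _) =
   (fun t => 4^-1 * (`|f t + g t| ^+ 2 - `|f t - g t| ^+ 2))); last first.
  by apply/funext => t; rewrite ip_polar.
rewrite ip_polar; apply: cvgMl_tmp; apply: cvgB; rewrite expr2.
  under eq_fun do rewrite expr2.
  by apply: cvgM; apply: cvg_norm; apply: cvgD.
under eq_fun do rewrite expr2.
by apply: cvgM; apply: cvg_norm; apply: cvgB.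
Qed.

Lemma ip_inj x : (forall y, ip x y = 0) -> x = 0.
Proof.
by move=> /(_ x); rewrite -ip_sqrE => /eqP; rewrite sqrf_eq0 normr_eq0 => /eqP.
Qed.

End inner_product_theory.

(** * Minty's theorem *)

Section minty.
Context (R : realType) (V : normedModType R) (ip : V -> V -> R).
Hypotheses (hip : inner_product ip) (hV : seq_complete V).
Implicit Types (B : V -> set V) (x y a b u v w : V).

Let ipE := (ipDl hip, ipDr hip, ipNl hip, ipNr hip, ipZl hip, ipZr hip).

(** A pair monotonically related to a monotone graph can be adjoined to it, so
    a maximal graph already contains it. *)
Lemma maximal_monotoneP B : maximal_monotone ip B <->
  monotone_op ip B /\
  forall x y, (forall a b, B a b -> 0 <= ip (b - y) (a - x)) -> B x y.
Proof.
split=> [[mB maxB]|[mB relB]]; split=> //.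
  move=> x y xy; pose B' u : set V := [set v | B u v \/ (u = x /\ v = y)].
  apply: (maxB B') => [u v u' v' [Bu|[-> ->]] [Bv|[-> ->]]|u v Bu|].
  - exact: mB.
  - exact: xy.
  - by rewrite -opprB -(opprB v) (ipNl hip) (ipNr hip) opprK; exact: xy.
  - by rewrite !subrr (ip0l hip).
  - by left.
  - by right.
move=> B' mB' BB' x y B'xy; apply: relB => a b /BB' B'ab.
exact: mB'.
Qed.

Lemma maximal_monotone_nonempty B :
  maximal_monotone ip B -> exists a b, B a b.
Proof.
move=> /maximal_monotoneP[_ relB]; apply: contrapT => nB.
by apply: (nB); exists 0, 0; apply: relB => a b Bab; case: nB; exists a, b.
Qed.

(** The Fitzpatrick function of [B], the supremum over the graph of the
    right-hand side, dominates the duality product: a pair for which it does not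
    is monotonically related to the graph, hence lies in it, and is then its own
    witness. *)
Lemma fitzpatrick_ge B x y : maximal_monotone ip B ->
  exists a b, B a b /\ ip x y <= ip x b + ip a y - ip a b.
Proof.
move=> /maximal_monotoneP[_ relB]; apply: contrapT => nB.
have Bxy : B x y.
  apply: relB => a b Bab; rewrite leNgt; apply/negP => lt0.
  apply: nB; exists a, b; split=> //; move: lt0.
  rewrite !ipE (ipC hip b a) (ipC hip b x) (ipC hip y a) (ipC hip y x); lra.
apply: nB; exists x, y; split=> //; lra.
Qed.

(** Divide by [t] and let [t] tend to 0. *)
Lemma le0_linear_part (P Q : R) : 0 <= Q ->
  (forall t, 0 < t -> t <= 1 -> 0 <= t * P + t ^+ 2 * Q) -> 0 <= P.
Proof.
move=> Q0 h; rewrite leNgt; apply/negP => P0.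
have QP : 0 < Q - P by lra.
have t0 : 0 < - P / (Q - P) by rewrite divr_gt0// oppr_gt0.
have t1 : - P / (Q - P) <= 1 by rewrite ler_pdivrMr//; lra.
have := h _ t0 t1; rewrite expr2 -mulrA -mulrDr pmulr_rge0//.
rewrite (_ : P + _ = - (P ^+ 2 / (Q - P))); last by field; rewrite gt_eqF.
by rewrite oppr_ge0 leNgt divr_gt0// exprn_even_gt0//= lt_eqF.
Qed.

(** Adding (|x|^2 + |y|^2) / 2 to the Fitzpatrick function gives a nonnegative
    uniformly convex function of (x, y), so its minimizing sequences are Cauchy.
    Optimality at the minimizer (x0, y0) makes (- y0, - x0) monotonically related
    to the graph, hence an element of it, and then forces x0 + y0 = 0. *)
Lemma minty_zero B : maximal_monotone ip B -> exists z, B z (- z).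
Proof.
move=> hB; have /maximal_monotoneP[mB relB] := hB.
(* [feas c x y]: the function to be minimized is at most [c] at [(x, y)]. *)
pose feas (c : R) x y := forall a b, B a b ->
  ip x b + ip a y - ip a b + 2^-1 * (ip x x + ip y y) <= c.
pose C : set R := [set c | exists x y, feas c x y].
have fitz c x y : feas c x y -> ip x y + 2^-1 * (ip x x + ip y y) <= c.
  move=> h; have [a [b [Bab hab]]] := fitzpatrick_ge x y hB.
  by have := h _ _ Bab; lra.
have C0 : lbound C 0.
  move=> c [x [y /fitz]].
  have := ip_ge0 hip (x + y); rewrite !ipE (ipC hip y x); lra.
have [a0 [b0 Bab0]] := maximal_monotone_nonempty hB.
have feasB a1 b1 : B a1 b1 ->
    feas (ip a1 b1 + 2^-1 * (ip a1 a1 + ip b1 b1)) a1 b1.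
  move=> Bab1 a b Bab; have := mB _ _ _ _ Bab Bab1.
  rewrite !ipE (ipC hip b a) (ipC hip b1) (ipC hip b) (ipC hip b1); lra.
have infC : has_inf C.
  by split; [eexists; exists a0, b0; exact: feasB | exists 0].
pose c0 := inf C.
have c0_le c x y : feas c x y -> c0 <= c.
  by move=> h; apply: ge_inf; [exact: infC.2|exists x, y].
have seqE (n : nat) : exists p : V * V, feas (c0 + n.+1%:R^-1) p.1 p.2.
  have [c [x [y h]] lc] : exists2 c, C c & c < c0 + n.+1%:R^-1.
    by apply: inf_adherent => //; rewrite invr_gt0.
  by exists (x, y) => a b /h /= h1; apply: le_trans h1 (ltW lc).
have [p hp] := choice seqE.
(* The minimum is at most the value at the midpoint: this bounds the distance
   of two almost minimizing pairs. *)
have mid c c' x y x' y' : feas c x y -> feas c' x' y' ->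
    ip (x - x') (x - x') + ip (y - y') (y - y') <= 4 * (c + c') - 8 * c0.
  move=> h h'; have := @c0_le
    (2^-1 * (c + c') - 8^-1 * (ip (x - x') (x - x') + ip (y - y') (y - y')))
    (2^-1 *: (x + x')) (2^-1 *: (y + y')).
  have hm : feas
    (2^-1 * (c + c') - 8^-1 * (ip (x - x') (x - x') + ip (y - y') (y - y')))
    (2^-1 *: (x + x')) (2^-1 *: (y + y')).
    move=> a b Bab; have := h _ _ Bab; have := h' _ _ Bab.
    rewrite !ipE (ipC hip x' x) (ipC hip y' y); lra.
  by move=> /(_ hm); lra.
have cau (q : V * V -> V) : (forall i j, ip (q (p i) - q (p j)) (q (p i) - q (p j))
     <= 4 * (i.+1%:R^-1 + j.+1%:R^-1)) ->
    exists l : V, q (p n) @[n --> \oo] --> l.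
  move=> hq; refine (hV (x := fun n => q (p n)) _) => e e0.
  have e8 : 0 < e ^+ 2 / 8 by rewrite divr_gt0// exprn_gt0.
  have [N _ HN] := near_infty_natSinv_lt (PosNum e8).
  exists N => i j Ni Nj; rewrite -(ltr_pXn2r (n := 2)) ?nnegrE ?(ltW e0)//.
  rewrite (ip_sqrE hip); apply: le_lt_trans (hq _ _) _.
  have := HN i Ni; have := HN j Nj; rewrite /=.
  move: (j.+1%:R^-1) (i.+1%:R^-1) => rj ri; lra.
have [x0 cx] : exists l : V, (p n).1 @[n --> \oo] --> l.
  apply: (cau fst) => i j; have := mid _ _ _ _ _ _ (hp i) (hp j).
  have := ip_ge0 hip ((p i).2 - (p j).2); move: (i.+1%:R^-1) (j.+1%:R^-1) => ri rj; lra.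
have [y0 cy] : exists l : V, (p n).2 @[n --> \oo] --> l.
  apply: (cau snd) => i j; have := mid _ _ _ _ _ _ (hp i) (hp j).
  have := ip_ge0 hip ((p i).1 - (p j).1); move: (i.+1%:R^-1) (j.+1%:R^-1) => ri rj; lra.
have cvgip (f g : nat -> V) (a b : V) : f @ \oo --> a -> g @ \oo --> b ->
   ip (f n) (g n) @[n --> \oo] --> ip a b by move=> ? ?; exact: cvg_ip.
have cc (a : V) : (fun=> a) @ \oo --> a by exact: cvg_cst.
have h0 : feas c0 x0 y0.
  move=> a b Bab.
  have hL := cvgD (cvgD (cvgD (cvgip _ _ _ _ cx (cc b)) (cvgip _ _ _ _ (cc a) cy))
    (cvg_cst (- ip a b))) (cvgMl_tmp (a := 2^-1)
      (cvgD (cvgip _ _ _ _ cx cx) (cvgip _ _ _ _ cy cy))).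
  have hR := cvgD (cvg_cst c0) (@cvg_harmonic R).
  rewrite addr0 in hR; refine (ler_cvg_to (hL _ _ _ _ _ _) (hR _ _) _).
  by near=> n; exact: hp.
(* Optimality along the segment from the minimizer towards a point [(a, b)] of
   the graph, where the Fitzpatrick function is [ip a b]. *)
have key a b : B a b ->
   ip x0 y0 + ip x0 x0 + ip y0 y0 <= ip a b + ip x0 a + ip y0 b.
  move=> Bab; pose F0 := c0 - 2^-1 * (ip x0 x0 + ip y0 y0).
  have F0ge : ip x0 y0 <= F0 by have := fitz _ _ _ h0; rewrite /F0; lra.
  suff : 0 <= ip a b - F0 + ip x0 (a - x0) + ip y0 (b - y0).
    by rewrite !ipE; lra.
  apply: (@le0_linear_part _
    (2^-1 * (ip (a - x0) (a - x0) + ip (b - y0) (b - y0)))).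
    by rewrite mulr_ge0// addr_ge0//; exact: (ip_ge0 hip).
  move=> t t0 t1.
  have := @c0_le ((1 - t) * F0 + t * ip a b + 2^-1 *
    (ip (x0 + t *: (a - x0)) (x0 + t *: (a - x0))
     + ip (y0 + t *: (b - y0)) (y0 + t *: (b - y0))))
    (x0 + t *: (a - x0)) (y0 + t *: (b - y0)).
  have hm : feas ((1 - t) * F0 + t * ip a b + 2^-1 *
    (ip (x0 + t *: (a - x0)) (x0 + t *: (a - x0))
     + ip (y0 + t *: (b - y0)) (y0 + t *: (b - y0))))
    (x0 + t *: (a - x0)) (y0 + t *: (b - y0)).
    move=> a1 b1 Bab1; rewrite lerD2r.
    have {}h0 : ip x0 b1 + ip a1 y0 - ip a1 b1 <= F0.
      by have := h0 _ _ Bab1; rewrite /F0; lra.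
    have h1 : ip a b1 + ip a1 b - ip a1 b1 <= ip a b.
      by have := feasB _ _ Bab _ _ Bab1; lra.
    have : (1 - t) * (ip x0 b1 + ip a1 y0 - ip a1 b1) <= (1 - t) * F0.
      by apply: ler_wpM2l => //; lra.
    have : t * (ip a b1 + ip a1 b - ip a1 b1) <= t * ip a b.
      by apply: ler_wpM2l => //; lra.
    rewrite !ipE; lra.
  move=> /(_ hm); rewrite /F0 !ipE (ipC hip a x0) (ipC hip b y0); lra.
have Byx : B (- y0) (- x0).
  apply: relB => a b Bab; have := key _ _ Bab.
  have := ip_ge0 hip (x0 + y0).
  rewrite !ipE (ipC hip b) (ipC hip y0 x0) (ipC hip x0 a) (ipC hip b) ; lra.
have xy : x0 + y0 = 0.
  apply/eqP; rewrite -normr_eq0 -sqrf_eq0 (ip_sqrE hip) eq_le (ip_ge0 hip) andbT.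
  have := key _ _ Byx; rewrite !ipE (ipC hip y0 x0); lra.
exists (- y0); rewrite opprK.
by move: Byx; rewrite (_ : - x0 = y0)//; apply/eqP; rewrite eq_sym -addr_eq0 addrC xy.
Unshelve. all: by end_near.
Qed.

End minty.

(** * Resolvents and Yosida approximations *)

Lemma natSinv_lt (R : realType) (e : R) : 0 < e ->
  exists N : nat, forall n, (N <= n)%N -> n.+1%:R^-1 < e.
Proof.
by move=> e0; have [N _ HN] := near_infty_natSinv_lt (PosNum e0); exists N => n /HN.
Qed.

Lemma le_of_le_add_eps (R : realType) (a b : R) :
  (forall e, 0 < e -> a <= b + e) -> a <= b.
Proof. by move=> h; apply/ler_addgt0Pr => e /h. Qed.

Section yosida.
Context (R : realType) (V : normedModType R) (ip : V -> V -> R).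
Hypotheses (hip : inner_product ip) (hV : seq_complete V).
Context (B : V -> set V).
Hypothesis hB : maximal_monotone ip B.
Implicit Types (x y z u v w : V) (l : R).

Let ipE := (ipDl hip, ipDr hip, ipNl hip, ipNr hip, ipZl hip, ipZr hip).

Let mB : monotone_op ip B. Proof. by case: hB. Qed.

Lemma maximal_rel x y :
  (forall a b, B a b -> 0 <= ip (b - y) (a - x)) -> B x y.
Proof. by have /(maximal_monotoneP hip)[_] := hB; apply. Qed.

(** [minty_zero] applied to the operator l B - u. *)
Lemma minty l u : 0 < l -> exists z, B z (l^-1 *: (u - z)).
Proof.
move=> l0; pose B' x : set V := [set v | B x (l^-1 *: (v + u))].
have hB' : maximal_monotone ip B'.
  apply/(maximal_monotoneP hip); split.
    move=> x y x' y' /= /mB h /h.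
    rewrite -scalerBr opprD addrACA subrr addr0 (ipZl hip).
    by rewrite pmulr_rge0// invr_gt0.
  move=> x y h; rewrite /B' /=; apply: maximal_rel => a b Bab.
  have Bab' : B' a (l *: b - u).
    by rewrite /B' /= subrK scalerA mulVf ?gt_eqF// scale1r.
  have := h _ _ Bab'; rewrite (_ : l *: b - u - y = l *: (b - l^-1 *: (y + u))).
    by rewrite (ipZl hip) pmulr_rge0.
  by rewrite scalerBr scalerA divff ?gt_eqF// scale1r opprD (addrC (- y)) addrA.
have [z] := minty_zero hip hV hB'.
by rewrite /B' /= addrC => Bz; exists z.
Qed.

Definition resolvent l u : V := xget 0 [set z | B z (l^-1 *: (u - z))].
Definition yosida l u : V := l^-1 *: (u - resolvent l u).

Local Notation J := resolvent.
Local Notation Y := yosida.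

Lemma yosidaP l u : 0 < l -> B (J l u) (Y l u).
Proof.
move=> l0; have [z Bz] := minty u l0.
exact: (@xgetPex _ 0 [set z | B z (l^-1 *: (u - z))] (ex_intro _ z Bz)).
Qed.

Lemma yosidaE l u : 0 < l -> l *: Y l u = u - J l u.
Proof. by move=> l0; rewrite /Y scalerA divff ?gt_eqF// scale1r. Qed.

Lemma resolventE l u : 0 < l -> J l u = u - l *: Y l u.
Proof. by move=> l0; rewrite yosidaE// opprB addrC subrK. Qed.

(** In the expansion of |(J u - J v) + l (Y u - Y v)|^2 the cross term is
    nonnegative by monotonicity. *)
Lemma resolvent_nexp l u v : 0 < l -> `|J l u - J l v| <= `|u - v|.
Proof.
move=> l0; have h := mB (yosidaP u l0) (yosidaP v l0).
have uE : u - v = (J l u - J l v) + l *: (Y l u - Y l v).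
  by rewrite scalerBr !yosidaE// opprB [RHS]addrC addrACA subrK addrAC subrr add0r.
rewrite -ler_sqr ?nnegrE// uE !(ip_sqrE hip).
move: (J l u - J l v) (Y l u - Y l v) h => p q h.
rewrite !ipE (ipC hip p q).
have q0 := ip_ge0 hip q.
have h1 : 0 <= l * ip q p by rewrite mulr_ge0// ltW.
have h2 : 0 <= l * (l * ip q q) by rewrite !mulr_ge0// ltW.
lra.
Qed.

(** Monotonicity between [(x, v)] and [(J l x, Y l x)] reads
    (v - Y l x, Y l x) >= 0. *)
Lemma yosida_ip l x v : 0 < l -> B x v ->
  `|v - Y l x| ^+ 2 <= `|v| ^+ 2 - `|Y l x| ^+ 2.
Proof.
move=> l0 Bxv; have := mB Bxv (yosidaP x l0).
rewrite -yosidaE// (ipZr hip) pmulr_rge0// !(ip_sqrE hip).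
by move: (Y l x) => y; rewrite !ipE (ipC hip y v); lra.
Qed.

Lemma yosida_le l x v : 0 < l -> B x v -> `|Y l x| <= `|v|.
Proof.
move=> l0 Bxv; rewrite -ler_sqr ?nnegrE//.
by have := yosida_ip l0 Bxv; have := sqr_ge0 (`|v - Y l x|); lra.
Qed.

(** The increments of the squared norm control the distances: bounded families
    of Yosida approximations converge in norm as the parameter decreases, without any
    appeal to weak compactness. *)
Lemma yosida_decr l k x : 0 < k -> k <= l ->
  `|Y k x - Y l x| ^+ 2 <= `|Y k x| ^+ 2 - `|Y l x| ^+ 2.
Proof.
move=> k0 kl; have l0 : 0 < l by exact: lt_le_trans kl.
move: kl; rewrite le_eqVlt => /predU1P[->|kl].
  by rewrite !subrr normr0 expr0n.
have := mB (yosidaP x k0) (yosidaP x l0).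
rewrite (resolventE x k0) (resolventE x l0).
rewrite (_ : x - k *: Y k x - (x - l *: Y l x) = l *: Y l x - k *: Y k x).
  2: by rewrite opprB addrC addrA subrK.
move: (Y k x) (Y l x) => p q; rewrite !(ip_sqrE hip) !ipE (ipC hip q p) => h.
have hq : 0 <= ip p p + ip q q - 2 * ip p q.
  by have := ip_ge0 hip (p - q); rewrite !ipE (ipC hip q p); lra.
have h1 : 0 <= k * (ip p p + ip q q - 2 * ip p q) by rewrite mulr_ge0// ltW.
have : 0 <= (l - k) * (ip p q - ip q q) by lra.
by rewrite pmulr_rge0 ?subr_gt0//; lra.
Qed.

(** Monotone relatedness passes to the limit, and maximality turns it into
    membership. *)
Lemma closed_graph (x y : nat -> V) (a b : V) : (forall n, B (x n) (y n)) ->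
  x n @[n --> \oo] --> a -> y n @[n --> \oo] --> b -> B a b.
Proof.
move=> Bxy xa yb; apply: maximal_rel => p q Bpq.
have h : (fun n => ip (q - y n) (p - x n)) @ \oo --> ip (q - b) (p - a).
  by apply: (cvg_ip hip); apply: cvgB => //; exact: cvg_cst.
by apply: (cvgr_to_ge h); apply: nearW => n; exact: mB.
Qed.

(** By [yosida_decr] the approximations converge as [l] tends to 0; the resolvents
    converge to [x], and the graph is closed. *)
Lemma yosida_bounded x (L : R) : (forall l, 0 < l -> `|Y l x| <= L) ->
  exists y, [/\ B x y, `|y| <= L &
    forall e, 0 < e -> exists2 l, 0 < l & `|y - Y l x| < e].
Proof.
move=> hL; pose s n : R := n.+1%:R^-1.
have s0 n : 0 < s n by rewrite invr_gt0.
have sN i j : (i <= j)%N -> s j <= s i by move=> ij; rewrite lef_pV2 ?posrE ?ler_nat.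
pose D : set R := range (fun n => `|Y (s n) x| ^+ 2).
have supD : has_sup D.
  split; first by exists (`|Y (s 0%N) x| ^+ 2), 0%N.
  exists (L ^+ 2) => _ [n _ <-]; rewrite ler_sqr ?nnegrE//.
    exact: hL.
  exact: le_trans (hL _ (s0 n)).
have [y cy] : exists y : V, Y (s n) x @[n --> \oo] --> y.
  refine (hV (x := fun n => Y (s n) x) _) => e e0.
  have e2 : 0 < e ^+ 2 by rewrite exprn_gt0.
  have [_ [N _ <-] HN] := sup_adherent e2 supD.
  have up n : `|Y (s n) x| ^+ 2 <= sup D.
    by apply: ub_le_sup; [exact: supD.2|exists n].
  have main i j : (N <= i)%N -> (i <= j)%N -> `|Y (s i) x - Y (s j) x| < e.
    move=> Ni ij; rewrite -ltr_sqr ?nnegrE ?(ltW e0)// distrC.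
    apply: le_lt_trans (yosida_decr _ (s0 j) (sN _ _ ij)) _.
    have := up j; have := yosida_decr x (s0 i) (sN _ _ Ni).
    have := sqr_ge0 (`|Y (s i) x - Y (s N) x|); lra.
  exists N => i j Ni Nj; have [ij|/ltnW ij] := leqP i j; first exact: main.
  by rewrite distrC; exact: main.
have cJ : J (s n) x @[n --> \oo] --> x.
  apply/cvgrPdist_lt => e e0.
  have Le0 : 0 < e / (L + 1).
    by rewrite divr_gt0//; have := hL _ ltr01; have := normr_ge0 (Y 1 x); lra.
  have [N HN] := natSinv_lt Le0.
  exists N => //= n /HN; rewrite -/(s n) => sn.
  rewrite -yosidaE// normrZ gtr0_norm//.
  have L1 : 0 < L + 1 by have := hL _ ltr01; have := normr_ge0 (Y 1 x); lra.
  apply: (@le_lt_trans _ _ (s n * (L + 1))).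
    by apply: ler_wpM2l; [exact: ltW|have := hL _ (s0 n); lra].
  by rewrite -ltr_pdivlMr.
exists y; split.
- exact: (closed_graph (fun n => yosidaP x (s0 n)) cJ cy).
- apply: (cvgr_to_le (cvg_norm cy)); apply: nearW => n; exact: hL.
- move=> e e0; have /cvgrPdist_lt/(_ e e0)[N _ HN] := cy.
  by exists (s N) => //; apply: HN => /=.
Qed.

Definition min_section x : V :=
  xget 0 [set y | B x y /\ forall v, B x v -> `|y| <= `|v|].

Local Notation B0 := min_section.

(** The limit of the Yosida approximations has minimal norm, and by [yosida_ip]
    any other element of minimal norm is also their limit. *)
Lemma min_section_spec x : dom B x ->
  [/\ B x (B0 x), forall v, B x v -> `|B0 x| <= `|v| &
    forall e, 0 < e -> exists2 l, 0 < l & `|B0 x - Y l x| < e].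
Proof.
move=> [v Bxv].
have [y [Bxy yv ycv]] := @yosida_bounded x _ (fun l lp => yosida_le lp Bxv).
have ymin w : B x w -> `|y| <= `|w|.
  move=> Bxw; apply: le_of_le_add_eps => e e0.
  have [l l0 hl] := ycv e e0; have := yosida_le l0 Bxw.
  have := ler_normD (y - Y l x) (Y l x); rewrite subrK; lra.
have [B0x B0min] : [set y | B x y /\ forall v, B x v -> `|y| <= `|v|] (B0 x).
  by apply: xgetPex; exists y; split.
split=> // e e0.
have d0 : 0 < e ^+ 2 / (2 * `|B0 x| + 1).
  by rewrite divr_gt0 ?exprn_gt0//; have := normr_ge0 (B0 x); lra.
have [l l0 hl] := ycv _ d0; exists l => //.
rewrite -ltr_sqr ?nnegrE ?(ltW e0)//.
apply: le_lt_trans (yosida_ip l0 B0x) _.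
have h1 := yosida_le l0 B0x.
have h2 : `|B0 x| - `|Y l x| < e ^+ 2 / (2 * `|B0 x| + 1).
  have := B0min _ Bxy; have := ler_normD (y - Y l x) (Y l x); rewrite subrK; lra.
rewrite subr_sqr.
apply: (@le_lt_trans _ _ ((`|B0 x| - `|Y l x|) * (2 * `|B0 x| + 1))).
  by apply: ler_wpM2l; lra.
by rewrite -ltr_pdivlMr//; have := normr_ge0 (B0 x); lra.
Qed.

End yosida.

(** * Real functions *)

Lemma within_continuous_epsP (R : realType) (V : normedModType R) (A : set R)
    (f : R -> V) :
  {within A, continuous f} <-> forall x, A x -> forall e : R, 0 < e ->
    exists2 d : R, 0 < d & forall y, A y -> `|x - y| < d -> `|f x - f y| < e.
Proof.
split=> [/subspace_continuousP h x Ax e e0|h].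
  have := h x Ax; move/cvgrPdist_lt => /(_ e e0).
  rewrite /within /= => /nbhs_ballP[d /= d0 hd].
  by exists d => // y Ay xy; exact: hd.
apply/subspace_continuousP => x Ax; apply/cvgrPdist_lt => e e0.
have [d d0 hd] := h x Ax e e0.
by apply/nbhs_ballP; exists d => //= y xy Ay; exact: hd.
Qed.

(** Each left jump leaves a rational strictly between the value at the point and
    all earlier values; by monotonicity these rationals are distinct. *)
Lemma countable_left_jumps (R : realType) (N : R -> R) :
  (forall s t : R, 0 <= s -> s <= t -> N t <= N s) ->
  countable [set t : R | 0 < t /\
    ~ forall d : R, 0 < d -> exists2 s : R, 0 <= s < t & N s <= N t + d].
Proof.
move=> Ndecr; set J := (X in countable X).
have hJ t : J t -> exists q : rat, N t < ratr q /\
    forall s, 0 <= s -> s < t -> ratr q < N s.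
  move=> [t0 /existsNP[d /not_implyP[d0 nh]]].
  have [q qN] : exists q, ratr q \in `]N t, N t + d[ by apply: rat_in_itvoo; rewrite ltrDl.
  move: qN; rewrite in_itv/= => /andP[Nq qN].
  exists q; split=> // s s0 st; apply: lt_le_trans qN _; rewrite leNgt.
  by apply/negP => Nsd; apply: nh; exists s; [rewrite s0 st|exact: ltW].
pose f t : rat := xget 0 [set q : rat | N t < ratr q /\
    forall s, 0 <= s -> s < t -> ratr q < N s].
have fP t : J t -> N t < ratr (f t) /\
    forall s, 0 <= s -> s < t -> ratr (f t) < N s.
  by move=> /hJ[q hq]; exact: (@xgetPex _ 0 [set q : rat | _] (ex_intro _ q hq)).
apply/countable_injP; exists (fun t => pickle (f t)).
move=> s t /set_mem Js /set_mem Jt /(pcan_inj pickleK) fst.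
have aux u v : J u -> J v -> f u = f v -> ~ u < v.
  move=> Ju Jv fuv uv; have [Nu _] := fP _ Ju; have [_ /(_ u)] := fP _ Jv.
  by rewrite -fuv => /(_ (ltW Ju.1) uv)/(lt_trans Nu); rewrite ltxx.
by have [/(aux _ _ Js Jt fst)|/(aux _ _ Jt Js (esym fst))|] := ltgtP s t.
Qed.

(** * The semigroup generated by a maximal monotone operator *)

Definition mesh (R : realType) (n : nat) : R := n.+1%:R^-1.
Definition nsteps (R : realType) (n : nat) (t : R) : nat :=
  Num.truncn (t * n.+1%:R).

Section generation.
Context (R : realType) (V : normedModType R) (ip : V -> V -> R).
Hypotheses (hip : inner_product ip) (hV : seq_complete V).
Context (B : V -> set V).
Hypothesis hB : maximal_monotone ip B.
Implicit Types (x y z u v w : V) (h l t : R).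

Local Notation J := (resolvent B).
Local Notation Y := (yosida B).
Local Notation B0 := (min_section B).

Let ipE := (ipDl hip, ipDr hip, ipNl hip, ipNr hip, ipZl hip, ipZr hip).

Definition euler h k x : V := iter k (J h) x.

Lemma euler_nexp h k x y : 0 < h -> `|euler h k x - euler h k y| <= `|x - y|.
Proof.
move=> hp; elim: k => //= k; apply: le_trans.
exact: (resolvent_nexp hip hV hB).
Qed.

(** The Yosida approximation at a point is at most any element of the operator
    there, so slopes do not grow along the scheme. *)
Lemma euler_slope h k x v : 0 < h -> B x v ->
  exists2 w, B (euler h k x) w & `|w| <= `|v|.
Proof.
move=> hp Bxv; elim: k => [|k [w Bw wv]]; first by exists v.
exists (Y h (euler h k x)); first exact: (yosidaP hip hV hB).
by apply: le_trans wv; exact: (yosida_le hip hV hB).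
Qed.

Lemma euler_step h k x v : 0 < h -> B x v ->
  `|euler h k x - euler h k.+1 x| <= h * `|v|.
Proof.
move=> hp Bxv; have [w Bw wv] := euler_slope k hp Bxv.
rewrite [euler h k.+1 x]/= -(yosidaE B)// normrZ gtr0_norm// ler_pM2l//.
by apply: le_trans wv; exact: (yosida_le hip hV hB).
Qed.

Lemma euler_dist h k x v : 0 < h -> B x v ->
  `|x - euler h k x| <= k%:R * h * `|v|.
Proof.
move=> hp Bxv; elim: k => [|k IH]; first by rewrite subrr normr0 !mul0r.
have := euler_step k hp Bxv.
have := ler_distD (euler h k x) x (euler h k.+1 x).
rewrite -natr1 mulrDl mulrDl mul1r; lra.
Qed.

(** The recursive inequality behind Kobayashi's estimate, for steps of different
    sizes; it is monotonicity at the two resolvents, the squares of the two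
    slopes being dropped. *)
Lemma resolvent_dist2 a c u w : 0 < a -> 0 < c ->
  (a + c) * `|J a u - J c w| ^+ 2 <=
    c * `|u - J c w| ^+ 2 + a * `|J a u - w| ^+ 2.
Proof.
move=> a0 c0.
have := hB.1 _ _ _ _ (yosidaP hip hV hB u a0) (yosidaP hip hV hB w c0).
have -> : u - J c w = (J a u - J c w) + a *: Y a u.
  by rewrite yosidaE// [RHS]addrC addrA subrK.
have -> : J a u - w = (J a u - J c w) - c *: Y c w.
  by rewrite yosidaE// opprB addrA subrK.
move: (J a u - J c w) (Y a u) (Y c w) => p q r; rewrite !(ip_sqrE hip) => h1.
have h2 : 0 <= a * (c * ip (q - r) p) by rewrite !mulr_ge0// ltW.
have h3 : 0 <= c * (a * (a * ip q q)).
  by rewrite !mulr_ge0 ?(ip_ge0 hip) ?ltW.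
have h4 : 0 <= a * (c * (c * ip r r)).
  by rewrite !mulr_ge0 ?(ip_ge0 hip) ?ltW.
move: h2; rewrite !ipE (ipC hip p q) (ipC hip p r); lra.
Qed.

(** Double induction with [resolvent_dist2]: the right-hand side satisfies the
    recursion with equality. *)
Lemma kobayashi a c x v i j : 0 < a -> 0 < c -> B x v ->
  `|euler a i x - euler c j x| ^+ 2 <=
  `|v| ^+ 2 * ((i%:R * a - j%:R * c) ^+ 2 + i%:R * a ^+ 2 + j%:R * c ^+ 2).
Proof.
move=> a0 c0 Bxv; elim: i j => [|i IHi] j.
  rewrite !mul0r sub0r sqrrN addr0.
  apply: (@le_trans _ _ ((j%:R * c * `|v|) ^+ 2)).
    by rewrite ler_sqr ?nnegrE ?mulr_ge0 ?(ltW c0)//; exact: euler_dist.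
  rewrite exprMn mulrC ler_wpM2l ?sqr_ge0// lerDl.
  by rewrite mulr_ge0 ?sqr_ge0.
elim: j => [|j IHj].
  rewrite !mul0r subr0 addr0.
  apply: (@le_trans _ _ ((i.+1%:R * a * `|v|) ^+ 2)).
    rewrite ler_sqr ?nnegrE ?mulr_ge0 ?(ltW a0)// distrC; exact: euler_dist.
  rewrite exprMn mulrC ler_wpM2l ?sqr_ge0// lerDl.
  by rewrite mulr_ge0 ?sqr_ge0.
have ac : 0 < a + c by rewrite addr_gt0.
rewrite -(ler_pM2l ac).
apply: le_trans (resolvent_dist2 (euler a i x) (euler c j x) a0 c0) _.
have := IHi j.+1; rewrite -(ler_pM2l c0) => h1.
have := IHj; rewrite -(ler_pM2l a0) => h2.
apply: le_trans (lerD h1 h2) _.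
rewrite -!natr1 le_eqVlt; apply/orP; left; apply/eqP; ring.
Qed.

Local Notation s := (mesh R).
Local Notation k := nsteps.

Let s0 n : 0 < s n. Proof. by rewrite invr_gt0. Qed.

Let ks n t : 0 <= t -> (k n t)%:R * s n <= t < (k n t)%:R * s n + s n.
Proof.
move=> t0; have /andP[h1 h2] : ((k n t)%:R <= t * n.+1%:R < (k n t).+1%:R).
  by apply: truncn_itv; rewrite mulr_ge0.
have -> : (k n t)%:R * s n + s n = (k n t).+1%:R / n.+1%:R.
  by rewrite -natr1 mulrDl mul1r.
by rewrite /mesh ler_pdivrMr// ltr_pdivlMr// h1 h2.
Qed.

Lemma mesh_lt e : 0 < e -> exists N : nat, forall n, (N <= n)%N -> s n < e.
Proof. exact: natSinv_lt. Qed.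

Definition approx n t x : V := euler (s n) (k n t) x.

(** [nsteps n t] steps of size [mesh n] reach [t] up to one step. *)
Lemma approx_near x v n m t t' : 0 <= t -> 0 <= t' -> B x v ->
  `|approx n t x - approx m t' x| ^+ 2 <=
  `|v| ^+ 2 * ((`|t - t'| + s n + s m) ^+ 2 + t * s n + t' * s m).
Proof.
move=> t0 t'0 Bxv; apply: le_trans (kobayashi _ _ (s0 n) (s0 m) Bxv) _.
rewrite ler_wpM2l ?sqr_ge0//.
have /andP[h1 h2] := ks n t0; have /andP[h3 h4] := ks m t'0.
have sn := s0 n; have sm := s0 m.
have e1 : (k n t)%:R * s n ^+ 2 <= t * s n.
  by rewrite expr2 mulrA ler_wpM2r// ltW.
have e2 : (k m t')%:R * s m ^+ 2 <= t' * s m.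
  by rewrite expr2 mulrA ler_wpM2r// ltW.
rewrite !lerD//.
rewrite -[leLHS]real_normK ?num_real// ler_sqr ?nnegrE ?addr_ge0 ?(ltW sn) ?(ltW sm)//.
rewrite ler_norml; have := ler_norm (t - t'); have := ler_norm (t' - t).
rewrite (distrC t'); lra.
Qed.

Hypothesis dB : closure (dom B) = setT.

Lemma dom_dense x e : 0 < e -> exists2 y, dom B y & `|x - y| < e.
Proof.
move=> e0; have : closure (dom B) x by rewrite dB.
by move=> /(_ (ball x e) (nbhsx_ballx x e e0))[y [Dy]]; rewrite -ball_normE; exists y.
Qed.

Lemma approx_nexp n t x y : `|approx n t x - approx n t y| <= `|x - y|.
Proof. exact: euler_nexp. Qed.

(** [approx_near] gives this on the domain, and the approximations are
    nonexpansive. *)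
Lemma approx_cauchy t x e : 0 <= t -> 0 < e ->
  exists N : nat, forall i j, (N <= i)%N -> (N <= j)%N ->
    `|approx i t x - approx j t x| < e.
Proof.
move=> t0 e0; have e4 : 0 < e / 4 by rewrite divr_gt0.
have [y [v Byv] xy] := dom_dense x e4.
pose M := `|v| ^+ 2 * (4 + 2 * t) + 1.
have M0 : 0 < M by rewrite ltr_wpDl// mulr_ge0 ?sqr_ge0//; lra.
have d0 : 0 < Num.min 1 ((e / 4) ^+ 2 / M).
  by rewrite lt_min ltr01 divr_gt0// exprn_gt0.
have [N HN] := mesh_lt d0; exists N => i j Ni Nj.
have /andP[si1 siM] : (s i < 1) && (s i < (e / 4) ^+ 2 / M).
  by rewrite -lt_min HN.
have /andP[sj1 sjM] : (s j < 1) && (s j < (e / 4) ^+ 2 / M).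
  by rewrite -lt_min HN.
have yy : `|approx i t y - approx j t y| < e / 4.
  rewrite -ltr_sqr ?nnegrE ?(ltW e4)//.
  apply: le_lt_trans (approx_near i j t0 t0 Byv) _; rewrite subrr normr0 add0r.
  have := s0 i; have := s0 j; move: siM sjM.
  set c := (e / 4) ^+ 2 / M => siM sjM sj0 si0.
  have cE : (e / 4) ^+ 2 = c * M by rewrite /c divfK// gt_eqF.
  have c0 : 0 < c by rewrite (lt_trans si0).
  rewrite cE (@le_lt_trans _ _ (`|v| ^+ 2 * (c * (4 + 2 * t))))//.
    rewrite ler_wpM2l ?sqr_ge0//.
    have h1 : (s i + s j) ^+ 2 <= 4 * c.
      rewrite expr2; apply: (@le_trans _ _ (2 * (s i + s j))).
        by rewrite ler_wpM2r//; lra.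
      by lra.
    have h2 : t * s i <= t * c by rewrite ler_wpM2l// ltW.
    have h3 : t * s j <= t * c by rewrite ler_wpM2l// ltW.
    lra.
  by rewrite [ltRHS](_ : _ = `|v| ^+ 2 * (c * (4 + 2 * t)) + c) ?ltrDl// /M; ring.
have := approx_nexp i t x y; have := approx_nexp j t y x; rewrite (distrC y).
have := ler_distD (approx i t y) (approx i t x) (approx j t x).
have := ler_distD (approx j t y) (approx i t y) (approx j t x).
lra.
Qed.

Definition semigroup t x : V := lim (approx n t x @[n --> \oo]).
Local Notation T := semigroup.

Lemma semigroup_cvg t x : 0 <= t -> approx n t x @[n --> \oo] --> T t x.
Proof.
move=> t0; have [l hl] : exists l : V, approx n t x @[n --> \oo] --> l.
  by refine (hV (x := fun n => approx n t x) _) => e; exact: approx_cauchy.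
by rewrite /semigroup (cvg_lim _ hl).
Qed.

Lemma mesh_cvg : s n @[n --> \oo] --> (0 : R).
Proof. exact: cvg_harmonic. Qed.

Lemma semigroup_nexp t x y : 0 <= t -> `|T t x - T t y| <= `|x - y|.
Proof.
move=> t0.
have h : `|approx n t x - approx n t y| @[n --> \oo] --> `|T t x - T t y|.
  by apply: cvg_norm; apply: cvgB; exact: semigroup_cvg.
apply: (cvgr_to_le h).
by apply: nearW => n; exact: approx_nexp.
Qed.

Lemma semigroup0 x : T 0 x = x.
Proof.
have h := @semigroup_cvg 0 x (lexx 0).
apply: (cvg_unique _ h) => //.
have -> : (fun n => approx n 0 x) = fun=> x.
  by apply/funext => n; rewrite /approx /nsteps mul0r truncn0.
exact: cvg_cst.
Qed.

(** [approx_near] in the limit of vanishing mesh. *)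
Lemma semigroup_lip x v t t' : B x v -> 0 <= t -> 0 <= t' ->
  `|T t x - T t' x| <= `|v| * `|t - t'|.
Proof.
move=> Bxv t0 t'0; rewrite -ler_sqr ?nnegrE ?mulr_ge0// exprMn.
have h1 : `|approx n t x - approx n t' x| @[n --> \oo] --> `|T t x - T t' x|.
  by apply: cvg_norm; apply: cvgB; exact: semigroup_cvg.
have h2 : (`|t - t'| + s n + s n) @[n --> \oo] --> `|t - t'| + 0 + 0.
  by apply: cvgD; [apply: cvgD; [exact: cvg_cst|]|]; exact: mesh_cvg.
have h3 a : a * s n @[n --> \oo] --> a * 0 by apply: cvgMl_tmp; exact: mesh_cvg.
have h4 : `|v| ^+ 2 * ((`|t - t'| + s n + s n) * (`|t - t'| + s n + s n)
    + t * s n + t' * s n) @[n --> \oo] --> `|v| ^+ 2 *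
    ((`|t - t'| + 0 + 0) * (`|t - t'| + 0 + 0) + t * 0 + t' * 0).
  apply: cvgMl_tmp; apply: cvgD; last exact: h3.
  by apply: cvgD; [exact: (cvgM h2 h2)|exact: h3].
move: h4; rewrite !mulr0 !addr0 => h4.
apply: (ler_cvg_to (cvgM h1 h1) h4).
by apply: nearW => n; have := approx_near n n t0 t'0 Bxv; rewrite !expr2.
Qed.

(** Used to extend identities from the domain of [B] to the whole space. *)
Lemma lipschitz_le0_dense (P : V -> R) (C : R) x : 0 <= C ->
  (forall y z, P y <= P z + C * `|y - z|) ->
  (forall y, dom B y -> P y <= 0) -> P x <= 0.
Proof.
move=> C0 lip hP; apply: le_of_le_add_eps => e e0.
have C1 : 0 < C + 1 by lra.
have [y Dy xy] := dom_dense x (divr_gt0 e0 C1).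
have := lip x y; have := hP _ Dy.
have : C * `|x - y| <= e.
  apply: (@le_trans _ _ ((C + 1) * `|x - y|)); first by apply: ler_wpM2r => //; lra.
  by rewrite mulrC -ler_pdivlMr// ltW.
lra.
Qed.

(** On the domain, [nsteps] of the sum and the sum of the [nsteps] differ by a
    bounded number of steps, which [kobayashi] makes negligible. *)
Lemma semigroup_law t t' x : 0 <= t -> 0 <= t' -> T (t + t') x = T t (T t' x).
Proof.
move=> t0 t'0; have tt0 : 0 <= t + t' by rewrite addr_ge0.
apply/eqP; rewrite -subr_eq0 -normr_le0.
apply: (@lipschitz_le0_dense (fun x => `|T (t + t') x - T t (T t' x)|) 2) => //.
  move=> y z; have := semigroup_nexp y z tt0.
  have := semigroup_nexp (T t' z) (T t' y) t0; have := semigroup_nexp z y t'0.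
  rewrite (distrC z y).
  have := ler_distD (T (t + t') z) (T (t + t') y) (T t (T t' y)).
  have := ler_distD (T t (T t' z)) (T (t + t') z) (T t (T t' y)).
  lra.
move=> y [v Byv].
have c1 : approx n (t + t') y @[n --> \oo] --> T (t + t') y.
  exact: semigroup_cvg.
have c2 : approx n t (approx n t' y) @[n --> \oo] --> T t (T t' y).
  have c3 : approx n t (T t' y) @[n --> \oo] --> T t (T t' y).
    exact: semigroup_cvg.
  have c4 : approx n t' y @[n --> \oo] --> T t' y by exact: semigroup_cvg.
  apply/cvgrPdist_lt => e e0.
  have e2 : 0 < e / 2 by rewrite divr_gt0.
  move/cvgrPdist_lt : c3 => /(_ _ e2) c3; move/cvgrPdist_lt : c4 => /(_ _ e2) c4.
  near=> n.
  have a3 : `|T t (T t' y) - approx n t (T t' y)| < e / 2 by near: n.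
  have a4 : `|T t' y - approx n t' y| < e / 2 by near: n.
  have := approx_nexp n t (T t' y) (approx n t' y).
  have := ler_distD (approx n t (T t' y)) (T t (T t' y)) (approx n t (approx n t' y)).
  lra.
have c5 : `|approx n (t + t') y - approx n t (approx n t' y)| @[n --> \oo] -->
    `|T (t + t') y - T t (T t' y)|.
  by apply: cvg_norm; apply: cvgB.
have c6 : `|v| ^+ 2 * (2 * s n * (2 * s n) + (t + t') * s n + (t + t') * s n)
   @[n --> \oo] --> `|v| ^+ 2 * (2 * 0 * (2 * 0) + (t + t') * 0 + (t + t') * 0).
  have m a : a * s n @[n --> \oo] --> a * 0 by apply: cvgMl_tmp; exact: mesh_cvg.
  apply: cvgMl_tmp; apply: cvgD => //; apply: cvgD => //.
  exact: (cvgM (m 2) (m 2)).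
rewrite !mulr0 !addr0 mulr0 in c6.
suff : `|T (t + t') y - T t (T t' y)| ^+ 2 <= 0.
  by rewrite exprn_even_le0//= => /eqP ->.
rewrite expr2; apply: (ler_cvg_to (cvgM c5 c5) c6); apply: nearW => n /=.
rewrite -[X in X <= _]expr2 -[approx n t (approx n t' y)]/(iter _ _ (iter _ _ _)) -iterD -/(euler _ _ _).
apply: le_trans (kobayashi _ _ (s0 n) (s0 n) Byv) _.
rewrite ler_wpM2l ?sqr_ge0//.
have /andP[h1 h2] := ks n t0; have /andP[h3 h4] := ks n t'0.
have /andP[h5 h6] := ks n tt0; have sn := s0 n.
have e1 : (k n (t + t'))%:R * s n ^+ 2 <= (t + t') * s n.
  by rewrite expr2 mulrA ler_wpM2r// ltW.
have e2 : (k n t + k n t')%:R * s n ^+ 2 <= (t + t') * s n.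
  by rewrite expr2 mulrA ler_wpM2r ?(ltW sn)// natrD mulrDl lerD.
rewrite !lerD// -expr2.
rewrite -[leLHS]real_normK ?num_real// ler_sqr ?nnegrE ?mulr_ge0 ?(ltW sn)//.
rewrite natrD ler_norml; lra.
Unshelve. all: by end_near.
Qed.

Lemma semigroup_continuous x : {within `[0, +oo[, continuous (T^~ x)}.
Proof.
apply/within_continuous_epsP => t; rewrite /= in_itv/= andbT => t0 e e0.
have e3 : 0 < e / 3 by rewrite divr_gt0.
have [y [v Byv] xy] := dom_dense x e3.
have v1 : 0 < `|v| + 1 by have := normr_ge0 v; lra.
exists (e / 3 / (`|v| + 1)); first by rewrite divr_gt0.
move=> t'; rewrite /= in_itv/= andbT => t'0 tt'.
have h1 := semigroup_lip Byv t0 t'0.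
have h2 : `|v| * `|t - t'| <= e / 3.
  apply: (@le_trans _ _ ((`|v| + 1) * `|t - t'|)).
    by apply: ler_wpM2r => //; lra.
  by rewrite mulrC -ler_pdivlMr// ltW.
have := semigroup_nexp x y t0; have := semigroup_nexp y x t'0.
rewrite (distrC y x).
have := ler_distD (T t y) (T t x) (T t' x).
have := ler_distD (T t' y) (T t y) (T t' x).
lra.
Qed.

Lemma semigroup_nonexpansive : nonexpansive_semigroup T.
Proof.
split; [exact: semigroup0| |exact: semigroup_continuous|].
  by move=> t t' x t0 t'0; exact: semigroup_law.
by move=> t x y; exact: semigroup_nexp.
Qed.

Lemma yosida_lipschitz l x y : 0 < l ->
  `|Y l x - Y l y| <= 2 * l^-1 * `|x - y|.
Proof.
move=> l0; rewrite /yosida -scalerBr normrZ ger0_norm ?invr_ge0 ?(ltW l0)//.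
rewrite (mulrC 2) -mulrA ler_wpM2l ?invr_ge0 ?(ltW l0)//.
have -> : x - J l x - (y - J l y) = (x - y) - (J l x - J l y).
  by rewrite !opprB addrACA [RHS]addrACA (addrC (- y)).
have := resolvent_nexp hip hV hB x y l0.
have := ler_normB (x - y) (J l x - J l y); lra.
Qed.

(** The Yosida approximations at the Euler points are at most |v| by
    [euler_slope]; so are those at the limit point, and [yosida_bounded] applies. *)
Lemma semigroup_dom x v t : 0 <= t -> B x v ->
  exists2 w, B (T t x) w & `|w| <= `|v|.
Proof.
move=> t0 Bxv; have [|y [By yv _]] := @yosida_bounded _ _ _ hip hV _ hB (T t x) `|v|.
  move=> l l0; have c1 : approx n t x @[n --> \oo] --> T t x by exact: semigroup_cvg.
  have c2 : Y l (approx n t x) @[n --> \oo] --> Y l (T t x).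
    apply/cvgrPdist_le => e e0.
    move/cvgrPdist_le : c1 => /(_ (e / (2 * l^-1))) h.
    have li : 0 < 2 * l^-1 by rewrite mulr_gt0// invr_gt0.
    have {}h := h (divr_gt0 e0 li).
    near=> n; apply: le_trans (yosida_lipschitz _ _ l0) _.
    by rewrite mulrC -ler_pdivlMr//; near: n.
  apply: (cvgr_to_le (cvg_norm c2)); apply: nearW => n.
  have [w Bw wv] := euler_slope (k n t) (s0 n) Bxv.
  by apply: le_trans wv; exact: (yosida_le hip hV hB).
by exists y.
Unshelve. all: by end_near.
Qed.

(** Discrete form of |T_t x - a|^2 <= |x - a|^2 - 2 int_0^t (b, T_s x - a) ds,
    with T_s x replaced by x at a cost quadratic in the time. *)
Lemma euler_energy h j x v a b : 0 < h -> B x v -> B a b ->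
  `|euler h j x - a| ^+ 2 <= `|x - a| ^+ 2 - 2 * (j%:R * h * ip b (x - a))
     + 2 * (`|b| * `|v| * (j%:R * h) ^+ 2).
Proof.
move=> hp Bxv Bab; elim: j => [|j IH].
  by rewrite /= !mul0r expr0n/=; lra.
have step : `|euler h j.+1 x - a| ^+ 2 <=
    `|euler h j x - a| ^+ 2 - 2 * (h * ip b (euler h j.+1 x - a)).
  have := hB.1 _ _ _ _ (yosidaP hip hV hB (euler h j x) hp) Bab.
  have -> : euler h j x - a = (euler h j.+1 x - a) + h *: Y h (euler h j x).
    by rewrite yosidaE// [RHS]addrC addrA subrK.
  rewrite -[J h (euler h j x)]/(euler h j.+1 x).
  move: (euler h j.+1 x - a) (Y h (euler h j x)) => p q; rewrite !(ip_sqrE hip).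
  have h1 : 0 <= h * (h * ip q q) by rewrite !mulr_ge0 ?(ip_ge0 hip) ?(ltW hp).
  move=> h0; have h2 : 0 <= h * ip (q - b) p by rewrite mulr_ge0 ?(ltW hp).
  by move: h2; rewrite !ipE (ipC hip p q); lra.
have low : - (`|b| * (j.+1%:R * h * `|v|)) + ip b (x - a)
    <= ip b (euler h j.+1 x - a).
  have -> : euler h j.+1 x - a = (euler h j.+1 x - x) + (x - a).
    by rewrite addrA subrK.
  rewrite (ipDr hip (euler h j.+1 x - x)) lerD2r; apply: le_trans (ip_ge hip _ _).
  rewrite lerN2 ler_wpM2l// distrC; exact: euler_dist.
have h3 : 0 <= h * (ip b (euler h j.+1 x - a)
    - (- (`|b| * (j.+1%:R * h * `|v|)) + ip b (x - a))).
  by rewrite mulr_ge0 ?(ltW hp)// subr_ge0.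
apply: (le_trans step); apply: (le_trans (lerD IH (lexx _))).
move: h3; rewrite -!natr1.
have h4 : 0 <= `|b| * `|v| * h ^+ 2 * j%:R by rewrite !mulr_ge0// ltW.
move: (ip b (euler h j.+1 x - a)) (ip b (x - a)) (`|x - a| ^+ 2) (j%:R) h4 => P Q W r h4.
lra.
Qed.

Lemma semigroup_energy t x v a b : 0 <= t -> B x v -> B a b ->
  t * ip b (x - a) - `|b| * `|v| * t ^+ 2 <= ip (x - T t x) (x - a).
Proof.
move=> t0 Bxv Bab.
have c0 : (k n t)%:R * s n @[n --> \oo] --> t.
  apply/cvgrPdist_lt => e /mesh_lt[N HN]; exists N => // n /= /HN sn.
  have /andP[h1 h2] := ks n t0.
  by rewrite ger0_norm ?subr_ge0//; lra.
have c1 : approx n t x @[n --> \oo] --> T t x by exact: semigroup_cvg.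
have c2 : `|approx n t x - a| @[n --> \oo] --> `|T t x - a|.
  by apply: cvg_norm; apply: cvgB => //; exact: cvg_cst.
have c3 : `|x - a| ^+ 2 - 2 * ((k n t)%:R * s n * ip b (x - a))
     + 2 * (`|b| * `|v| * ((k n t)%:R * s n * ((k n t)%:R * s n))) @[n --> \oo] -->
    `|x - a| ^+ 2 - 2 * (t * ip b (x - a)) + 2 * (`|b| * `|v| * (t * t)).
  apply: cvgD; last first.
    by apply: cvgMl_tmp; apply: cvgMl_tmp; exact: (cvgM c0 c0).
  apply: cvgB; first exact: cvg_cst.
  by apply: cvgMl_tmp; exact: (cvgMr_tmp (b := ip b (x - a)) c0).
have : `|T t x - a| * `|T t x - a| <=
    `|x - a| ^+ 2 - 2 * (t * ip b (x - a)) + 2 * (`|b| * `|v| * (t * t)).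
  apply: (ler_cvg_to (cvgM c2 c2) c3); apply: nearW => n /=.
  by have := euler_energy (k n t) (s0 n) Bxv Bab; rewrite !expr2.
rewrite -!expr2.
have -> : T t x - a = (x - a) - (x - T t x).
  by rewrite opprB [RHS]addrC addrA subrK.
move: (x - T t x) (x - a) => p q; rewrite !(ip_sqrE hip) !ipE (ipC hip q p).
have := ip_ge0 hip p; lra.
Qed.

Lemma semigroup_step_bound t x v : 0 < t -> B x v ->
  `|t^-1 *: (x - T t x)| <= `|v|.
Proof.
move=> t0 Bxv; rewrite normrZ gtr0_norm ?invr_gt0// mulrC ler_pdivrMr//.
have := semigroup_lip Bxv (lexx 0) (ltW t0).
by rewrite semigroup0 sub0r normrN (gtr0_norm t0).
Qed.

(** [semigroup_energy] with [(a, b)] the resolvent and the Yosida approximation at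
    [w]: the difference quotient is close to the latter when its norm is close to
    that of [v] and [h] is small against [l]. The base point [z] may move with
    [h], as a left derivative requires. *)
Lemma derivative_estimate h l z v w (L : R) : 0 < h -> 0 < l ->
  B z v -> `|v| <= L -> `|Y l w| <= L -> `|z - w| <= h * L ->
  `|h^-1 *: (z - T h z) - Y l w| ^+ 2 <=
    `|v| ^+ 2 - `|Y l w| ^+ 2 + 6 * (h * L ^+ 2 / l).
Proof.
move=> h0 l0 Bzv vL bL zw.
have L0 : 0 <= L by exact: le_trans vL.
have := semigroup_energy (ltW h0) Bzv (yosidaP hip hV hB w l0).
set D := h^-1 *: (z - T h z).
have -> : z - T h z = h *: D by rewrite /D scalerA divff ?gt_eqF// scale1r.
have DL : `|D| <= `|v| by exact: semigroup_step_bound.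
have -> : z - J l w = (z - w) + l *: Y l w by rewrite yosidaE// addrA subrK.
clearbody D; move: (Y l w) bL => b bL.
move: (z - w) zw => p pL.
rewrite (ipZl hip) (_ : `|b| * `|v| * h ^+ 2 = h * (h * (`|b| * `|v|))); last by ring.
rewrite -mulrBr ler_pM2l// => e1.
have e2 : ip D p <= L * (h * L).
  apply: le_trans (ip_le hip _ _) _; apply: ler_pM => //; exact: le_trans vL.
have e3 : - (L * (h * L)) <= ip b p.
  by apply: le_trans (ip_ge hip _ _); rewrite lerN2; apply: ler_pM.
have e4 : h * (`|b| * `|v|) <= h * (L * L).
  by rewrite ler_wpM2l ?(ltW h0)//; apply: ler_pM.
have e5 : l * ip b b - 3 * (h * L ^+ 2) <= l * ip D b.
  by move: e1; rewrite !ipE; lra.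
have e6 : ip b b - 3 * (h * L ^+ 2 / l) <= ip D b.
  rewrite -(ler_pM2l l0); apply: le_trans e5.
  by rewrite le_eqVlt; apply/orP; left; apply/eqP; field; rewrite gt_eqF.
have e7 : ip D D <= `|v| ^+ 2 by rewrite -(ip_sqrE hip) ler_sqr ?nnegrE.
by move: e6 e7; rewrite !(ip_sqrE hip b) (ip_sqrE hip (D - b)) !ipE (ipC hip b D); lra.
Qed.

(** First [l] is chosen such that the Yosida approximation is close to the minimal
    section at [w], then [d] small against [l]. *)
Lemma semigroup_slope w (L e : R) : dom B w -> `|B0 w| <= L -> 0 < e ->
  exists2 d : R, 0 < d & forall h z v, 0 < h -> h < d -> B z v -> `|v| <= L ->
    `|v| <= `|B0 w| + d -> `|z - w| <= h * L ->
    `|h^-1 *: (z - T h z) - B0 w| < e.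
Proof.
move=> Dw wL e0; have [Bw _ ylim] := min_section_spec hip hV hB Dw.
have L0 : 0 <= L by exact: le_trans wL.
pose M := 2 * L + 1; have M0 : 0 < M by rewrite /M; lra.
have eta0 : 0 < Num.min (e / 2) (e ^+ 2 / 16 / M).
  by rewrite lt_min !divr_gt0// exprn_gt0.
have [l l0] := ylim _ eta0; rewrite lt_min => /andP[b1 b2].
have d0 : 0 < Num.min (e ^+ 2 / 16 / M) (e ^+ 2 / 16 / (6 * (L ^+ 2 / l) + 1)).
  have : 0 <= L ^+ 2 / l by rewrite divr_ge0 ?sqr_ge0 ?ltW.
  by move=> ?; rewrite lt_min !divr_gt0 ?exprn_gt0//; lra.
set d := Num.min _ _ in d0; exists d => //.
have d1 : d <= e ^+ 2 / 16 / M by rewrite ge_min lexx.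
have d2 : d <= e ^+ 2 / 16 / (6 * (L ^+ 2 / l) + 1) by rewrite ge_min lexx orbT.
move=> h z v h0 hd Bzv vL vd zw.
have yL : `|Y l w| <= `|B0 w| by exact: (yosida_le hip hV hB).
have := derivative_estimate h0 l0 Bzv vL (le_trans yL wL) zw.
have e1 : `|v| - `|Y l w| <= d + `|B0 w - Y l w|.
  by have := ler_normD (B0 w - Y l w) (Y l w); rewrite subrK; lra.
have yz := normr_ge0 (Y l w).
have q0 : 0 <= L ^+ 2 / l by rewrite divr_ge0 ?sqr_ge0 ?ltW.
have e2 : `|v| ^+ 2 - `|Y l w| ^+ 2 <= (d + `|B0 w - Y l w|) * M.
  rewrite subr_sqr; apply: (@le_trans _ _ ((d + `|B0 w - Y l w|) * (`|v| + `|Y l w|))).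
    by rewrite ler_wpM2r// addr_ge0.
  by rewrite ler_wpM2l ?addr_ge0 ?(ltW d0)// /M; lra.
have e3 : d * M <= e ^+ 2 / 16 by rewrite -ler_pdivlMr.
have e4 : `|B0 w - Y l w| * M < e ^+ 2 / 16 by rewrite -ltr_pdivlMr.
have e5 : 6 * (h * L ^+ 2 / l) <= e ^+ 2 / 16.
  have : d * (6 * (L ^+ 2 / l) + 1) <= e ^+ 2 / 16 by rewrite -ler_pdivlMr//; lra.
  have : h * (L ^+ 2 / l) <= d * (L ^+ 2 / l) by rewrite ler_wpM2r// ltW.
  rewrite -(mulrA h); lra.
move=> e6.
have e7 : `|h^-1 *: (z - T h z) - Y l w| < e / 2.
  rewrite -ltr_sqr ?nnegrE ?divr_ge0 ?(ltW e0)//; apply: (le_lt_trans e6).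
  by rewrite exprMn; have := exprn_gt0 2 e0; lra.
have := ler_distD (Y l w) (h^-1 *: (z - T h z)) (B0 w); rewrite (distrC (Y l w)); lra.
Qed.

Lemma min_section_semigroup x t : dom B x -> 0 <= t ->
  dom B (T t x) /\ `|B0 (T t x)| <= `|B0 x|.
Proof.
move=> Dx t0; have [Bx _ _] := min_section_spec hip hV hB Dx.
have [w Bw wx] := semigroup_dom t0 Bx.
have DT : dom B (T t x) by exists w.
split=> //; have [_ hmin _] := min_section_spec hip hV hB DT.
exact: le_trans (hmin _ Bw) wx.
Qed.

Lemma semigroup_right_derivative x : dom B x ->
  h^-1 *: (x - T h x) @[h --> 0^'+] --> B0 x.
Proof.
move=> Dx; have [Bx _ _] := min_section_spec hip hV hB Dx.
apply/cvgrPdist_lt => e e0.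
have [d d0 hd] := semigroup_slope Dx (lexx `|B0 x|) e0.
near=> h; rewrite distrC.
have h0 : 0 < h by near: h; exact: nbhs_right_gt.
apply: (hd h x (B0 x)) => //.
- by rewrite lerDl ltW.
- by rewrite subrr normr0 mulr_ge0// ltW.
Unshelve. all: by end_near.
Qed.

(** A left difference quotient at [t] is a right one at the earlier point
    T_(t+h) x. The hypothesis bounds the minimal section there by almost its norm
    at [t], which is what [semigroup_slope] asks for. *)
Lemma semigroup_derivative x t : dom B x -> 0 < t ->
  (forall d, 0 < d -> exists2 t', 0 <= t' < t &
     `|B0 (T t' x)| <= `|B0 (T t x)| + d) ->
  h^-1 *: (T (h + t) x - T t x) @[h --> 0^'] --> - B0 (T t x).
Proof.
move=> Dx t0 jump; have [Bx _ _] := min_section_spec hip hV hB Dx.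
have [DT TL] := min_section_semigroup Dx (ltW t0).
apply/cvgrPdist_lt => e e0.
have [d d0 hd] := semigroup_slope DT TL e0.
have [t' /andP[t'0 t't] ht'] := jump d d0.
have r0 : 0 < Num.min d (t - t') by rewrite lt_min d0 subr_gt0.
exists (Num.min d (t - t')) => //= h; rewrite /ball_/= sub0r normrN lt_min => /andP[h1 h2] hn0.
rewrite -opprD normrN addrC.
have [hlt|hgt|h00] := ltgtP h 0; last by rewrite h00 eqxx in hn0.
  rewrite ltr0_norm// in h1 h2.
  have k0 : 0 < - h by rewrite oppr_gt0.
  have th0 : 0 <= h + t by lra.
  have [DTh ThL] := min_section_semigroup Dx th0.
  have [BTh _ _] := min_section_spec hip hV hB DTh.
  have Tk : T (- h) (T (h + t) x) = T t x by rewrite -semigroup_law ?(ltW k0)// addKr.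
  have -> : h^-1 *: (T (h + t) x - T t x) + B0 (T t x) =
      - ((- h)^-1 *: (T (h + t) x - T (- h) (T (h + t) x)) - B0 (T t x)).
    by rewrite Tk invrN scaleNr opprB opprK addrC.
  rewrite normrN; apply: hd BTh ThL _ _ => //.
    have tt' : 0 <= h + t - t' by lra.
    have [DT' _] := min_section_semigroup Dx t'0.
    have [_] := min_section_semigroup DT' tt'.
    by rewrite -semigroup_law// subrK; lra.
  have := semigroup_lip Bx th0 (ltW t0).
  by rewrite addrK ltr0_norm// mulrC.
rewrite gtr0_norm// in h1 h2.
have [BTt _ _] := min_section_spec hip hV hB DT.
have -> : h^-1 *: (T (h + t) x - T t x) + B0 (T t x) =
    - (h^-1 *: (T t x - T h (T t x)) - B0 (T t x)).
  by rewrite -semigroup_law ?(ltW hgt) ?(ltW t0)// opprB -scalerN opprB addrC.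
rewrite normrN; apply: hd BTt TL _ _ => //.
  by rewrite lerDl ltW.
by rewrite subrr normr0 mulr_ge0 ?(ltW hgt).
Qed.

(** The norm of the minimal section is nonincreasing along an orbit, so it has
    only countably many left jumps; [semigroup_derivative] applies elsewhere. *)
Lemma semigroup_generator : generator ip T B.
Proof.
split=> // x Dx; have [Bx _ _] := min_section_spec hip hV hB Dx.
split; first exact: semigroup_continuous.
- move=> a b a0 ab e e0.
  have L1 : 0 < `|B0 x| + 1 by have := normr_ge0 (B0 x); lra.
  exists (e / (`|B0 x| + 1)); first by rewrite divr_gt0.
  move=> n p q hpq _ hsum.
  apply: (@le_lt_trans _ _ (\sum_(i < n) (`|B0 x| + 1) * (q i - p i))).
    apply: ler_sum => i _; have [ap pq _] := hpq i.
    have p0 : 0 <= p i by lra.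
    have q0 : 0 <= q i by lra.
    apply: le_trans (semigroup_lip Bx q0 p0) _.
    by rewrite ger0_norm ?subr_ge0// ler_wpM2r ?subr_ge0//; lra.
  by rewrite -mulr_sumr mulrC -ltr_pdivlMr.
pose N t := `|B0 (T t x)|.
have Ndecr (t t' : R) : 0 <= t -> t <= t' -> N t' <= N t.
  move=> t0 tt'; have [Dt _] := min_section_semigroup Dx t0.
  have [//|_] := @min_section_semigroup (T t x) (t' - t) Dt _; first by rewrite subr_ge0.
  by rewrite -semigroup_law ?subr_ge0// subrK.
have := countable_lebesgue_measure0 (countable_left_jumps Ndecr).
set E := (X in lebesgue_measure X) => E0.
have nE : (@lebesgue_measure R).-negligible E.
  apply/negligibleP => //.
  apply: countable_measurable => [t|]; [exact: measurable_set1|exact: countable_left_jumps].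
apply: negligibleS nE => t /=; apply: contra_notP => jump t0.
have hd : h^-1 *: (T (h + t) x - T t x) @[h --> 0^'] --> - B0 (T t x).
  apply: semigroup_derivative => // d d0; apply: contrapT => nj; apply: jump.
  by split=> // hj; apply: nj; exact: hj.
split.
  apply/cvg_ex; exists (- B0 (T t x)); apply: cvg_trans hd.
  apply: near_eq_cvg; apply: nearW => h /=.
  by rewrite [h *: 1]mulr1.
have [DT _] := min_section_semigroup Dx (ltW t0).
have [BT _ _] := min_section_spec hip hV hB DT.
by rewrite /derive1 (cvg_lim _ hd)// opprK.
Qed.

End generation.

(** * Uniqueness of strong solutions *)

(** The supremum of the points reached from [a] is reached and is [b]: a step
    starts slightly to the left of any point and ends slightly to its right. *)
Lemma interval_induction (R : realType) (P : R -> Prop) (a b : R) : a <= b ->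
  P a ->
  (forall c, a <= c <= b -> exists2 d : R, 0 < d & forall x y, a <= x <= c ->
     c <= y <= b -> c - d < x -> y < c + d -> P x -> P y) -> P b.
Proof.
move=> ab Pa step; pose S : set R := [set t | a <= t <= b /\ P t].
have Sa : S a by split=> //; rewrite lexx.
have supS : has_sup S by split; [exists a|exists b => t [/andP[]]].
have ac : a <= sup S by apply: ub_le_sup => //; exact: supS.2.
have cb : sup S <= b by apply: ge_sup; [exists a|move=> t [/andP[]]].
have [|d d0 hd] := step (sup S); first by rewrite ac cb.
have [x [/andP[ax xb] Px] dx] := sup_adherent d0 supS.
have xc : x <= sup S by apply: ub_le_sup; [exact: supS.2|split=> //; rewrite ax].
have Py y : sup S <= y <= b -> y < sup S + d -> P y.
  by move=> yb yd; apply: (hd x y) => //; rewrite ax.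
have [bc|cb'] := leP b (sup S + d / 2).
  by apply: Py; [rewrite cb lexx|lra].
have : S (sup S + d / 2) by split; [lra|apply: Py; lra].
by move=> /(ub_le_sup supS.2); lra.
Qed.

Section ac_decreasing.
Context (R : realType) (V : normedModType R).

Lemma null_set_cover (E : set R) (d : R) :
  (@lebesgue_measure R).-negligible E -> 0 < d ->
  exists U : set R, [/\ open U, E `<=` U & (lebesgue_measure U < d%:E)%E].
Proof.
move=> [A [mA A0 EA]] d0.
have [|U [oU AU Ud]] := @lebesgue_regularity_outer R A d mA _ d0.
  by rewrite [X in (X < _)%E](_ : _ = 0%E).
exists U; split=> //; first exact: subset_trans AU.
have mU : measurable U by exact: open_measurable.
rewrite -(setDUK AU); apply: le_lt_trans (measureU2 _ mA (measurableD mU mA)) _.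
by rewrite [X in (X + _)%E](_ : _ = 0%E)// add0e.
Qed.

(** An absolutely continuous function whose derivative is nonpositive almost
    everywhere is nonincreasing; real induction replaces a covering theorem. The
    null set lies in an open set [U] of small measure. Near a point outside [U],
    [g] grows by at most a small multiple of the length; near a point of [U], a
    whole interval is added to a list [s] of disjoint intervals in [U], over which
    the growth of [g] is bounded by that of [w], small by absolute continuity. The
    application is to [g = |w|^2], whose growth is dominated by that of [w]. *)
Lemma ac_nonincreasing (a b C : R) (w : R -> V) (g : R -> R) (E : set R) :
  a <= b -> 0 <= C -> absolutely_continuous a b w ->
  (forall x y, a <= x -> x <= y -> y <= b -> g y - g x <= C * `|w y - w x|) ->
  (@lebesgue_measure R).-negligible E ->
  (forall t, a <= t <= b -> ~ E t -> forall e, 0 < e ->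
     exists2 d, 0 < d & forall x y, x <= t <= y -> t - d < x -> y < t + d ->
       g y - g x <= e * (y - x)) ->
  g b <= g a.
Proof.
move=> ab C0 acw gw nE good; apply: le_of_le_add_eps => e e0.
have e1 : 0 < e / 2 / (b - a + 1) by rewrite !divr_gt0//; lra.
have C1 : 0 < C + 1 by lra.
have [d d0 hd] := acw _ (divr_gt0 (divr_gt0 e0 (ltr0n R 2)) C1).
have [U [oU EU Ud]] := null_set_cover nE d0.
have mU : measurable U by exact: open_measurable.
pose inc (s : seq (R * R)) := \sum_(p <- s) `|w p.2 - w p.1|.
pose P t := exists s : seq (R * R),
  [/\ pairwise (fun p q => p.2 <= q.1) s,
      all (fun p => [&& a <= p.1, p.1 <= p.2 & p.2 <= t]) s,
      g t - g a <= e / 2 / (b - a + 1) * (t - a) + C * inc s &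
      ((\sum_(p <- s) (p.2 - p.1))%:E <= lebesgue_measure (U `&` `[a, t]%classic))%E].
have Pb : P b.
  apply: (interval_induction ab).
    by exists [::]; split => //; rewrite /inc !big_nil ?measure_ge0// !subrr mulr0 mulr0 addr0.
  move=> c /andP[ac cb]; have [Uc|nUc] := pselect (U c).
    have /nbhs_ballP[r /= r0 rU] : nbhs c U by exact: open_nbhs_nbhs.
    exists r => // x y /andP[ax xc] /andP[cy yb] rx ry [s [s1 s2 s3 s4]].
    have xy : x <= y by exact: le_trans cy.
    exists (rcons s (x, y)); split.
    - rewrite pairwise_rcons s1 andbT; apply: sub_all s2 => p /and3P[_ _ px].
      by rewrite /= px.
    - rewrite all_rcons /= ax xy lexx /=; apply: sub_all s2 => p /and3P[-> -> px] /=.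
      exact: le_trans xy.
    - have := gw _ _ ax xy yb; rewrite /inc big_rcons/=.
      have : 0 <= e / 2 / (b - a + 1) * (y - x) by rewrite mulr_ge0 ?(ltW e1) ?subr_ge0.
      move: s3; rewrite /inc; lra.
    - rewrite big_rcons/= EFinD.
      have xyU : `]x, y]%classic `<=` U.
        move=> z; rewrite /= in_itv/= => /andP[xz zy]; apply: rU.
        by rewrite /ball/= ltr_norml; apply/andP; split; lra.
      have -> : U `&` `[a, y] = (U `&` `[a, x]) `|` `]x, y]%classic.
        apply/seteqP; split=> [z [Uz]|z [[Uz]|zxy]]; rewrite /= !in_itv/=.
        + move=> /andP[az zy]; have [zx|xz] := leP z x; [left|right].
            by split=> //; rewrite az.
          by [].
        + by move=> /andP[-> zx]; split=> //=; exact: le_trans xy.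
        + split; first exact: xyU.
          move: zxy; rewrite /= in_itv/= => /andP[xz ->].
          by rewrite andbT ltW// (le_lt_trans ax).
      rewrite measureU//; first last.
      + rewrite -subset0 => z [[_]] /=; rewrite !in_itv/=.
        by move=> /andP[_ zx] /andP[/(le_lt_trans zx)]; rewrite ltxx.
      + exact: measurableI.
      have mE : lebesgue_measure `]x, y]%classic = (y - x)%:E :> \bar R.
        rewrite lebesgue_measure_itv/= lte_fin.
        by move: xy; rewrite le_eqVlt => /predU1P[->|->]; rewrite ?ltxx ?subrr ?EFinB.
      by apply: leeD => //; rewrite -mE.
  have cab : a <= c <= b by rewrite ac.
  have [r r0 hr] := good c cab (fun h => nUc (EU _ h)) _ e1.
  exists r => // x y /andP[ax xc] /andP[cy yb] rx ry [s [s1 s2 s3 s4]].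
  exists s; split=> //.
  - by apply: sub_all s2 => p /and3P[-> -> px] /=; rewrite (le_trans px)// (le_trans xc).
  - have := hr x y _ rx ry; rewrite xc cy => /(_ isT) h.
    by move: s3 h; rewrite !mulrBr; lra.
  - apply: (le_trans s4); apply: le_measure; rewrite ?inE; [exact: measurableI..|].
    move=> z [Uz] /=; rewrite !in_itv/= => /andP[-> zx]; split=> //.
    by rewrite /= (le_trans zx)// (le_trans xc).
have [s [s1 s2 s3 s4]] := Pb.
pose x (i : 'I_(size s)) := (nth (0, 0) s i).1.
pose y (i : 'I_(size s)) := (nth (0, 0) s i).2.
have /(_ _ x y) := hd; have hxy i : [/\ a <= x i, x i <= y i & y i <= b].
  by have /allP/(_ _ (mem_nth (0, 0) (ltn_ord i)))/and3P[] := s2.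
have sepij (i j : 'I_(size s)) : (i < j)%N -> y i <= x j.
  by move=> ij; have /(pairwiseP (0, 0)) := s1; apply => //; rewrite inE.
have tri : trivIset setT (fun i => `]x i, y i[%classic).
  move=> i j _ _ [z [/=]]; rewrite !in_itv/= => /andP[z1 z2] /andP[z3 z4].
  have [ij|ji|/val_inj//] := ltngtP i j.
    by have := lt_trans z3 z2; rewrite ltNge sepij.
  by have := lt_trans z1 z4; rewrite ltNge sepij.
have sumE (f : R * R -> R) : \sum_(i < size s) f (nth (0, 0) s i) = \sum_(p <- s) f p.
  by rewrite (big_nth (0, 0)) big_mkord.
have lens : \sum_(i < size s) (y i - x i) < d.
  rewrite (sumE (fun p => p.2 - p.1)) -lte_fin; apply: le_lt_trans s4 _.
  apply: le_lt_trans Ud; apply: le_measure; rewrite ?inE; [exact: measurableI|exact: mU|exact: subIsetl].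
move=> /(_ hxy tri lens); rewrite (sumE (fun p => `|w p.2 - w p.1|)) => incs.
have : (C + 1) * inc s < e / 2 by rewrite mulrC -ltr_pdivlMr.
have : 0 <= inc s by apply: sumr_ge0.
have : e / 2 / (b - a + 1) * (b - a) <= e / 2.
  rewrite -mulrA ler_piMr ?divr_ge0 ?(ltW e0)// mulrC ler_pdivrMr; lra.
move: s3; lra.
Qed.

End ac_decreasing.

Section strong_solution_uniqueness.
Context (R : realType) (V : normedModType R) (ip : V -> V -> R).
Hypothesis hip : inner_product ip.
Implicit Types (B : V -> set V) (u v w : R -> V).

Lemma difference_quotient_continuous w (t : R) (l : V) :
  (h^-1 *: (w (h + t) - w t) @[h --> 0^'] --> l) ->
  w (h + t) @[h --> 0^'] --> w t.
Proof.
move=> hl.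
have hid : (h : R) @[h --> 0^'] --> (0 : R) by apply: cvg_within_filter; exact: cvg_id.
have hc : h *: (h^-1 *: (w (h + t) - w t)) + w t @[h --> 0^'] --> 0 *: l + w t.
  by apply: cvgD; [apply: cvgZ|exact: cvg_cst].
rewrite scale0r add0r in hc; apply: cvg_trans hc; apply: near_eq_cvg.
near=> h; rewrite scalerA divff ?scale1r ?subrK//.
by near: h; exact: nbhs_dnbhs_neq.
Unshelve. all: by end_near.
Qed.

(** The derivative of |w|^2 at [t] is 2 (l, w t). Straddling intervals are those
    that occur in [ac_nonincreasing]. *)
Lemma sqr_norm_straddle w (t e : R) (l : V) :
  (h^-1 *: (w (h + t) - w t) @[h --> 0^'] --> l) -> ip l (w t) <= 0 -> 0 < e ->
  exists2 d : R, 0 < d & forall x y, x <= t <= y -> t - d < x -> y < t + d ->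
    `|w y| ^+ 2 - `|w x| ^+ 2 <= e * (y - x).
Proof.
move=> hl l0 e0; have wc := difference_quotient_continuous hl.
have hc : ip (h^-1 *: (w (h + t) - w t)) (w (h + t) + w t) @[h --> 0^'] -->
    ip l (w t + w t).
  by apply: (cvg_ip hip) => //; apply: cvgD => //; exact: cvg_cst.
have : \forall h \near 0^',
    ip (h^-1 *: (w (h + t) - w t)) (w (h + t) + w t) < e.
  apply: (cvgr_lt (ip l (w t + w t))) => //.
  by rewrite (ipDr hip); lra.
move=> [d /= d0 hd].
have q h : `|h| < d -> h != 0 ->
    h^-1 * (`|w (h + t)| ^+ 2 - `|w t| ^+ 2) < e.
  move=> hh h0; have := hd h; rewrite /ball_/= sub0r normrN => /(_ hh h0).
  rewrite (ipZl hip); have -> // : ip (w (h + t) - w t) (w (h + t) + w t) =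
    `|w (h + t)| ^+ 2 - `|w t| ^+ 2.
  rewrite !(ip_sqrE hip) (ipBl hip) !(ipDr hip) (ipC hip (w t) (w (h + t))); ring.
have right y : t <= y -> y < t + d -> `|w y| ^+ 2 - `|w t| ^+ 2 <= e * (y - t).
  rewrite le_eqVlt => /predU1P[<-|ty] yd; first by rewrite !subrr mulr0.
  have yt : 0 < y - t by rewrite subr_gt0.
  have := q (y - t); rewrite subrK gtr0_norm// gt_eqF// => /(_ _ isT) h.
  have {}h : (y - t)^-1 * (`|w y| ^+ 2 - `|w t| ^+ 2) < e by apply: h; lra.
  by rewrite -ler_pdivrMr// mulrC ltW.
have left x : x <= t -> t - d < x -> `|w t| ^+ 2 - `|w x| ^+ 2 <= e * (t - x).
  rewrite le_eqVlt => /predU1P[->|xt] dx; first by rewrite !subrr mulr0.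
  have yt : 0 < t - x by rewrite subr_gt0.
  have := q (x - t); rewrite subrK distrC gtr0_norm// lt_eqF ?subr_lt0// => /(_ _ isT) h.
  have {}h : (x - t)^-1 * (`|w x| ^+ 2 - `|w t| ^+ 2) < e by apply: h; lra.
  rewrite -ler_pdivrMr// mulrC ltW// (le_lt_trans _ h)//.
  by rewrite -(opprB t x) invrN -(opprB (`|w t| ^+ 2)) mulrNN.
exists d => // x y /andP[xt ty] dx dy.
by have := right y ty dy; have := left x xt dx; lra.
Qed.

Lemma absolutely_continuousB (a b : R) u v : absolutely_continuous a b u ->
  absolutely_continuous a b v -> absolutely_continuous a b (fun t => u t - v t).
Proof.
move=> hu hv e e0; have e2 : 0 < e / 2 by rewrite divr_gt0.
have [d1 d10 h1] := hu _ e2; have [d2 d20 h2] := hv _ e2.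
exists (Num.min d1 d2); first by rewrite lt_min d10.
move=> n x y hxy tri; rewrite lt_min => /andP[s1 s2].
have := h1 n x y hxy tri s1; have := h2 n x y hxy tri s2.
suff : \sum_(i < n) `|u (y i) - v (y i) - (u (x i) - v (x i))| <=
  \sum_(i < n) `|u (y i) - u (x i)| + \sum_(i < n) `|v (y i) - v (x i)| by lra.
rewrite -big_split/=; apply: ler_sum => i _.
have -> : u (y i) - v (y i) - (u (x i) - v (x i)) =
    (u (y i) - u (x i)) - (v (y i) - v (x i)).
  by rewrite !opprB addrACA [RHS]addrACA (addrC (- v _)).
exact: ler_normB.
Qed.

(** By monotonicity |u - v|^2 has a nonpositive derivative almost everywhere.
    Absolute continuity holds away from 0 only, hence the passage from [a > 0] to
    0 by continuity. *)
Lemma strong_solution_unique B u v : monotone_op ip B ->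
  strong_solution B u -> strong_solution B v -> u 0 = v 0 ->
  forall t, 0 <= t -> u t = v t.
Proof.
move=> mB [cu acu dau] [cv acv dav] uv0 t.
rewrite le_eqVlt => /predU1P[<-//|t0].
pose w s := u s - v s.
have cw : {within `[0, +oo[, continuous w}.
  by move=> z; apply: cvgB; [exact: cu|exact: cv].
have [E0 nE0 hE0] : exists2 E, (@lebesgue_measure R).-negligible E &
   forall s, 0 < s -> ~ E s -> exists2 l : V,
      h^-1 *: (w (h + s) - w s) @[h --> 0^'] --> l & ip l (w s) <= 0.
  exists (~` [set s : R | 0 < s -> derivable (u : R^o -> V) s 1 /\ B (u s) (- derive1 u s)]
    `|` ~` [set s : R | 0 < s -> derivable (v : R^o -> V) s 1 /\ B (v s) (- derive1 v s)]).
    exact: negligibleU.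
  move=> s s0 /not_orP[/contrapT /(_ s0) [du Bu] /contrapT /(_ s0) [dv Bv]].
  have dd (z : R -> V) : derivable (z : R^o -> V) s 1 ->
      h^-1 *: (z (h + s) - z s) @[h --> 0^'] --> derive1 z s.
    move=> dz; rewrite derive1E; apply: cvg_trans dz; apply: near_eq_cvg.
    by apply: nearW => h /=; rewrite [h *: 1]mulr1.
  exists (derive1 u s - derive1 v s).
    have h1 : h^-1 *: (u (h + s) - u s) - h^-1 *: (v (h + s) - v s)
        @[h --> 0^'] --> derive1 u s - derive1 v s.
      by apply: cvgB; exact: dd.
    apply: cvg_trans h1; apply: near_eq_cvg; apply: nearW => h /=.
    rewrite -scalerBr /w; congr (_ *: _).
    by rewrite !opprB addrACA [RHS]addrACA (addrC (- v _)).
  have := mB _ _ _ _ Bu Bv; by rewrite -opprD (ipNl hip) oppr_ge0.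
have decr a : 0 < a -> a <= t -> `|w t| ^+ 2 <= `|w a| ^+ 2.
  move=> a0 at_.
  have sub : `[a, t]%classic `<=` `[0, +oo[%classic.
    by move=> z; rewrite /= !in_itv/= andbT => /andP[az _]; rewrite (le_trans (ltW a0)).
  have cnw : {within `[a, t], continuous (fun s => `|w s|)}.
    move=> z; apply: cvg_norm; move: z; exact: continuous_subspaceW sub cw.
  have [c cat hc] := EVT_max at_ cnw.
  apply: (@ac_nonincreasing R V a t (2 * `|w c|) w (fun s => `|w s| ^+ 2) E0) => //.
  - apply: absolutely_continuousB; [exact: acu|exact: acv].
  - move=> x y ax xy yt.
    have xc : `|w x| <= `|w c| by apply: hc; rewrite in_itv/= ax (le_trans xy).
    have yc : `|w y| <= `|w c| by apply: hc; rewrite in_itv/= yt (le_trans ax).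
    rewrite subr_sqr mulrC; apply: (@le_trans _ _ ((`|w y| + `|w x|) * `|w y - w x|)).
      apply: ler_wpM2l; first by rewrite addr_ge0.
      exact: lerB_dist.
    by rewrite ler_wpM2r//; lra.
  - move=> s /andP[as_ st] nEs e e0.
    have [|l hl lw] := hE0 s _ nEs; first exact: lt_le_trans as_.
    exact: sqr_norm_straddle hl lw e0.
suff : w t = 0 by move/eqP; rewrite subr_eq0 => /eqP.
apply/eqP; rewrite -normr_le0; apply: le_of_le_add_eps => e e0; rewrite add0r.
move/within_continuous_epsP : cw => /(_ 0 _ e e0)[|d d0 hd].
  by rewrite /= in_itv/= lexx.
pose a := Num.min t (d / 2).
have a0 : 0 < a by rewrite lt_min t0 divr_gt0.
have at_ : a <= t by rewrite ge_min lexx.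
have ad : a <= d / 2 by rewrite ge_min lexx orbT.
apply: (@le_trans _ _ `|w a|).
  by rewrite -ler_sqr ?nnegrE//; exact: decr.
have w0 : w 0 = 0 by rewrite /w uv0 subrr.
have := hd a; rewrite /= in_itv/= (ltW a0) w0 !sub0r !normrN => /(_ isT) h.
by apply/ltW/h; rewrite gtr0_norm//; lra.
Qed.

(** Orbits issued from the domain are strong solutions; the others are limits of
    such orbits. *)
Lemma semigroup_unique B (T T' : R -> V -> V) : closure (dom B) = setT ->
  nonexpansive_semigroup T -> nonexpansive_semigroup T' ->
  generator ip T B -> generator ip T' B ->
  forall t x, 0 <= t -> T' t x = T t x.
Proof.
move=> dB [T0 _ _ Tn] [T'0 _ _ T'n] [mB _ sT] [_ _ sT'] t x t0.
apply/eqP; rewrite -subr_eq0 -normr_le0.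
apply: (@lipschitz_le0_dense _ _ B dB (fun x => `|T' t x - T t x|) 2) => //.
  move=> y z; have := Tn t z y t0; have := T'n t y z t0; rewrite (distrC z).
  have := ler_distD (T t z) (T' t y) (T t y).
  have := ler_distD (T' t z) (T' t y) (T t z).
  lra.
move=> y Dy; rewrite (strong_solution_unique mB.1 (sT' _ Dy) (sT _ Dy)) ?subrr ?normr0//.
by rewrite T0 T'0.
Qed.

End strong_solution_uniqueness.

(** * Maximal monotone extensions *)

Section maximal_extension.
Context (R : realType) (V : normedModType R) (ip : V -> V -> R).

(** Zorn's lemma for sets [X] of pairs whose union with the graph of [A] is
    monotone; the union with [A] makes the empty chain harmless. *)
Lemma maximal_monotone_extension (A : V -> set V) : monotone_op ip A ->
  exists B, maximal_monotone ip B /\ extends A B.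
Proof.
move=> mA; pose op (X : set (V * V)) u : set V := [set v | X (u, v) \/ A u v].
have [|X [mX maxX]] := @Zorn_bigcup (V * V)%type (fun X => monotone_op ip (op X)).
  move=> F mF totF u v u' v' [[X FX Xu]|Au] [[Y FY Yv]|Av].
  - have [XY|YX] := totF _ _ FX FY.
      by apply: (mF _ FY); left => //; exact: XY.
    by apply: (mF _ FX); left => //; exact: YX.
  - by apply: (mF _ FX); [left|right].
  - by apply: (mF _ FY); [right|left].
  - exact: mA.
exists (op X); split; last by move=> u v Auv; right.
split=> // B mB XB u v Buv; apply: contrapT => nXuv.
apply: (maxX [set p | B p.1 p.2]).
  split; last by move=> /(_ (u, v) Buv) Xuv; apply: nXuv; left.
  by move=> [p q] Xpq; apply: XB; left.
move=> p q p' q' Bp Bq; apply: mB.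
  by case: Bp => // Ap; apply: XB; right.
by case: Bq => // Aq; apply: XB; right.
Qed.

End maximal_extension.

(** * The space L^2 as a complete inner product space *)

Section L2_hilbert.
Context d (X : measurableType d) (R : realType).
Variable m : {measure set X -> \bar R}.
Local Notation L2 := (LspaceType2 m).
Implicit Types (x y z : L2).

Lemma measurable_L2_fun x : measurable_fun setT (L2_fun x).
Proof. exact: (@measurable_funPT _ _ _ _ (L2_repr x)). Qed.

Lemma L2_mul_integrable x y :
  m.-integrable setT (EFin \o (fun t => L2_fun x t * L2_fun y t)).
Proof. by apply/Lfun1_integrable; exact: Lfun2_mul_Lfun1 (L2_funP x) (L2_funP y). Qed.

Lemma ae_eq_Rintegral (f g : X -> R) : measurable_fun setT f ->
  measurable_fun setT g -> f = g %[ae m] ->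
  \int[m]_t f t = \int[m]_t g t.
Proof.
move=> mf mg fg; congr fine; apply: ae_eq_integral => //.
- exact/measurable_EFinP.
- exact/measurable_EFinP.
by apply: filterS fg => t h _; rewrite h.
Qed.

Let mmul (f g : X -> R) : measurable_fun setT f -> measurable_fun setT g ->
  measurable_fun setT (fun t => f t * g t).
Proof. by move=> mf mg; exact: measurable_funM. Qed.

Lemma L2_norm_sqr x : (L2_norm x ^+ 2)%:E = (\int[m]_t (L2_fun x t ^+ 2)%:E)%E.
Proof.
have two0 : (2 : R) != 0 by rewrite pnatr_eq0.
have := poweR_Lnorm m (EFin \o L2_fun x) two0.
rewrite -(finite_norm_fine (L2_repr x)) => h.
rewrite -(powR_mulrn 2 (normr_ge0 x : 0 <= L2_norm x)) -poweR_EFin.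
rewrite [LHS]h; apply: eq_integral => t _.
by rewrite /comp abse_EFin poweR_EFin powR_mulrn ?normr_ge0// real_normK ?num_real.
Qed.

Lemma L2_inner_product : inner_product (@L2_inner d X R m).
Proof.
split.
- by move=> x y; apply: eq_Rintegral => t _; rewrite mulrC.
- move=> x y z; rewrite /L2_inner -RintegralD//; try exact: L2_mul_integrable.
  apply: ae_eq_Rintegral.
  + by apply: mmul; exact: measurable_L2_fun.
  + by apply: measurable_funD; apply: mmul; exact: measurable_L2_fun.
  + apply: filterS (L2_addE x y) => t h _.
    by rewrite -mulrDl; congr (_ * _); exact: h.
- move=> a x y; rewrite /L2_inner -RintegralZl//; try exact: L2_mul_integrable.
  apply: ae_eq_Rintegral.
  + by apply: mmul; exact: measurable_L2_fun.
  + apply: measurable_funM => //; apply: mmul; exact: measurable_L2_fun.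
  + apply: filterS (L2_scaleE a x) => t h _.
    by rewrite mulrA; congr (_ * _); exact: h.
- move=> x; rewrite -[RHS]/(L2_norm x ^+ 2); apply: EFin_inj; rewrite L2_norm_sqr.
  rewrite /L2_inner /Rintegral fineK; first by apply: eq_integral => t _; rewrite expr2.
  exact: (integrable_fin_num measurableT (L2_mul_integrable x x)).
Qed.

(** Adding or subtracting the geometric remainder makes the sequence monotone. *)
Lemma geometric_steps_cvg (u : nat -> R) (C : R) : 0 <= C ->
  (forall k, `|u k.+1 - u k| <= C * 2^-1 ^+ k) -> cvgn u.
Proof.
move=> C0 hu; pose q k : R := 2 * C * 2^-1 ^+ k.
have q0 k : 0 <= q k by rewrite !mulr_ge0// exprn_ge0// invr_ge0.
have qS k : q k.+1 = q k - C * 2^-1 ^+ k by rewrite /q exprS; field.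
have decr : {homo (fun k => u k + q k) : n p / (n <= p)%N >-> p <= n}.
  apply: homo_leq => [x|y x z xy yz|k] //; first exact: le_trans yz xy.
  by have := hu k; rewrite ler_norml qS; lra.
have incr : {homo (fun k => u k - q k) : n p / (n <= p)%N >-> n <= p}.
  apply: homo_leq => [x|y x z|k] //; first exact: le_trans.
  by have := hu k; rewrite ler_norml qS; lra.
have c1 : cvgn (fun k => u k + q k).
  apply: nonincreasing_is_cvgn decr _; exists (u 0%N - q 0%N) => _ [k _ <-].
  by have := incr _ _ (leq0n k); have := q0 k; lra.
have c2 : cvgn q.
  have h2 : `|2^-1 : R| < 1 by rewrite ger0_norm ?invr_ge0// invf_lt1// ltr1n.
  by apply: cvgP (cvg_geometric (2 * C) h2).
rewrite (_ : u = (fun k => u k + q k) - q); first exact: is_cvgB.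
by apply/funext => k; rewrite fctE addrK.
Qed.

Lemma fatou_cvg (c : \bar R) (f_ : nat -> X -> \bar R) (f : X -> \bar R) :
  (forall k, measurable_fun setT (f_ k)) -> (forall k t, 0 <= f_ k t)%E ->
  (forall t, f_ k t @[k --> \oo] --> f t) ->
  (forall k, \int[m]_t f_ k t <= c)%E -> (\int[m]_t f t <= c)%E.
Proof.
move=> mf f0 cf ic.
have -> : (\int[m]_t f t = \int[m]_t limn_einf (f_ ^~ t))%E.
  apply: eq_integral => t _; rewrite is_cvg_limn_einfE; last by apply: cvgP (cf t).
  by apply/esym/cvg_lim => //; exact: cf.
apply: le_trans (fatou m measurableT mf (fun n t _ => f0 n t)) _.
rewrite limn_einf_lim; apply: lime_le; first exact: is_cvg_einfs.
apply: nearW => k; apply: le_trans (ic k).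
by apply: ereal_inf_lbound; exists k => /=.
Qed.

Lemma L2_of_fun (f : X -> R) : measurable_fun setT f ->
  (\int[m]_t (f t ^+ 2)%:E < +oo)%E -> exists x : L2, L2_fun x = f %[ae m].
Proof.
move=> mf fi; have fP : f \in Lfun m 2%:E.
  rewrite inE; apply/andP; split; rewrite inE//= /finite_norm.
  have two0 : (2 : R) != 0 by rewrite pnatr_eq0.
  have := poweR_Lnorm m (EFin \o f) two0.
  have -> : (\int[m]_t (`|(EFin \o f) t| `^ 2) = \int[m]_t (f t ^+ 2)%:E)%E.
    apply: eq_integral => t _.
    by rewrite /comp abse_EFin poweR_EFin powR_mulrn ?normr_ge0// real_normK ?num_real.
  by move=> NE; apply: (lty_poweRy two0); rewrite NE.
by exists (L2_class (Lfun_Sub (lee1n 2) fP)); exact: L2_classK.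
Qed.

Lemma L2_dist_sqr x y : (`|x - y| ^+ 2)%:E =
  (\int[m]_t ((L2_fun x t - L2_fun y t) ^+ 2)%:E)%E.
Proof.
rewrite -[LHS]/((L2_norm (x - y)) ^+ 2)%:E L2_norm_sqr.
have msq (f : X -> R) : measurable_fun setT f ->
    measurable_fun setT (fun t => (f t ^+ 2)%:E).
  by move=> mf; apply/measurable_EFinP; exact: measurable_funX.
apply: ae_eq_integral => //.
- exact/msq/measurable_L2_fun.
- by apply: msq; apply: measurable_funB; exact: measurable_L2_fun.
have hx : L2_fun (x - y) = (fun t => L2_fun x t + L2_fun (- y) t) %[ae m].
  exact: L2_addE.
apply: filterS2 hx (L2_oppE y) => t h1 h2 _.
by rewrite h1// h2.
Qed.

(** Riesz-Fischer: along a subsequence with distances at most 4^-k, the series of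
    4^k times the squared increments is integrable, so that almost everywhere the
    increments are O(2^-k) and the subsequence converges. Fatou's lemma bounds the
    distance to the limit. *)
Lemma L2_complete : seq_complete L2.
Proof.
move=> x cx; pose e k : R := 4^-1 ^+ k.
have e0 k : 0 < e k by rewrite exprn_gt0// invr_gt0.
have [N hN] := choice (fun k => cx (e k) (e0 k)).
pose n k := (\sum_(i < k.+1) N i)%N.
have nN k : (N k <= n k)%N by rewrite /n big_ord_recr leq_addl.
have nS k : (n k <= n k.+1)%N by rewrite /n [leqRHS]big_ord_recr leq_addr.
have nmono : {homo n : i j / (i <= j)%N >-> (i <= j)%N} by move=> i j ij; apply: (homo_leq leqnn leq_trans nS).
pose y k := L2_fun (x (n k)).
have my k : measurable_fun setT (y k) by exact: measurable_L2_fun.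
have ye k j : (k <= j)%N -> (\int[m]_t ((y j t - y k t) ^+ 2)%:E <= (e k ^+ 2)%:E)%E.
  move=> kj; rewrite -L2_dist_sqr lee_fin ler_sqr ?nnegrE ?(ltW (e0 k))//.
  by apply/ltW/hN => //; apply: leq_trans (nN k) _; exact: nmono.
pose F k t : \bar R := (4 ^+ k * (y k.+1 t - y k t) ^+ 2)%:E.
have F0 k t : (0 <= F k t)%E by rewrite lee_fin mulr_ge0 ?sqr_ge0 ?exprn_ge0//.
have mF k : measurable_fun setT (F k).
  apply/measurable_EFinP; apply: measurable_funM => //.
  by apply: measurable_funX; exact: measurable_funB.
have sumF : (\int[m]_t (\sum_(0 <= k <oo) F k t) < +oo)%E.
  rewrite (integral_nneseries m measurableT mF (fun k t _ => F0 k t)).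
  apply: (@le_lt_trans _ _ (\sum_(0 <= k <oo) (geometric 1 4^-1 k)%:E)%E).
    apply: lee_nneseries => [k _ _|k _]; first by apply: integral_ge0 => t _; exact: F0.
    rewrite /F; under eq_integral do rewrite EFinM.
    rewrite ge0_integralZl//; last 2 first.
    - apply/measurable_EFinP; apply: measurable_funX; exact: measurable_funB.
    - by move=> t _; rewrite lee_fin sqr_ge0.
    apply: (@le_trans _ _ ((4 ^+ k)%:E * (e k ^+ 2)%:E)%E).
      by rewrite lee_pmul2l ?lte_fin ?exprn_gt0//; exact: ye.
    rewrite -EFinM lee_fin /geometric/= mul1r /e expr2 mulrA -exprMn.
    by rewrite divff ?pnatr_eq0// expr1n mul1r.
  rewrite (_ : (\sum_(0 <= k <oo) _)%E = (1 / (1 - 4^-1))%:E) ?ltry//.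
  apply/cvg_lim => //.
  under eq_fun do rewrite sumEFin.
  apply: cvg_EFin; first exact: nearW.
  by apply: cvg_geometric_series; rewrite ger0_norm ?invr_ge0// invf_lt1// ltr1n.
have mS : measurable_fun setT (fun t => \sum_(0 <= k <oo) F k t)%E.
  exact: ge0_emeasurable_sum.
have : m.-integrable setT (fun t => \sum_(0 <= k <oo) F k t)%E.
  apply/integrableP; split=> //; rewrite (eq_integral (fun t => \sum_(0 <= k <oo) F k t)%E)//.
  by move=> t _; rewrite gee0_abs// nneseries_ge0.
move=> /(integrable_ae measurableT)[Z [mZ Z0 ZP]].
(* Setting the representatives to 0 on the exceptional set makes them converge
   everywhere. *)
pose h k t := \1_(~` Z) t * y k t.
have mh k : measurable_fun setT (h k).
  by apply: measurable_funM => //; apply: measurable_indic; exact: measurableC.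
have hy k : h k = y k %[ae m].
  exists Z; split=> // t /=; apply: contra_notP => nZ _.
  by rewrite /h indicE mem_set ?mul1r.
have hc t : cvgn (h ^~ t).
  have [Zt|nZt] := pselect (Z t).
    rewrite (_ : h ^~ t = fun=> 0); first exact: is_cvg_cst.
    by apply/funext => k; rewrite /h indicE memNset ?mul0r//=; apply.
  have /= : setT t -> (\sum_(0 <= k <oo) F k t)%E \is a fin_num.
    by apply: contrapT => nf; apply: nZt; exact: ZP.
  move=> /(_ I); set M := (X in X \is a _) => fM.
  have M0 : (0 <= M)%E by exact: nneseries_ge0.
  apply: (@geometric_steps_cvg _ (Num.sqrt (fine M))); first exact: sqrtr_ge0.
  move=> k; rewrite /h indicE mem_set// !mul1r.
  rewrite -ler_sqr ?nnegrE ?mulr_ge0 ?sqrtr_ge0 ?exprn_ge0 ?invr_ge0//.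
  rewrite exprMn sqr_sqrtr ?fine_ge0// real_normK ?num_real// -exprM mulnC exprM.
  rewrite (_ : 2^-1 ^+ 2 = 4^-1 :> R); last by field.
  rewrite exprVn ler_pdivlMr ?exprn_gt0// mulrC -lee_fin fineK//.
  rewrite -[leLHS]/(F k t).
  apply: le_trans (nneseries_lim_ge k.+1 (fun i _ _ => F0 i t)).
  by rewrite big_nat_recr//= leeDr// sume_ge0.
pose f t := limn (h ^~ t).
have mf : measurable_fun setT f by apply: (measurable_fun_cvg mh) => t _; exact: hc.
have fe k : (\int[m]_t ((f t - h k t) ^+ 2)%:E <= (e k ^+ 2)%:E)%E.
  apply: (@fatou_cvg _ (fun j t => ((h (j + k)%N t - h k t) ^+ 2)%:E)).
  - move=> j; apply/measurable_EFinP; apply: measurable_funX.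
    exact: measurable_funB.
  - by move=> j t; rewrite lee_fin sqr_ge0.
  - move=> t; apply: cvg_EFin; first exact: nearW.
    have c1 : h (j + k)%N t - h k t @[j --> \oo] --> f t - h k t.
      apply: cvgB; last exact: cvg_cst.
      by have := hc t; rewrite -(cvg_shiftn k).
    by under eq_fun do rewrite expr2; rewrite expr2; exact: (cvgM c1 c1).
  - move=> j; apply: le_trans (ye k (j + k)%N (leq_addl _ _)).
    rewrite le_eqVlt; apply/orP; left; apply/eqP; apply: ae_eq_integral => //.
    + apply/measurable_EFinP; apply: measurable_funX; exact: measurable_funB.
    + apply/measurable_EFinP; apply: measurable_funX; exact: measurable_funB.
    + by apply: filterS2 (hy (j + k)%N) (hy k) => t h1 h2 _; rewrite h1// h2.
have [z0 hz0] := L2_of_fun (measurable_funB mf (mh 0%N)) (le_lt_trans (fe 0%N) (ltry _)).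
pose z := z0 + x (n 0%N).
have zf : L2_fun z = f %[ae m].
  apply: filterS3 (L2_addE z0 (x (n 0%N))) hz0 (hy 0%N) => t h1 h2 h3 I'.
  by rewrite h1// h2//= h3// /y subrK.
have zx k : `|z - x (n k)| <= e k.
  rewrite -ler_sqr ?nnegrE ?(ltW (e0 k))// -lee_fin L2_dist_sqr.
  apply: le_trans (fe k); rewrite le_eqVlt; apply/orP; left; apply/eqP.
  apply: ae_eq_integral => //.
  + apply/measurable_EFinP; apply: measurable_funX; exact: measurable_funB (measurable_L2_fun _) (my k).
  + apply/measurable_EFinP; apply: measurable_funX; exact: measurable_funB.
  + by apply: filterS2 zf (hy k) => t h1 h2 _; rewrite h1// h2.
exists z; apply/cvgrPdist_lt => r r0.
have [k kr] : exists k, e k < r / 2.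
  have : e j @[j --> \oo] --> (0 : R).
    by apply: cvg_expr; rewrite ger0_norm ?invr_ge0// invf_lt1// ltr1n.
  move=> /cvgrPdist_lt /(_ (r / 2)) []; first by rewrite divr_gt0.
  move=> k _ /(_ k (leqnn k)) /=; rewrite sub0r normrN gtr0_norm ?e0// => kr.
  by exists k.
exists (N k) => // i /= Ni.
have := hN k _ _ (nN k) Ni; have := zx k.
have := ler_distD (x (n k)) z (x i); lra.
Qed.

End L2_hilbert.

(** * Bochner integrals tested against vectors *)

Section bochner.
Context d (Y : measurableType d) (R : realType) (V : normedModType R).
Context (ip : V -> V -> R).
Hypotheses (hip : inner_product ip) (hV : seq_complete V).
Context (mu : {measure set Y -> \bar R}) (D : set Y).
Hypothesis mD : measurable D.
Implicit Types (f s : Y -> V) (v w : V).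

Let ipE := (ipDl hip, ipDr hip, ipNl hip, ipNr hip, ipZl hip, ipZr hip).

Lemma integrable_eqR (g h : Y -> R) : (forall y, D y -> g y = h y) ->
  mu.-integrable D (EFin \o g) -> mu.-integrable D (EFin \o h).
Proof.
by move=> gh; apply: eq_integrable => // y /set_mem Dy; rewrite /= gh.
Qed.

Lemma integrable_cst0 : mu.-integrable D (EFin \o (fun=> 0 : R)).
Proof. exact: integrable0. Qed.

Lemma eq_RintegralD (g h : Y -> R) : (forall y, D y -> g y = h y) ->
  \int[mu]_(y in D) g y = \int[mu]_(y in D) h y.
Proof. by move=> gh; apply: eq_Rintegral => y /set_mem; exact: gh. Qed.

(** Measurability tested on distance functions: it involves no sigma-algebra on
    [V], and it makes inner products with vectors, and distances to simple
    functions, measurable. *)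
Definition dist_measurable f : Prop :=
  forall v, measurable_fun D (fun y => `|f y - v|).

(** Polarization. *)
Lemma measurable_fun_ip f w : dist_measurable f ->
  measurable_fun D (fun y => ip (f y) w).
Proof.
move=> mf.
have m2 v : measurable_fun D (fun y => `|f y - v| ^+ 2) by exact: measurable_funX.
have -> : (fun y => ip (f y) w) = (fun y => 2^-1 * (`|f y - 0| ^+ 2
    + `|w| ^+ 2 - `|f y - w| ^+ 2)).
  apply/funext => y; rewrite subr0 !(ip_sqrE hip) !ipE (ipC hip w (f y)).
  by field.
have mB := measurable_funB (measurable_funD (m2 0) (measurable_cst (`|w| ^+ 2))) (m2 w).
exact: (measurable_funM (measurable_cst (2^-1 : R)) mB).
Qed.

Lemma Rintegral_sum (I : Type) (r : seq I) (F : I -> Y -> R) :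
  (forall i, mu.-integrable D (EFin \o F i)) ->
  mu.-integrable D (EFin \o (fun y => \sum_(i <- r) F i y)) /\
  \int[mu]_(y in D) (\sum_(i <- r) F i y) = \sum_(i <- r) \int[mu]_(y in D) F i y.
Proof.
move=> iF; elim: r => [|i r [ir Er]].
  rewrite big_nil (_ : (fun y => _) = cst 0); last by apply/funext => y; rewrite big_nil.
  split; last by rewrite Rintegral_cst// mul0r.
  exact: integrable_cst0.
have E : (fun y => \sum_(i <- i :: r) F i y) = (fun y => F i y + \sum_(i <- r) F i y).
  by apply/funext => y; rewrite big_cons.
rewrite big_cons E; split; last by rewrite RintegralD// Er.
exact: (integrableD mD (iF i) ir).
Qed.

Lemma simple_weak_integral s w : Bochner_simple mu D s ->
  mu.-integrable D (EFin \o (fun y => ip (s y) w)) /\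
  \int[mu]_(y in D) ip (s y) w = ip (Bochner_simple_integral mu D s) w.
Proof.
move=> [fs ms]; pose r := finmap.enum_fset (fset_set (s @` D)).
pose E v := D `&` s @^-1` [set v].
have sE y : D y -> ip (s y) w = \sum_(v <- r) ip v w * \1_(E v) y.
  move=> Dy; have sr : s y \in r by rewrite in_fset_set// inE; exists y.
  rewrite (bigD1_seq (s y) sr)/=; last exact: finmap.fset_uniq.
  have -> : \sum_(v <- r | v != s y) ip v w * \1_(E v) y = 0.
    apply: big1 => v vs; rewrite indicE memNset ?mulr0// => -[_ /= sv].
    by rewrite sv eqxx in vs.
  by rewrite addr0 indicE mem_set// mulr1.
have iE v : mu.-integrable D (EFin \o (fun y => ip v w * \1_(E v) y)).
  (* The value 0 may be taken on a set of infinite measure. *)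
  have [mE Efin] := ms v; have [->|v0] := eqVneq v 0.
    by apply: integrable_eqR integrable_cst0 => y _; rewrite (ip0l hip) mul0r.
  apply: (integrableZl mD (ip v w) (f := EFin \o \1_(E v))).
  apply/integrableP; split.
    by apply/measurable_EFinP; exact: measurable_indic.
  under eq_integral do rewrite /comp abse_EFin ger0_norm//.
  by rewrite integral_indic// setIidl; [exact: Efin|exact: subIsetl].
have [i1 i2] := Rintegral_sum r iE; split.
  by apply: integrable_eqR i1 => y Dy; rewrite sE.
rewrite (eq_RintegralD sE) i2 /Bochner_simple_integral fsbig_finite//= (ip_suml hip); apply: eq_bigr => v _.
have [mE Efin] := ms v; have [->|v0] := eqVneq v 0.
  rewrite scaler0 (ip0l hip) (@eq_RintegralD _ (cst 0)) ?Rintegral_cst ?mul0r//.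
  by move=> y _; rewrite mul0r.
rewrite RintegralZl//.
  by rewrite (ipZl hip) mulrC /Rintegral integral_indic// setIidl//; exact: subIsetl.
apply/integrableP; split.
  by apply/measurable_EFinP; exact: measurable_indic.
under eq_integral do rewrite /comp abse_EFin ger0_norm//.
by rewrite integral_indic// setIidl; [exact: Efin|exact: subIsetl].
Qed.

Lemma measurable_fun_dist_simple f s : dist_measurable f -> Bochner_simple mu D s ->
  measurable_fun D (fun y => `|f y - s y|).
Proof.
move=> mf [fs ms] _ B mB.
rewrite (_ : D `&` _ = \bigcup_(v in s @` D)
    ((D `&` s @^-1` [set v]) `&` (D `&` (fun y => `|f y - v|) @^-1` B))).
  apply: fin_bigcup_measurable => // v _; apply: measurableI; first exact: (ms v).1.
  exact: mf.
apply/seteqP; split => [y [Dy By]|y [v _ [[Dy /= sv] [_ /= By]]]].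
  by exists (s y); [exists y|].
by split=> //=; rewrite sv.
Qed.

Lemma approx_integrable f sn : dist_measurable f -> Bochner_approx mu D f sn ->
  exists N : nat, forall n, (N <= n)%N ->
    mu.-integrable D (EFin \o (fun y => `|f y - sn n y|)).
Proof.
move=> mf [ss _ cs].
have /fine_cvgP[[N _ HN] _] := cs.
exists N => n Nn; apply/integrableP; split.
  by apply/measurable_EFinP; exact: measurable_fun_dist_simple.
under eq_integral do rewrite /comp abse_EFin normr_id.
by rewrite -ge0_fin_numE; [exact: HN|apply: integral_ge0 => y _; rewrite lee_fin].
Qed.

Lemma approx_weak_error f (sn : nat -> Y -> V) n w : dist_measurable f -> Bochner_simple mu D (sn n) ->
  mu.-integrable D (EFin \o (fun y => `|f y - sn n y|)) ->
  mu.-integrable D (EFin \o (fun y => ip (f y) w)) /\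
  `|\int[mu]_(y in D) ip (f y) w - ip (Bochner_simple_integral mu D (sn n)) w|
    <= (\int[mu]_(y in D) `|f y - sn n y|) * `|w|.
Proof.
move=> mf ss ifs; have [isn Es] := simple_weak_integral w ss.
have mfs : measurable_fun D (fun y => ip (f y) w - ip (sn n y) w).
  apply: measurable_funB; first exact: measurable_fun_ip.
  by apply/measurable_EFinP; case/integrableP : isn.
have iw : mu.-integrable D (EFin \o (fun y => `|f y - sn n y| * `|w|)).
  exact: (integrableZr mD `|w| ifs).
have bound y : `|ip (f y) w - ip (sn n y) w| <= `|f y - sn n y| * `|w|.
  by rewrite -(ipBl hip); exact: (cauchy_schwarz hip).
have idiff : mu.-integrable D (EFin \o (fun y => ip (f y) w - ip (sn n y) w)).
  apply: le_integrable iw => //; first exact/measurable_EFinP.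
  by move=> y _; rewrite /= lee_fin (le_trans (bound y))// ler_norm.
have if_ : mu.-integrable D (EFin \o (fun y => ip (f y) w)).
  have h := integrableD mD idiff isn.
  by apply: (@integrable_eqR (fun y => ip (f y) w - ip (sn n y) w + ip (sn n y) w)) h => y _; rewrite subrK.
split=> //; rewrite -Es -RintegralB//.
apply: le_trans (le_normr_Rintegral mD idiff) _; rewrite -RintegralZr//.
apply: le_Rintegral => //.
apply: le_integrable iw => //.
  by apply/measurable_EFinP; exact: measurableT_comp.
by move=> y _; rewrite /= lee_fin normr_id (le_trans (bound y))// ler_norm.
Qed.

(** The simple integrals form a Cauchy sequence: their difference is tested
    against itself. *)
Lemma approx_weak_integral f sn : dist_measurable f -> Bochner_approx mu D f sn ->
  exists I : V, Bochner_simple_integral mu D (sn n) @[n --> \oo] --> I /\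
   forall w, mu.-integrable D (EFin \o (fun y => ip (f y) w)) /\
     ip I w = \int[mu]_(y in D) ip (f y) w.
Proof.
move=> mf hsn; have [N HN] := approx_integrable mf hsn.
have [ss _ cs] := hsn.
pose b n := \int[mu]_(y in D) `|f y - sn n y|.
pose S n := Bochner_simple_integral mu D (sn n).
have b0 n : 0 <= b n by exact: Rintegral_ge0.
have cb : b n @[n --> \oo] --> (0 : R) by apply: fine_cvg cs.
have err n w : (N <= n)%N ->
    `|\int[mu]_(y in D) ip (f y) w - ip (S n) w| <= b n * `|w|.
  by move=> Nn; have [_] := approx_weak_error w mf (ss n) (HN n Nn).
have dS i j : (N <= i)%N -> (N <= j)%N -> `|S i - S j| <= b i + b j.
  move=> Ni Nj; have [->|z0] := eqVneq (S i - S j) 0; first by rewrite normr0 addr_ge0.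
  rewrite -(ler_pM2r (x := `|S i - S j|)) ?normr_gt0// -expr2 (ip_sqrE hip).
  rewrite {1}(ipBl hip) mulrDl.
  have := err i (S i - S j) Ni; have := err j (S i - S j) Nj.
  rewrite !ler_norml; lra.
have [I cI] : exists I : V, S n @[n --> \oo] --> I.
  refine (hV (x := S) _) => e e0.
  move/cvgrPdist_lt : cb => /(_ (e / 2)) []; first by rewrite divr_gt0.
  move=> M _ HM; exists (maxn N M) => i j.
  rewrite !geq_max => /andP[Ni Mi] /andP[Nj Mj].
  apply: le_lt_trans (dS _ _ Ni Nj) _.
  have := HM _ Mi; have := HM _ Mj; rewrite /= !sub0r !normrN !ger0_norm//; lra.
exists I; split=> // w; split.
  by have [] := approx_weak_error w mf (ss N) (HN N (leqnn N)).
have c1 : ip (S n) w @[n --> \oo] --> ip I w by apply: (cvg_ip hip) => //; exact: cvg_cst.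
apply: (cvg_unique _ c1) => //.
have c2 : b n * `|w| @[n --> \oo] --> 0 * `|w| by exact: cvgMr_tmp.
rewrite mul0r in c2; apply/cvgrPdist_le => e e0.
move/cvgrPdist_le : c2 => /(_ e e0)[M _ HM]; exists (maxn N M) => // n /=.
rewrite geq_max => /andP[Nn Mn]; apply: le_trans (err n w Nn) _.
by have := HM n Mn; rewrite /= sub0r normrN ger0_norm ?mulr_ge0.
Qed.

(** By [approx_weak_integral] every approximating sequence yields a limit, and
    this limit has the stated inner products. *)
Lemma Bochner_integral_weak f w : dist_measurable f -> Bochner_integrable mu D f ->
  mu.-integrable D (EFin \o (fun y => ip (f y) w)) /\
  ip (Bochner_integral mu D f) w = \int[mu]_(y in D) ip (f y) w.
Proof.
move=> mf [sn hsn]; have [I [cI hI]] := approx_weak_integral mf hsn.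
have [sn' hsn' cB] : [set I | exists2 sn, Bochner_approx mu D f sn &
    Bochner_simple_integral mu D (sn n) @[n --> \oo] --> I]
    (Bochner_integral mu D f).
  by apply: xgetPex; exists I, sn.
have [I' [cI' hI']] := approx_weak_integral mf hsn'.
by rewrite (cvg_unique _ cB cI')//; exact: hI'.
Qed.

End bochner.

(** * Bochner integrability of continuous curves *)

Section bochner_continuous.
Context (R : realType) (V : normedModType R).
Context (mu : {measure set (measurableTypeR R) -> \bar R}) (D : set R).
Hypothesis mD : measurable (D : set (measurableTypeR R)).
Hypothesis D_ge0 : forall y, D y -> 0 <= y.
Hypothesis D_up : forall y z, D y -> y <= z -> D z.
Hypothesis D_fin : forall n : nat, (mu (D `&` `[0%R, n%:R[%classic) < +oo)%E.
Context (f : R -> V) (g : R -> R).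
Hypothesis cf : {within D, continuous f}.
Hypothesis fg : forall y z, D y -> y <= z -> `|f z| <= g y.
Hypothesis ig : mu.-integrable D (EFin \o g).

Lemma dist_measurable_continuous : @dist_measurable _ (measurableTypeR R) R V D f.
Proof.
move=> v; apply: subspace_continuous_measurable_fun => //.
move=> y; apply: cvg_norm; apply: cvgB; last exact: cvg_cst.
exact: cf.
Qed.

Let pt (n : nat) (k : nat) : R := k.+1%:R / n.+1%:R.
Let idx (n : nat) (y : R) : nat := Num.truncn (y * n.+1%:R).

(** The curve is sampled to the right of each point, where it is bounded by the
    value of [g] at the point, and cut at [n] so that the steps have finite
    measure. *)
Definition right_step (n : nat) (y : R) : V :=
  if y < n%:R then f (pt n (idx n y)) else 0.

Lemma idx_bounds n y : 0 <= y -> y < pt n (idx n y) <= y + n.+1%:R^-1.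
Proof.
move=> y0; have /truncn_itv/andP[h1 h2] : 0 <= y * n.+1%:R by rewrite mulr_ge0.
rewrite /pt /idx ltr_pdivlMr// h2/= -natr1 mulrDl mul1r lerD2r.
by rewrite ler_pdivrMr.
Qed.

Lemma idx_cell n k y : 0 <= y -> (idx n y = k) <-> (k%:R / n.+1%:R <= y < pt n k).
Proof.
move=> y0; have /truncn_itv h : 0 <= y * n.+1%:R by rewrite mulr_ge0.
rewrite /pt ler_pdivrMr// ltr_pdivlMr//; split=> [<-//|].
by move=> /truncn_def.
Qed.

Lemma idx_lt n y : 0 <= y -> y < n%:R -> (idx n y < n * n.+1)%N.
Proof.
move=> y0 yn; rewrite /idx truncn_lt_nat ?mulr_ge0// natrM ltr_pM2r//.
Qed.

Lemma right_step_simple n : Bochner_simple mu D (right_step n).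
Proof.
split.
  apply: (@sub_finite_set _ _ ((fun k => f (pt n k)) @` `I_(n * n.+1) `|` [set 0])).
    move=> _ [y Dy <-]; rewrite /right_step; case: ltP => yn; last by right.
    by left; exists (idx n y) => //=; apply: idx_lt => //; exact: D_ge0.
  by rewrite finite_setU; split; [exact/finite_image/finite_II|exact: finite_set1].
move=> v; have mE : measurable (D `&` right_step n @^-1` [set v] : set (measurableTypeR R)).
  pose P := [set k | (k < n * n.+1)%N /\ f (pt n k) = v].
  pose Z : set (measurableTypeR R) := if `[< v = 0 >] then D `&` `[n%:R, +oo[ else set0.
  have -> : D `&` right_step n @^-1` [set v] =
      (\bigcup_(k in P) (D `&` `[(k%:R / n.+1%:R), (pt n k)[ `&` `[0%R, n%:R[)) `|` Z.
    apply/seteqP; split=> y.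
      move=> [Dy]; have y0 := D_ge0 Dy; rewrite /right_step /=; case: ltP => yn fv.
        left; exists (idx n y); first by split=> //; exact: idx_lt.
        split; last by rewrite /= in_itv/= y0.
        by split=> //; rewrite /= in_itv/=; apply/idx_cell.
      by right; rewrite /Z asboolT//; split=> //; rewrite /= in_itv/= yn.
    move=> [[k [kn fv] [[Dy]]]|].
      rewrite /= !in_itv/= => yk /andP[y0 yn]; split=> //=.
      by rewrite /right_step yn; have -> : idx n y = k by apply/idx_cell.
    rewrite /Z; case: asboolP => // ->[Dy] /=; rewrite in_itv/= andbT => ny.
    by split=> //=; rewrite /right_step ltNge ny.
  apply: measurableU; last by rewrite /Z; case: asboolP => _ //; exact: measurableI.
  by apply: bigcup_measurable => k _; apply: measurableI => //; exact: measurableI.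
split=> // v0; apply: le_lt_trans (D_fin n); apply: le_measure; rewrite ?inE//.
  exact: measurableI.
move=> y [Dy /=]; rewrite /right_step; case: ltP => yn; last by move=> /esym/eqP; rewrite (negbTE v0).
by move=> _; split=> //; rewrite /= in_itv/= yn D_ge0.
Qed.

Lemma right_step_cvg y : D y -> right_step n y @[n --> \oo] --> f y.
Proof.
move=> Dy; have y0 := D_ge0 Dy; apply/cvgrPdist_lt => e e0.
have [d d0 hd] := (within_continuous_epsP D f).1 cf y Dy e e0.
have [N HN] := natSinv_lt d0.
exists (maxn N (Num.truncn y).+1) => // n /=; rewrite geq_max => /andP[/HN Nn yn].
have {}yn : y < n%:R by rewrite -truncn_lt_nat.
have /andP[h1 h2] := idx_bounds n y0.
rewrite /right_step yn; apply: hd; first by apply: D_up Dy _; exact: ltW.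
by rewrite distrC gtr0_norm ?subr_gt0//; move: Nn; move: (n.+1%:R^-1) h2 => r; lra.
Qed.

Lemma right_step_le n y : D y -> `|right_step n y| <= g y.
Proof.
move=> Dy; have y0 := D_ge0 Dy; have /andP[h1 h2] := idx_bounds n y0.
rewrite /right_step; case: ltP => _; first by apply: fg => //; exact: ltW.
by rewrite normr0 (le_trans _ (fg Dy (lexx y))).
Qed.

Lemma Bochner_integrable_continuous : Bochner_integrable mu D f.
Proof.
exists right_step; split; first exact: right_step_simple.
  by apply: aeW => y Dy; exact: right_step_cvg.
have -> : 0%E = (\int[mu]_(y in D) (cst 0%:E y))%E by rewrite integral0.
apply: (@dominated_cvg _ _ _ _ _ mD _ _ (fun y => (g y + g y)%:E)).
- move=> n; apply/measurable_EFinP.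
  exact: (measurable_fun_dist_simple mD dist_measurable_continuous (right_step_simple n)).
- move=> y Dy; apply: cvg_EFin; first exact: nearW.
  rewrite -[X in _ --> X](normr0 V) -(subrr (f y)).
  by apply: cvg_norm; apply: cvgB; [exact: cvg_cst|exact: right_step_cvg].
- by [].
- exact: (integrableD mD ig ig).
- move=> n y Dy; rewrite /= lee_fin normr_id; apply: le_trans (ler_normB _ _) _.
  by rewrite lerD ?right_step_le// fg.
Qed.

End bochner_continuous.

(** * Improper integrals over the half-line *)

Section half_line_integrals.
Context (R : realType).
Local Notation leb := (@lebesgue_measure R).
Implicit Types (h H : R -> R) (s x : R).

Let cut (n : nat) : set R := `[n.+2%:R^-1, n.+2%:R]%classic.

Lemma bigcup_cut : \bigcup_n cut n = `]0, +oo[%classic.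
Proof.
apply/seteqP; split=> [s [n _]|s]; rewrite /cut /= !in_itv/=.
  by move=> /andP[ns _]; rewrite andbT (lt_le_trans _ ns)// invr_gt0.
rewrite andbT => s0; pose n := Num.truncn (s + s^-1).
exists n => //; rewrite /= in_itv/=.
have si0 : 0 < s^-1 by rewrite invr_gt0.
have /truncn_itv/andP[_ hn] : 0 <= s + s^-1 by rewrite addr_ge0 ?(ltW s0) ?(ltW si0).
have hn2 : s + s^-1 < n.+2%:R by apply: lt_trans hn _; rewrite ltr_nat.
apply/andP; split; last by lra.
rewrite invf_ple ?posrE//; lra.
Qed.

Lemma cut_homo : {homo cut : n m / (n <= m)%N >-> (n <= m)%O}.
Proof.
move=> n m nm; apply/subsetPset => s; rewrite /cut /= !in_itv/= => /andP[h1 h2].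
have nm2 : (n.+2%:R : R) <= m.+2%:R by rewrite ler_nat.
by rewrite (le_trans h2)// andbT (le_trans _ h1)// lef_pV2 ?posrE.
Qed.

Lemma half_line_measurable h : (forall s, 0 < s -> {for s, continuous h}) ->
  measurable_fun (`]0, +oo[ : set R) h.
Proof.
move=> ch; apply: open_continuous_measurable_fun => // s.
by rewrite inE /= in_itv/= andbT; exact: ch.
Qed.

Lemma half_line_cvg h : (forall s, 0 < s -> {for s, continuous h}) ->
  (forall s, 0 < s -> 0 <= h s) ->
  (\int[leb]_(s in cut n) (h s)%:E)%E @[n --> \oo] -->
  (\int[leb]_(s in `]0%R, +oo[) (h s)%:E)%E.
Proof.
move=> ch h0; rewrite -bigcup_cut; apply: ge0_nondecreasing_set_cvg_integral.
- exact: cut_homo.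
- by move=> n; exact: measurable_itv.
- move=> n; apply/measurable_EFinP; apply: measurable_funS (half_line_measurable ch) => //.
  by rewrite -bigcup_cut; exact: bigcup_sup.
- move=> n s ns; rewrite lee_fin h0//.
  have : (\bigcup_n cut n) s by exists n.
  by rewrite bigcup_cut /= in_itv/= andbT.
Qed.

(** Integration by parts for functions with possibly infinite integrals: the
    fundamental theorem of calculus on [1/(n+2), n+2], then monotone limits on
    both sides. *)
Lemma half_line_FTC h1 h2 H (la lb : R) :
  (forall s, 0 < s -> {for s, continuous h1}) ->
  (forall s, 0 < s -> {for s, continuous h2}) ->
  (forall s, 0 < s -> 0 <= h1 s) -> (forall s, 0 < s -> 0 <= h2 s) ->
  (forall s, 0 < s -> is_derive s 1 H (h1 s - h2 s)) ->
  H n.+2%:R^-1 @[n --> \oo] --> la -> H n.+2%:R @[n --> \oo] --> lb ->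
  (\int[leb]_(s in `]0%R, +oo[) (h1 s)%:E =
   \int[leb]_(s in `]0%R, +oo[) (h2 s)%:E + (lb - la)%:E)%E.
Proof.
move=> c1 c2 p1 p2 dH ca cb.
have cut0 n s : cut n s -> 0 < s.
  move=> ns; have : (\bigcup_n cut n) s by exists n.
  by rewrite bigcup_cut /= in_itv/= andbT.
have ab n : (n.+2%:R^-1 : R) < n.+2%:R.
  rewrite (@lt_trans _ _ 1)// ?invf_lt1// ?ltr1n//.
have cs n h : (forall s, 0 < s -> {for s, continuous h}) -> {within cut n, continuous h}.
  move=> ch; apply: continuous_in_subspaceT => s /set_mem /cut0; exact: ch.
have ic n h : (forall s, 0 < s -> {for s, continuous h}) ->
    leb.-integrable (cut n) (EFin \o h).
  move=> ch; apply: continuous_compact_integrable; first exact: segment_compact.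
  exact: cs.
have dHs s : 0 < s -> derivable H s 1 by move=> s0; have [] := dH s s0.
have cH s : 0 < s -> {for s, continuous H}.
  by move=> s0; apply/differentiable_continuous/derivable1_diffP; exact: dHs.
have step n : (\int[leb]_(s in cut n) (h1 s)%:E =
    \int[leb]_(s in cut n) (h2 s)%:E + (H n.+2%:R - H n.+2%:R^-1)%:E)%E.
  have hF : (\int[leb]_(s in cut n) (h1 s - h2 s)%:E = (H n.+2%:R)%:E - (H n.+2%:R^-1)%:E)%E.
    apply: continuous_FTC2 => //.
    - by apply: cs => s s0; apply: cvgB; [exact: c1|exact: c2].
    - split.
      + by move=> s; rewrite in_itv/= => /andP[h _]; apply/dHs/lt_trans/h; rewrite invr_gt0.
      + by apply: cvg_at_right_filter; apply: cH; rewrite invr_gt0.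
      + by apply: cvg_at_left_filter; exact: cH.
    - move=> s; rewrite in_itv/= => /andP[h _]; rewrite derive1E.
      have s0 : 0 < s by apply/lt_trans/h; rewrite invr_gt0.
      by have [_ ->] := dH s s0.
  have hf : (\int[leb]_(s in cut n) (h2 s)%:E)%E \is a fin_num.
    by apply: integrable_fin_num (ic n _ c2); exact: measurable_itv.
  rewrite EFinB -hF; under [X in (_ + X)%E]eq_integral do rewrite EFinB.
  have mc : measurable (cut n : set (measurableTypeR R)) by exact: measurable_itv.
  rewrite (integralB_EFin mc (ic n h1 c1) (ic n h2 c2)).
  by rewrite addeC subeK.
have l1 := half_line_cvg c1 p1; have l2 := half_line_cvg c2 p2.
have l3 : (\int[leb]_(s in cut n) (h2 s)%:E + (H n.+2%:R - H n.+2%:R^-1)%:E)%E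
    @[n --> \oo] --> (\int[leb]_(s in `]0%R, +oo[) (h2 s)%:E + (lb - la)%:E)%E.
  apply: cvgeD => //; first by rewrite fin_num_adde_defl.
  by apply: cvg_EFin; [exact: nearW|exact: cvgB].
apply: (cvg_unique _ l1) => //; apply: cvg_trans l3; apply: near_eq_cvg.
by apply: nearW => n; exact/esym/step.
Qed.

Lemma half_line_scaling h x : 0 < x ->
  (forall s, 0 < s -> {for s, continuous h}) -> (forall s, 0 < s -> 0 <= h s) ->
  (\int[leb]_(s in `]0%R, +oo[) (h s)%:E =
   \int[leb]_(s in `]0%R, +oo[) (h (x * s) * x)%:E)%E.
Proof.
move=> x0 ch h0.
have dx : (fun s => x * s)^`()%classic = cst x.
  apply/funext => s; rewrite derive1E.
  have D : is_derive s 1 (fun s => x * s) (x *: 1) by exact: is_deriveZ.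
  by rewrite derive_val /GRing.scale/= mulr1.
pose tail (a : R) n : set R := `[a * n.+1%:R^-1, +oo[%classic.
have tailcup (a : R) : 0 < a -> \bigcup_n tail a n = `]0, +oo[%classic.
  move=> a0; apply/seteqP; split=> [s [n _]|s]; rewrite /tail /= !in_itv/= !andbT.
    by apply: lt_le_trans; rewrite mulr_gt0// invr_gt0.
  move=> s0; exists (Num.truncn (a / s)) => //=; rewrite in_itv/= andbT.
  rewrite ler_pdivrMr// mulrC -ler_pdivrMr//.
  by have /truncn_itv/andP[_ /ltW] : 0 <= a / s by rewrite divr_ge0 ?ltW.
have tailhomo (a : R) : 0 < a -> {homo tail a : n m / (n <= m)%N >-> (n <= m)%O}.
  move=> a0 n m nm; apply/subsetPset => s; rewrite /tail /= !in_itv/= !andbT.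
  by apply: le_trans; rewrite ler_pM2l// lef_pV2 ?posrE// ler_nat.
have tc (a : R) (k : R -> R) : 0 < a -> (forall s, 0 < s -> {for s, continuous k}) ->
    (forall s, 0 < s -> 0 <= k s) ->
    (\int[leb]_(s in tail a n) (k s)%:E)%E @[n --> \oo] -->
    (\int[leb]_(s in `]0%R, +oo[) (k s)%:E)%E.
  move=> a0 ck k0; rewrite -(tailcup a a0); apply: ge0_nondecreasing_set_cvg_integral.
  - exact: tailhomo.
  - by move=> n; exact: measurable_itv.
  - move=> n; apply/measurable_EFinP; apply: measurable_funS (half_line_measurable ck) => //.
    by rewrite -(tailcup a a0); exact: bigcup_sup.
  - move=> n s ns; rewrite lee_fin k0//.
    have : (\bigcup_n tail a n) s by exists n.
    by rewrite tailcup//= in_itv/= andbT.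
have l1 := tc x h x0 ch h0.
have l2 : (\int[leb]_(s in tail 1%R n) (h (x * s) * x)%:E)%E @[n --> \oo] -->
    (\int[leb]_(s in `]0%R, +oo[) (h (x * s) * x)%:E)%E.
  apply: (tc 1 (fun s => h (x * s) * x)) => // [s s0|s s0].
    apply: cvgMr_tmp; apply: (@continuous_comp _ _ _ (fun s => x * s) h).
      exact: mulrl_continuous.
    by apply: ch; rewrite mulr_gt0.
  by rewrite mulr_ge0 ?(ltW x0)// h0// mulr_gt0.
apply: (cvg_unique _ l1) => //; apply: cvg_trans l2; apply: near_eq_cvg.
apply: nearW => n; rewrite /tail mul1r.
rewrite (@increasing_ge0_integration_by_substitutiony _ (fun s => x * s) h (n.+1%:R^-1)).
- by apply: eq_integral => s _; rewrite dx.
- by move=> s t _ _ st; rewrite ltr_pM2l.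
- by rewrite dx => s _; exact: cvg_cst.
- by rewrite dx; exact: is_cvg_cst.
- by rewrite dx; exact: is_cvg_cst.
- split=> [s _|].
    by have D : is_derive s 1 (fun s => x * s) (x *: 1) by exact: is_deriveZ.
  by apply: cvg_at_right_filter; exact: mulrl_continuous.
- by apply: gt0_cvgMry => //; exact: cvg_id.
- apply: continuous_in_subspaceT => s; rewrite inE /= in_itv/= andbT => hs.
  by apply: ch; apply: lt_le_trans hs; rewrite mulr_gt0// invr_gt0.
- move=> s; rewrite in_itv/= andbT => hs; apply: h0.
  by apply: lt_trans hs; rewrite mulr_gt0// invr_gt0.
Qed.

End half_line_integrals.

(** * Fractional powers as integrals of exponentials *)

Section fractional_integral.
Context (R : realType).
Local Notation leb := (@lebesgue_measure R).
Implicit Types (s x p : R).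

Lemma powR_le1D p s : 0 <= p -> p <= 1 -> 0 <= s -> s `^ p <= 1 + s.
Proof.
move=> p0 p1 s0; have [s1|/ltW s1] := leP 1 s.
  by apply: le_trans (ler1_powR s1 p1) _; lra.
apply: (@le_trans _ _ 1); last by lra.
have -> : 1 = 1 `^ p :> R by rewrite powR1.
by apply: ge0_ler_powR => //; rewrite nnegrE.
Qed.

Lemma is_derive_expN x s :
  is_derive s 1 (fun t : R => expR (- (x * t))) (- x * expR (- (x * s))).
Proof.
have D1 : is_derive s 1 (fun t : R => - (x * t)) (- x).
  have D : is_derive s 1 (fun t => x * t) (x *: 1) by exact: is_deriveZ.
  by apply: is_derive_eq (is_deriveN D) _; rewrite /GRing.scale/= mulr1.
have D := @is_derive1_comp _ expR (fun t => - (x * t)) s (expR (- (x * s))) (- x)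
  (is_derive_expR _) D1.
by apply: is_derive_eq D _; rewrite mulrC.
Qed.

Lemma continuous_expN x : continuous (fun t : R => expR (- (x * t))).
Proof.
move=> s; apply/differentiable_continuous/derivable1_diffP.
by have [] := is_derive_expN x s.
Qed.

Lemma continuous_powR_pos p s : 0 < s -> {for s, continuous (fun t : R => t `^ p)}.
Proof.
move=> s0; apply/differentiable_continuous/derivable1_diffP.
by have [] := is_derive1_powR p s0.
Qed.

Lemma invn2_cvg : (n.+2%:R^-1 : R) @[n --> \oo] --> (0 : R).
Proof.
have := @cvg_harmonic R; rewrite -(cvg_shiftn 1).
by apply: cvg_trans; apply: near_eq_cvg; apply: nearW => n; rewrite /harmonic/= addn1.
Qed.

Lemma invn2_powR_cvg p : 0 < p -> (n.+2%:R^-1 : R) `^ p @[n --> \oo] --> (0 : R).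
Proof.
move=> p0; have [h _] := cvg_at_rightP (fun t : R => t `^ p) 0 0.
apply: (h (powR_cvg0 p0) (fun n => n.+2%:R^-1)); split; last exact: invn2_cvg.
by move=> n; rewrite invr_gt0.
Qed.

Lemma cvg0_le (u v : nat -> R) : (forall n, 0 <= u n) -> (forall n, u n <= v n) ->
  v n @[n --> \oo] --> (0 : R) -> u n @[n --> \oo] --> (0 : R).
Proof.
move=> u0 uv cv; apply: (@squeeze_cvgr _ _ _ _ (fun=> 0) v) => //; last exact: cvg_cst.
by apply: nearW => n; rewrite u0 uv.
Qed.

Lemma expN_half_le s : 0 < s -> (1 + s) * expR (- (1 * s)) <= 2 * expR (- (2^-1 * s)).
Proof.
move=> s0; rewrite mul1r; have -> : - s = - (2^-1 * s) + - (2^-1 * s) by field.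
rewrite expRD mulrA ler_wpM2r ?expR_ge0//.
rewrite -ler_pdivlMr ?expR_gt0// expRN invrK.
have := expR_ge1Dx (2^-1 * s); have := expR_gt0 (2^-1 * s); nra.
Qed.

Lemma expN_integral_finite :
  (\int[leb]_(s in `]0%R, +oo[) (2^-1 * expR (- (2^-1 * s)))%:E < +oo)%E.
Proof.
have -> : (\int[leb]_(s in `]0%R, +oo[) (2^-1 * expR (- (2^-1 * s)))%:E =
    \int[leb]_(s in `]0%R, +oo[) (0 : R)%:E + (0 - (- 1))%:E)%E; last first.
  by rewrite integral0 add0e ltry.
apply: (@half_line_FTC R _ (fun=> 0) (fun s => - expR (- (2^-1 * s)))).
- move=> s _; apply: cvgMl_tmp; exact: continuous_expN.
- by move=> s _; exact: cvg_cst.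
- by move=> s _; rewrite mulr_ge0// expR_ge0.
- by [].
- move=> s _; have D := is_deriveN (is_derive_expN 2^-1 s).
  by apply: is_derive_eq D _; rewrite subr0 mulNr opprK.
- apply: cvgN; have := cvg_comp _ _ invn2_cvg (@continuous_expN 2^-1 0).
  by rewrite mulr0 oppr0 expR0.
- rewrite -[X in _ --> X]oppr0; apply: cvgN.
  apply: (@cvg0_le _ (fun n => 2 * n.+2%:R^-1)) => [n|n|]; first exact: expR_ge0.
    rewrite expRN -ler_pdivrMl// -invfM lef_pV2 ?posrE ?mulr_gt0 ?expR_gt0//.
    by have := expR_ge1Dx (2^-1 * n.+2%:R : R); lra.
  by rewrite -[X in _ --> X](mulr0 2); apply: cvgMl_tmp; exact: invn2_cvg.
Qed.

Context (alpha : R).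
Hypotheses (alpha0 : 0 < alpha) (alpha1 : alpha < 1).

Let gam s := s `^ (1 - alpha - 1) * expR (- s).

Lemma gamma_cont s : 0 < s -> {for s, continuous gam}.
Proof.
move=> s0.
have -> : gam = fun t => t `^ (1 - alpha - 1) * expR (- (1 * t)).
  by apply/funext => t; rewrite mul1r.
by apply: cvgM; [exact: continuous_powR_pos|exact: continuous_expN].
Qed.

Lemma gamma_nonneg s : 0 <= gam s.
Proof. by rewrite mulr_ge0 ?powR_ge0 ?expR_ge0. Qed.

(** Integration by parts replaces the density, singular at 0, by a bounded one. *)
Lemma gamma_finite : (\int[leb]_(s in `]0%R, +oo[) (gam s)%:E < +oo)%E.
Proof.
pose H s := s `^ (1 - alpha) * expR (- (1 * s)).
have p0 : 0 < 1 - alpha by rewrite subr_gt0.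
have p1 : 1 - alpha <= 1 by rewrite gerBl ltW.
have Hc s : 0 < s -> {for s, continuous H}.
  move=> s0; apply: cvgM; first exact: continuous_powR_pos.
  exact: continuous_expN.
have H0 s : 0 <= H s by rewrite mulr_ge0 ?powR_ge0 ?expR_ge0.
have Hle s : 0 < s -> H s <= 2 * expR (- (2^-1 * s)).
  move=> s0; apply: le_trans (expN_half_le s0).
  by rewrite ler_wpM2r ?expR_ge0// powR_le1D// ltW.
have HI : (\int[leb]_(s in `]0%R, +oo[) (H s)%:E < +oo)%E.
  apply: (@le_lt_trans _ _ (\int[leb]_(s in `]0%R, +oo[) ((4%:E * (2^-1 * expR (- (2^-1 * s)))%:E)))%E).
    apply: ge0_le_integral => //.
    - by move=> s _; rewrite lee_fin.
    - by apply/measurable_EFinP; exact: (@half_line_measurable R H Hc).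
    - apply/measurable_EFinP; apply: (@half_line_measurable _ (fun s => 4 * (2^-1 * expR (- (2^-1 * s))))) => s s0.
      by apply: cvgMl_tmp; apply: cvgMl_tmp; exact: continuous_expN.
    - move=> s; rewrite /= in_itv/= andbT => s0; rewrite -EFinM lee_fin.
      by apply: le_trans (Hle s s0) _; rewrite mulrA (_ : 4 / 2 = 2 :> R)//; field.
  rewrite ge0_integralZl//.
  - by rewrite lte_mul_pinfty// expN_integral_finite.
  - apply/measurable_EFinP.
    apply: (@half_line_measurable _ (fun s => 2^-1 * expR (- (2^-1 * s)))) => s s0.
    by apply: cvgMl_tmp; exact: continuous_expN.
have E : (\int[leb]_(s in `]0%R, +oo[) ((1 - alpha)%:E * (gam s)%:E) =
   \int[leb]_(s in `]0%R, +oo[) (H s)%:E)%E.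
  have add0 (a : \bar R) : a = (a + ((0 : R) - 0)%:E)%E by rewrite subrr adde0.
  rewrite [RHS]add0; under eq_integral do rewrite -EFinM.
  apply: (@half_line_FTC R (fun s => (1 - alpha) * gam s) H H) => //.
  - by move=> s s0; apply: cvgMl_tmp; exact: gamma_cont.
  - by move=> s _; rewrite mulr_ge0 ?gamma_nonneg// ltW.
  - move=> s s0; have D := is_deriveM (is_derive1_powR (1 - alpha) s0) (is_derive_expN 1 s).
    apply: is_derive_eq D _; rewrite /gam /H /GRing.scale/= mul1r; ring.
  - apply: cvg0_le (invn2_powR_cvg p0) => // n.
    rewrite /H ler_piMr ?powR_ge0// expR_le1 mul1r oppr_le0 invr_ge0//.
  - apply: (@cvg0_le _ (fun n => 4 * n.+2%:R^-1)) => // [n|].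
      apply: le_trans (Hle _ _) _ => //; rewrite -[4]/(2 * 2)%N%:R natrM -mulrA ler_pM2l//.
      rewrite expRN -ler_pdivrMl// -invfM lef_pV2 ?posrE ?mulr_gt0 ?expR_gt0//.
      by have := expR_ge1Dx (2^-1 * n.+2%:R : R); lra.
    by rewrite -[X in _ --> X](mulr0 4); apply: cvgMl_tmp; exact: invn2_cvg.
move: HI; rewrite -E ge0_integralZl//.
- case: (\int[leb]_(s in _) _)%E => [r _|/=|_]; rewrite ?ltry ?ltNyr//.
  by rewrite gt0_muley ?lte_fin.
- by apply/measurable_EFinP; exact: (@half_line_measurable R gam gamma_cont).
- by move=> s _; rewrite lee_fin gamma_nonneg.
- by rewrite lee_fin ltW.
Qed.

Lemma Gamma_integral :
  (\int[leb]_(s in `]0%R, +oo[) (gam s)%:E = (Gamma (1 - alpha))%:E)%E.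
Proof.
rewrite /Gamma /Rintegral fineK// ge0_fin_numE; first exact: gamma_finite.
by apply: integral_ge0 => s _; rewrite lee_fin gamma_nonneg.
Qed.

(** Below 1 the integrand is at least 1/e. *)
Lemma Gamma_gt0 : 0 < Gamma (1 - alpha).
Proof.
have p0 : 0 < 1 - alpha by rewrite subr_gt0.
pose c := expR (- 1) : R.
have c0 : 0 < c by exact: expR_gt0.
rewrite -lte_fin -Gamma_integral.
apply: (@lt_le_trans _ _ (\int[leb]_(s in `]0%R, 1%R]) (cst c%:E s))%E).
  rewrite integral_cst//= lebesgue_measure_itv/= lte_fin ltr01 -EFinB subr0 mule1.
  by rewrite lte_fin.
apply: (@le_trans _ _ (\int[leb]_(s in `]0%R, 1%R]) (gam s)%:E)%E).
  apply: ge0_le_integral => //=.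
  - by move=> s _; rewrite lee_fin ltW.
  - apply/measurable_EFinP; apply: measurable_funS (half_line_measurable gamma_cont) => //.
    by move=> s; rewrite /= !in_itv/= andbT => /andP[].
  - move=> s; rewrite in_itv/= => /andP[s0 s1]; rewrite lee_fin /gam.
    rewrite -[leLHS]mul1r; apply: ler_pM; rewrite ?(ltW c0)//; last by rewrite ler_expR lerN2.
    have -> : 1 = s `^ 0 by rewrite powRr0.
    by apply: ger_powR; rewrite ?s0// addrAC subrr add0r oppr_le0 ltW.
apply: ge0_subset_integral => //=.
- apply/measurable_EFinP; exact: (half_line_measurable gamma_cont).
- by move=> s _; rewrite lee_fin gamma_nonneg.
- by move=> s; rewrite /= !in_itv/= andbT => /andP[].
Qed.

(** Integration by parts, then the substitution of [x * s] for [s] in the integral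
    defining [Gamma (1 - alpha)]. *)
Lemma fractional_integral x : 0 < x ->
  (\int[leb]_(s in `]0%R, +oo[) ((1 - expR (- (x * s))) * s `^ (- (1 + alpha)))%:E =
   (x `^ alpha * Gamma (1 - alpha) / alpha)%:E)%E.
Proof.
move=> x0; pose h1 s := x * expR (- (x * s)) * s `^ (- alpha).
pose h s := (1 - expR (- (x * s))) * s `^ (- (1 + alpha)).
pose H s := (1 - expR (- (x * s))) * s `^ (- alpha).
have e1 s : 0 <= s -> 0 <= 1 - expR (- (x * s)).
  by move=> s0; rewrite subr_ge0 expR_le1 oppr_le0 mulr_ge0// ltW.
have e2 s : 1 - expR (- (x * s)) <= x * s.
  by have := expR_ge1Dx (- (x * s)); lra.
have ch s : 0 < s -> {for s, continuous h}.
  move=> s0; apply: cvgM; last exact: continuous_powR_pos.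
  by apply: cvgB; [exact: cvg_cst|exact: continuous_expN].
have h0 s : 0 < s -> 0 <= h s by move=> s0; rewrite mulr_ge0 ?powR_ge0// e1// ltW.
have p0 : 0 < 1 - alpha by rewrite subr_gt0.
have E1 : (\int[leb]_(s in `]0%R, +oo[) (h1 s)%:E =
    \int[leb]_(s in `]0%R, +oo[) (alpha * h s)%:E)%E.
  have add0 (a : \bar R) : a = (a + ((0 : R) - 0)%:E)%E by rewrite subrr adde0.
  rewrite [RHS]add0.
  apply: (@half_line_FTC R h1 (fun s => alpha * h s) H) => //.
  - move=> s s0; apply: cvgM; last exact: continuous_powR_pos.
    by apply: cvgMl_tmp; exact: continuous_expN.
  - by move=> s s0; apply: cvgMl_tmp; exact: ch.
  - by move=> s s0; rewrite !mulr_ge0 ?powR_ge0 ?expR_ge0// ltW.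
  - by move=> s s0; rewrite mulr_ge0 ?h0// ltW.
  - move=> s s0; have D1 : is_derive s 1 (fun t : R => 1 - expR (- (x * t))) (x * expR (- (x * s))).
      have D := is_deriveB (is_derive_cst (1 : R) s 1) (is_derive_expN x s).
      by apply: is_derive_eq D _; rewrite sub0r mulNr opprK.
    have D := is_deriveM D1 (is_derive1_powR (- alpha) s0).
    apply: is_derive_eq D _; rewrite /h1 /h /GRing.scale/= opprD addrC (addrC (- 1)); ring.
  - apply: (@cvg0_le _ (fun n => x * n.+2%:R^-1 `^ (1 - alpha))) => [n|n|].
    + by rewrite mulr_ge0 ?powR_ge0// e1// invr_ge0.
    + have w0 : 0 < (n.+2%:R^-1 : R) by rewrite invr_gt0.
      apply: (@le_trans _ _ (x * n.+2%:R^-1 * n.+2%:R^-1 `^ (- alpha))).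
        by rewrite ler_wpM2r ?powR_ge0.
      rewrite powRD ?gt_eqF ?implybT// powRr1 ?mulrA// ltW//.
    + by rewrite -[X in _ --> X](mulr0 x); apply: cvgMl_tmp; exact: invn2_powR_cvg.
  - apply: (@cvg0_le _ (fun n => n.+2%:R^-1 `^ alpha)) => [n|n|].
    + by rewrite mulr_ge0 ?powR_ge0// e1.
    + rewrite -powR_inv1// -powRrM mulN1r -[leRHS]mul1r ler_wpM2r ?powR_ge0//.
    + exact: invn2_powR_cvg.
have E2 : (\int[leb]_(s in `]0%R, +oo[) (h1 s)%:E =
    (x `^ alpha)%:E * (Gamma (1 - alpha))%:E)%E.
  rewrite -Gamma_integral (half_line_scaling x0 gamma_cont (fun s _ => gamma_nonneg s)).
  rewrite -ge0_integralZl//.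
  - apply: eq_integral => s; rewrite inE /= in_itv/= andbT => s0.
    rewrite -EFinM; congr EFin; rewrite /h1 /gam.
    rewrite (_ : 1 - alpha - 1 = - alpha); last by ring.
    rewrite (powRM _ (ltW x0) (ltW s0)) (powRN x); field.
    by rewrite gt_eqF// powR_gt0.
  - apply/measurable_EFinP; apply: (@half_line_measurable _ (fun s => gam (x * s) * x)) => s s0.
    apply: cvgMr_tmp; apply: (@continuous_comp _ _ _ (fun s => x * s) gam).
      exact: mulrl_continuous.
    by apply: gamma_cont; rewrite mulr_gt0.
  - by move=> s _; rewrite lee_fin mulr_ge0 ?gamma_nonneg// ltW.
  - by rewrite lee_fin powR_ge0.
have E3 : (alpha%:E * \int[leb]_(s in `]0%R, +oo[) (h s)%:E =
    (x `^ alpha * Gamma (1 - alpha))%:E)%E.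
  rewrite EFinM -E2 E1 -ge0_integralZl//.
  - by apply/measurable_EFinP; exact: (@half_line_measurable R h ch).
  - by move=> s; rewrite /= in_itv/= andbT => s0; rewrite lee_fin h0.
  - by rewrite lee_fin ltW.
have -> : (x `^ alpha * Gamma (1 - alpha) / alpha)%:E =
    (alpha^-1%:E * (x `^ alpha * Gamma (1 - alpha))%:E)%E.
  by rewrite -EFinM mulrC.
by rewrite -E3 muleA -EFinM mulVf ?gt_eqF// mul1e.
Qed.

End fractional_integral.

(** * Bernstein polynomials *)

Section bernstein.
Context (R : realType).
Implicit Types (r : R) (g : nat -> R).

Definition bernstein (n k : nat) r : R := 'C(n, k)%:R * r ^+ k * (1 - r) ^+ (n - k).

Definition bernstein_mean n r g : R := \sum_(k < n.+1) bernstein n k r * g k.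

Lemma bernstein_ge0 n k r : 0 <= r -> r <= 1 -> 0 <= bernstein n k r.
Proof. by move=> r0 r1; rewrite !mulr_ge0 ?exprn_ge0 ?subr_ge0. Qed.

Lemma bernsteinS n k r :
  bernstein n.+1 k.+1 r = r * bernstein n k r + (1 - r) * bernstein n k.+1 r.
Proof.
rewrite /bernstein binS natrD subSS exprS.
have [kn|nk] := ltnP k n.
  rewrite -(subnSK kn) exprS; ring.
by rewrite bin_small// !mul0r mulr0 add0r addr0; ring.
Qed.

Lemma bernstein_mean_rec n r g : bernstein_mean n.+1 r g =
  r * bernstein_mean n r (g \o S) + (1 - r) * bernstein_mean n r g.
Proof.
rewrite /bernstein_mean big_ord_recl /=.
under eq_bigr do rewrite /bump/= add1n bernsteinS mulrDl.
rewrite big_split/= addrCA mulr_sumr; congr (_ + _).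
  by apply: eq_bigr => i _; rewrite mulrA.
rewrite [in LHS]big_ord_recr [in RHS]big_ord_recl/= mulrDr /bump/=.
have -> : bernstein n n.+1 r = 0 by rewrite /bernstein bin_small// !mul0r.
rewrite mulr0 mul0r addr0; congr (_ + _).
  by rewrite /bernstein/= !bin0 !expr0 !subn0 exprS; ring.
by rewrite mulr_sumr; apply: eq_bigr => i _ /=; rewrite ?add1n -mulrA.
Qed.

Lemma bernstein_meanD n r g h :
  bernstein_mean n r (fun k => g k + h k) = bernstein_mean n r g + bernstein_mean n r h.
Proof. by rewrite -big_split; apply: eq_bigr => i _; rewrite mulrDr. Qed.

Lemma bernstein_meanZ n r g a :
  bernstein_mean n r (fun k => a * g k) = a * bernstein_mean n r g.
Proof. by rewrite mulr_sumr; apply: eq_bigr => i _; rewrite mulrCA. Qed.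

Lemma bernstein_mean_eq n r g h : g =1 h -> bernstein_mean n r g = bernstein_mean n r h.
Proof. by move=> gh; apply: eq_bigr => i _; rewrite gh. Qed.

Lemma bernstein_mean1 n r : bernstein_mean n r (fun=> 1) = 1.
Proof.
elim: n => [|n IH]; last by rewrite bernstein_mean_rec IH; ring.
by rewrite /bernstein_mean big_ord_recl big_ord0 /bernstein/= bin0 subnn !expr0; ring.
Qed.

Lemma bernstein_mean_id n r : bernstein_mean n r (fun k => k%:R) = n%:R * r.
Proof.
elim: n => [|n IH].
  by rewrite /bernstein_mean big_ord_recl big_ord0 /=; ring.
rewrite bernstein_mean_rec (bernstein_mean_eq _ _ (h := fun k => k%:R + 1)).
  by rewrite bernstein_meanD bernstein_mean1 IH -natr1; ring.
by move=> k; rewrite /= natr1.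
Qed.

Lemma bernstein_mean_sqr n r : bernstein_mean n r (fun k => k%:R ^+ 2) =
  n%:R * r * (1 - r) + (n%:R * r) ^+ 2.
Proof.
elim: n => [|n IH].
  by rewrite /bernstein_mean big_ord_recl big_ord0 /=; ring.
rewrite bernstein_mean_rec
  (bernstein_mean_eq _ _ (h := fun k => k%:R ^+ 2 + (2 * k%:R + 1))).
  rewrite !bernstein_meanD bernstein_meanZ bernstein_mean1 bernstein_mean_id IH.
  by rewrite -natr1; ring.
by move=> k; rewrite /= -natr1; ring.
Qed.

Lemma bernstein_variance n r : (0 < n)%N ->
  bernstein_mean n r (fun k => (k%:R / n%:R - r) ^+ 2) = r * (1 - r) / n%:R.
Proof.
move=> n0; have nn : n%:R != 0 :> R by rewrite pnatr_eq0 -lt0n.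
rewrite (bernstein_mean_eq _ _ (h := fun k =>
  n%:R^-1 ^+ 2 * k%:R ^+ 2 + (- (2 * r / n%:R) * k%:R + r ^+ 2 * 1))).
  rewrite !bernstein_meanD !bernstein_meanZ bernstein_mean1 bernstein_mean_id.
  by rewrite bernstein_mean_sqr; field.
by move=> k; field.
Qed.

Lemma bernstein_parabola n r : (0 < n)%N -> 0 <= r -> r <= 1 ->
  bernstein_mean n r (fun k => k%:R / n%:R * (1 - k%:R / n%:R)) <= r * (1 - r).
Proof.
move=> n0 r0 r1; have nn : n%:R != 0 :> R by rewrite pnatr_eq0 -lt0n.
rewrite (bernstein_mean_eq _ _ (h := fun k =>
  - (n%:R^-1 ^+ 2) * k%:R ^+ 2 + n%:R^-1 * k%:R)); last by move=> k; field.
rewrite !bernstein_meanD !bernstein_meanZ bernstein_mean_id bernstein_mean_sqr.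
rewrite [leLHS](_ : _ = r * (1 - r) - r * (1 - r) / n%:R); last by field.
by rewrite gerBl divr_ge0// mulr_ge0// subr_ge0.
Qed.

End bernstein.

Section bernstein_vector.
Context (R : realType) (V : normedModType R).
Implicit Types (r : R).

Lemma bernstein_vector_le n r (h : nat -> V) (v : V) g : 0 <= r -> r <= 1 ->
  (forall k, (k <= n)%N -> `|v - h k| <= g k) ->
  `|v - \sum_(k < n.+1) bernstein n k r *: h k| <= bernstein_mean n r g.
Proof.
move=> r0 r1 vh; have -> : v = \sum_(k < n.+1) bernstein n k r *: v.
  rewrite -scaler_suml -[LHS]scale1r -(bernstein_mean1 n r); congr (_ *: _).
  by apply: eq_bigr => k _; rewrite mulr1.
rewrite -sumrB; apply: le_trans (ler_norm_sum _ _ _) _; apply: ler_sum => k _.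
rewrite -scalerBr normrZ ger0_norm ?bernstein_ge0// ler_wpM2l ?bernstein_ge0//.
by apply: vh; rewrite -ltnS.
Qed.

(** The mean deviation is bounded by the variance through
    |k/n - r| <= (1/N + N (k/n - r)^2) / 2; the choice n = N^2 balances the two
    terms without square roots. *)
Lemma bernstein_lipschitz (K : R) (N : nat) r (f : R -> V) : (0 < N)%N ->
  0 <= r -> r <= 1 -> 0 <= K ->
  (forall x y, 0 <= x <= 1 -> 0 <= y <= 1 -> `|f x - f y| <= K * `|x - y|) ->
  `|f r - \sum_(k < (N ^ 2).+1) bernstein (N ^ 2) k r *: f (k%:R / (N ^ 2)%:R)|
    <= K / N%:R.
Proof.
move=> N0 r0 r1 K0 fK; set n := (N ^ 2)%N.
have n0 : (0 < n)%N by rewrite expn_gt0 N0.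
have nn : 0 < n%:R :> R by rewrite ltr0n.
have NN : 0 < N%:R :> R by rewrite ltr0n.
apply: le_trans (bernstein_vector_le (h := fun k => f (k%:R / n%:R))
  (g := fun k => K / 2 / N%:R * 1 + K / 2 * N%:R * (k%:R / n%:R - r) ^+ 2) r0 r1 _) _.
  move=> k kn; apply: (@le_trans _ _ (K * `|r - k%:R / n%:R|)).
    apply: fK; rewrite ?r0// divr_ge0//= ler_pdivrMr// mul1r ler_nat//.
  have -> : K / 2 / N%:R * 1 + K / 2 * N%:R * (k%:R / n%:R - r) ^+ 2 =
     K * (2^-1 / N%:R * (1 + (N%:R * `|r - k%:R / n%:R|) ^+ 2)).
    rewrite exprMn real_normK ?num_real// -[in RHS](sqrrN (r - _)) opprB; field.
    by rewrite !gt_eqF.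
  apply: ler_wpM2l => //; rewrite -mulrA ler_pdivlMl// ler_pdivlMl//.
  have := sqr_ge0 (N%:R * `|r - k%:R / n%:R| - 1).
  move: (`|_ - _ |) => z; nra.
rewrite bernstein_meanD !bernstein_meanZ bernstein_mean1 bernstein_variance//.
have -> : n%:R = N%:R ^+ 2 :> R by rewrite /n natrX.
have : r * (1 - r) <= 1 by nra.
move: (r * (1 - r)) => q q1.
have -> : K / 2 / N%:R * 1 + K / 2 * N%:R * (q / N%:R ^+ 2) = K / N%:R * ((1 + q) / 2).
  by field; rewrite gt_eqF.
by apply: ler_piMr; [rewrite divr_ge0// ltW|lra].
Qed.

(** The Bernstein polynomials of r (1 - r) lie below it. *)
Lemma bernstein_boundary (K : R) n r (f : R -> V) : (0 < n)%N ->
  0 <= r -> r <= 1 -> 0 <= K ->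
  (forall x, 0 <= x <= 1 -> `|f x| <= K * (x * (1 - x))) ->
  `|\sum_(k < n.+1) bernstein n k r *: f (k%:R / n%:R)| <= K * (r * (1 - r)).
Proof.
move=> n0 r0 r1 K0 fK; have nn : 0 < n%:R :> R by rewrite ltr0n.
rewrite -normrN -sub0r.
apply: le_trans (bernstein_vector_le (h := fun k => f (k%:R / n%:R))
  (g := fun k => K * (k%:R / n%:R * (1 - k%:R / n%:R))) r0 r1 _) _.
  move=> k kn; rewrite sub0r normrN fK// divr_ge0//= ler_pdivrMr// mul1r ler_nat//.
by rewrite bernstein_meanZ ler_wpM2l// bernstein_parabola.
Qed.

End bernstein_vector.

(** * Levy functionals and their convergence *)

Lemma cvg_sum_ord (R : realType) (W : normedModType R) T (F : set_system T)
    (FF : Filter F) n (f : 'I_n -> T -> W) (l : 'I_n -> W) :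
  (forall i, f i t @[t --> F] --> l i) ->
  \sum_(i < n) f i t @[t --> F] --> \sum_(i < n) l i.
Proof.
elim: n f l => [|n IH] f l fl.
  rewrite big_ord0 (_ : (fun t => _) = fun=> 0); first exact: cvg_cst.
  by apply/funext => t; rewrite big_ord0.
rewrite big_ord_recl (_ : (fun t => _) = fun t => f ord0 t +
    \sum_(i < n) f (lift ord0 i) t).
  by apply: cvgD => //; exact: IH.
by apply/funext => t; rewrite big_ord_recl.
Qed.

Section levy_functionals.
Context (R : realType).
Implicit Types (h : R -> R) (L : (R -> R) -> R) (s : R) (p : {poly R}).

(** Test functions for Levy measures: 1 - exp(-s) is comparable to min(1, s). *)
Definition levy_class h : Prop :=
  {within `[0, +oo[, continuous h} /\
  exists A : R, forall s, 0 <= s -> `|h s| <= A * (1 - expR (- s)).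

(** Positive linear functionals on [levy_class]. The integrals against mu_t / t
    and against the Levy measure are both of this kind, though the latter is an
    infinite measure. *)
Definition levy_functional L : Prop :=
  (forall a h1 h2, levy_class h1 -> levy_class h2 ->
     L (fun s => a * h1 s + h2 s) = a * L h1 + L h2) /\
  (forall h1 h2, levy_class h1 -> levy_class h2 ->
     (forall s, 0 <= s -> h1 s <= h2 s) -> L h1 <= L h2).

Definition exp_poly p s : R := (1 - expR (- s)) * p.[expR (- s)].

Lemma expN_itv s : 0 <= s -> 0 < expR (- s) <= 1.
Proof. by move=> s0; rewrite expR_gt0 expR_le1 oppr_le0. Qed.

Lemma levy_classD a h1 h2 : levy_class h1 -> levy_class h2 ->
  levy_class (fun s => a * h1 s + h2 s).
Proof.
move=> [c1 [A1 b1]] [c2 [A2 b2]]; split.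
  by move=> s; apply: cvgD; [apply: cvgMl_tmp; exact: c1|exact: c2].
exists (`|a| * A1 + A2) => s s0; apply: le_trans (ler_normD _ _) _.
by rewrite mulrDl -mulrA normrM lerD ?b2// ler_wpM2l// b1.
Qed.

Lemma levy_class0 : levy_class (fun=> 0).
Proof.
split; first by move=> s; exact: cvg_cst.
by exists 0 => s _; rewrite normr0 mul0r.
Qed.

Lemma levy_class_sum n (a : 'I_n -> R) (h : 'I_n -> R -> R) :
  (forall k, levy_class (h k)) -> levy_class (fun s => \sum_(k < n) a k * h k s).
Proof.
elim: n a h => [|n IH] a h ch.
  rewrite (_ : (fun s => _) = fun=> 0); first exact: levy_class0.
  by apply/funext => s; rewrite big_ord0.
rewrite (_ : (fun s => _) = fun s => a ord0 * h ord0 s +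
    \sum_(k < n) a (lift ord0 k) * h (lift ord0 k) s).
  by apply: levy_classD => //; exact: IH.
by apply/funext => s; rewrite big_ord_recl.
Qed.

Lemma exp_poly_class p : levy_class (exp_poly p).
Proof.
have cE : continuous (fun s : R => expR (- s)).
  by move=> s; apply: continuous_comp; [exact: opp_continuous|exact: continuous_expR].
split.
  apply: continuous_subspaceT => s; apply: cvgM.
    by apply: cvgB; [exact: cvg_cst|exact: cE].
  apply: (@continuous_comp _ _ _ (fun s : R => expR (- s)) (horner p)); first exact: cE.
  exact: continuous_horner.
exists (\sum_(i < size p) `|p`_i|) => s s0; have /andP[e0 e1] := expN_itv s0.
rewrite normrM ger0_norm ?subr_ge0// mulrC ler_wpM2r ?subr_ge0// horner_coef.
apply: le_trans (ler_norm_sum _ _ _) _; apply: ler_sum => i _.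
rewrite normrM (ger0_norm (exprn_ge0 _ (ltW e0))) ler_piMr//.
by rewrite exprn_ile1 ?(ltW e0).
Qed.

Section one_functional.
Context (L : (R -> R) -> R).
Hypothesis hL : levy_functional L.

Lemma levy_functional0 : L (fun=> 0) = 0.
Proof.
have := hL.1 (-1) _ _ levy_class0 levy_class0.
rewrite (_ : (fun s => _) = fun=> 0); first by move=> ->; ring.
by apply/funext => s; ring.
Qed.

Lemma levy_functional_sum n (a : 'I_n -> R) (h : 'I_n -> R -> R) :
  (forall k, levy_class (h k)) ->
  L (fun s => \sum_(k < n) a k * h k s) = \sum_(k < n) a k * L (h k).
Proof.
elim: n a h => [|n IH] a h ch.
  rewrite big_ord0 (_ : (fun s => _) = fun=> 0); first exact: levy_functional0.
  by apply/funext => s; rewrite big_ord0.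
rewrite (_ : (fun s => _) = fun s => a ord0 * h ord0 s +
    \sum_(k < n) a (lift ord0 k) * h (lift ord0 k) s).
  by rewrite hL.1// ?big_ord_recl ?IH//; exact: levy_class_sum.
by apply/funext => s; rewrite big_ord_recl.
Qed.

End one_functional.

Lemma exp_poly_cvg (Lt : R -> (R -> R) -> R) (L0 : (R -> R) -> R) p :
  (forall t, 0 < t -> levy_functional (Lt t)) -> levy_functional L0 ->
  (forall k, Lt t (exp_poly 'X^k) @[t --> 0^'+] --> L0 (exp_poly 'X^k)) ->
  Lt t (exp_poly p) @[t --> 0^'+] --> L0 (exp_poly p).
Proof.
move=> hLt hL0 hk; rewrite -[p]coefK poly_def.
have E : exp_poly (\sum_(i < size p) p`_i *: 'X^i) =
    fun s => \sum_(i < size p) p`_i * exp_poly 'X^i s.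
  apply/funext => s; rewrite /exp_poly horner_sum mulr_sumr; apply: eq_bigr => i _.
  by rewrite hornerZ mulrCA.
rewrite E levy_functional_sum//; last by move=> k; exact: exp_poly_class.
have h : \sum_(i < size p) p`_i * Lt t (exp_poly 'X^i) @[t --> 0^'+] -->
    \sum_(i < size p) p`_i * L0 (exp_poly 'X^i).
  by apply: cvg_sum_ord => i; apply: cvgMl_tmp; exact: hk.
apply: cvg_trans h; apply: near_eq_cvg; near=> t.
rewrite levy_functional_sum//; last by move=> k; exact: exp_poly_class.
by apply: hLt; near: t; exact: nbhs_right_gt.
Unshelve. all: by end_near.
Qed.

End levy_functionals.

Lemma ratio_le_1BexpN (R : realType) (s : R) : 0 <= s -> s / (1 + s) <= 1 - expR (- s).
Proof.
move=> s0; have s1 : 0 < 1 + s by rewrite ltr_wpDr.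
have -> : s / (1 + s) = 1 - (1 + s)^-1 by field; rewrite gt_eqF.
by rewrite lerD2l lerN2 expRN lef_pV2 ?posrE ?expR_gt0// expR_ge1Dx.
Qed.

Section levy_convergence.
Context (R : realType) (V : normedModType R) (ip : V -> V -> R).
Hypothesis hip : inner_product ip.
Context (phi : R -> V) (C M : R).
Hypotheses (C0 : 0 <= C) (M0 : 0 <= M).
Hypothesis phi0 : phi 0 = 0.
Hypothesis phi_lip : forall s t, 0 <= s -> 0 <= t -> `|phi s - phi t| <= C * `|s - t|.
Hypothesis phi_bnd : forall s, 0 <= s -> `|phi s| <= M.
Implicit Types (s r : R) (p : {poly R}).

Let K := C + M.

Let K0 : 0 <= K. Proof. exact: addr_ge0. Qed.

Lemma phi_bound s : 0 <= s -> `|phi s| <= K * (s / (1 + s)).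
Proof.
move=> s0; have s1 : 0 < 1 + s by rewrite ltr_wpDr.
have h1 : `|phi s| <= C * s.
  by have := phi_lip s0 (lexx 0); rewrite phi0 !subr0 (ger0_norm s0).
have h2 := phi_bnd s0.
rewrite mulrA ler_pdivlMr// mulrDr mulr1 /K mulrDl.
by rewrite lerD// ler_wpM2r.
Qed.

Lemma phi_exp_bound s : 0 <= s -> `|phi s| <= K * (1 - expR (- s)).
Proof.
move=> s0; apply: (le_trans (phi_bound s0)); apply: ler_wpM2l => //.
exact: ratio_le_1BexpN.
Qed.

(** The curve in the variable r = exp(-s); the factor r makes it vanish at
    infinity. *)
Let f r : V := r *: phi (- ln r).

Let ln_le0 r : 0 < r -> r <= 1 -> 0 <= - ln r.
Proof. by move=> r0 r1; rewrite oppr_ge0 ln_le0. Qed.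

Let f0 : f 0 = 0. Proof. by rewrite /f scale0r. Qed.

Let fE s : f (expR (- s)) = expR (- s) *: phi s.
Proof. by rewrite /f expRK opprK. Qed.

Let f_norm r : 0 <= r -> r <= 1 -> `|f r| <= M * r.
Proof.
rewrite le_eqVlt => /predU1P[<- _|r0 r1]; first by rewrite f0 normr0 mulr0.
by rewrite /f normrZ (gtr0_norm r0) mulrC ler_wpM2r ?(ltW r0)// phi_bnd ?ln_le0.
Qed.

Let f_lip x y : 0 <= x <= 1 -> 0 <= y <= 1 -> `|f x - f y| <= K * `|x - y|.
Proof.
wlog xy : x y / x <= y.
  move=> H hx hy; have [xy|/ltW yx] := leP x y; first exact: H.
  by rewrite distrC (distrC x); exact: H.
move=> /andP[x0 x1] /andP[y0 y1]; rewrite (distrC x) (ger0_norm (_ : 0 <= y - x)) ?subr_ge0//.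
move: x0; rewrite le_eqVlt => /predU1P[<-|x0].
  rewrite f0 sub0r normrN subr0; apply: le_trans (f_norm y0 y1) _.
  by rewrite ler_wpM2r// /K lerDr.
have y0' : 0 < y by exact: lt_le_trans xy.
have -> : f x - f y = x *: (phi (- ln x) - phi (- ln y)) - (y - x) *: phi (- ln y).
  by rewrite /f scalerBr scalerBl opprB addrA subrK.
apply: le_trans (ler_normB _ _) _; rewrite !normrZ (gtr0_norm x0).
rewrite (ger0_norm (_ : 0 <= y - x)) ?subr_ge0// /K [leRHS]mulrDl lerD//; last first.
  by rewrite mulrC ler_wpM2r ?subr_ge0// phi_bnd// ln_le0.
have hl : `|phi (- ln x) - phi (- ln y)| <= C * (ln y - ln x).
  have := phi_lip (ln_le0 x0 x1) (ln_le0 y0' y1).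
  by rewrite opprK [- ln x + _]addrC ger0_norm// subr_ge0 ler_ln.
have h2 : x * (ln y - ln x) <= y - x.
  rewrite -ln_div//; have := expR_ge1Dx (ln (y / x)); rewrite lnK ?posrE ?divr_gt0// => h.
  have : x * (1 + ln (y / x)) <= x * (y / x) by rewrite ler_pM2l.
  by rewrite mulrCA divff ?gt_eqF// mulr1; lra.
apply: (@le_trans _ _ (x * (C * (ln y - ln x)))); first by rewrite ler_wpM2l// ltW.
by rewrite mulrCA ler_wpM2l.
Qed.

Let f_parabola r : 0 <= r <= 1 -> `|f r| <= K * (r * (1 - r)).
Proof.
move=> /andP[]; rewrite le_eqVlt => /predU1P[<- _|r0 r1].
  by rewrite f0 normr0 mul0r mulr0.
rewrite /f normrZ (gtr0_norm r0) mulrCA ler_wpM2l ?(ltW r0)//.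
by have := phi_exp_bound (ln_le0 r0 r1); rewrite opprK lnK.
Qed.

(** For 0 < k < n, [bernstein n k r] is r (1 - r) times this polynomial. At
    k = 0 and k = n this fails, but [f] vanishes at the two corresponding nodes. *)
Definition bernstein_quotient (n k : nat) : {poly R} :=
  'C(n, k)%:R *: ('X ^+ k.-1 * (1 - 'X) ^+ (n - k).-1).

(** Bernstein's polynomial of [f], divided by r. *)
Definition exp_approx (n : nat) s : V :=
  \sum_(k < n.+1) exp_poly (bernstein_quotient n k) s *: f (k%:R / n%:R).

(** The first term accounts for the uniform error K/N of Bernstein's
    approximation, at the points where it is at most 8 j r (1 - r) K/N; the
    second one for the error near r = 0 and r = 1, bounded there by
    2 K r (1 - r). *)
Definition exp_error (j N : nat) : {poly R} :=
  (K * (8 * j%:R / N%:R))%:P + (4 * K) *: (1 - 2 *: 'X) ^+ (2 * j).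

Let f1 : f 1 = 0. Proof. by rewrite /f ln1 oppr0 phi0 scaler0. Qed.

Lemma exp_approxE n s : (0 < n)%N -> expR (- s) *: exp_approx n s =
  \sum_(k < n.+1) bernstein n k (expR (- s)) *: f (k%:R / n%:R).
Proof.
move=> n0; rewrite scaler_sumr; apply: eq_bigr => k _; set r := expR _.
have [->|k0] := eqVneq (k : nat) 0%N; first by rewrite mul0r f0 !scaler0.
have [->|kn] := eqVneq (k : nat) n.
  by rewrite divff ?pnatr_eq0 -?lt0n// f1 !scaler0.
rewrite scalerA; congr (_ *: _).
have {}kn : (k < n)%N by rewrite ltn_neqAle kn -ltnS ltn_ord.
rewrite /exp_poly /bernstein_quotient /bernstein -/r.
rewrite !(hornerZ, hornerM, hornerXn, horner_exp, hornerD, hornerN, hornerX, hornerC).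
rewrite -[in r ^+ k](@prednK k) ?lt0n// -[in RHS](@prednK (n - k)) ?subn_gt0// !exprS.
ring.
Qed.

Lemma bernoulli_pow (z : R) (j : nat) : 0 <= z -> z <= 1 -> 1 - j%:R * z <= (1 - z) ^+ j.
Proof.
move=> z0 z1; elim: j => [|j IH]; first by rewrite mul0r subr0.
rewrite exprS -natr1; have : (1 - z) * (1 - j%:R * z) <= (1 - z) * (1 - z) ^+ j.
  by rewrite ler_wpM2l// subr_ge0.
apply: le_trans; have : 0 <= j%:R * (z * z) by rewrite !mulr_ge0.
lra.
Qed.

(** With z = r (1 - r): if 4 j z > 1/2, the uniform error K/N is at most
    8 j z K/N. Otherwise (1 - 2 r)^(2j) = (1 - 4 z)^j is at least 1/2 by
    Bernoulli's inequality, and both [f] and its Bernstein polynomial are bounded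
    by K z. *)
Lemma exp_approx_error (j N : nat) s : (0 < N)%N -> 0 <= s ->
  `|phi s - exp_approx (N ^ 2) s| <= exp_poly (exp_error j N) s.
Proof.
move=> N0 s0; have /andP[r0 r1] := expN_itv s0; set n := (N ^ 2)%N.
have n0 : (0 < n)%N by rewrite expn_gt0 N0.
have NN : 0 < N%:R :> R by rewrite ltr0n.
set r := expR (- s) in r0 r1 *.
rewrite -(ler_pM2l r0) -{1}(gtr0_norm r0) -normrZ scalerBr exp_approxE// -fE -/r.
have h1 := bernstein_lipschitz N0 (ltW r0) r1 K0 f_lip.
have h2 := bernstein_boundary n0 (ltW r0) r1 K0 f_parabola.
have h3 := ler_normB (f r) (\sum_(k < n.+1) bernstein n k r *: f (k%:R / n%:R)).
have h4 : `|f r| <= K * (r * (1 - r)) by apply: f_parabola; rewrite ltW.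
set D := `|_ - _| in h1 h3 *; pose z := r * (1 - r).
have z0 : 0 <= z by rewrite mulr_ge0 ?subr_ge0// ltW.
have z4 : 4 * z <= 1 by have := sqr_ge0 (1 - 2 * r); rewrite /z; lra.
have y2 : (1 - 2 * r) ^+ 2 = 1 - 4 * z by rewrite /z; ring.
rewrite /exp_poly /exp_error -/r.
rewrite !(hornerZ, hornerM, hornerXn, horner_exp, hornerD, hornerN, hornerX, hornerC) exprM mulrA -/z.
rewrite [in X in _ <= X](_ : (1 - 2 * r) ^+ 2 = 1 - 4 * z)//.
have hb := @bernoulli_pow (4 * z) j (mulr_ge0 (ler0n _ 4) z0) z4.
have y0 : 0 <= (1 - 4 * z) ^+ j by rewrite exprn_ge0// subr_ge0.
have [small|big] := leP (j%:R * (4 * z)) 2^-1.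
  have : 0 <= z * (K * (8 * j%:R / N%:R)).
    exact: mulr_ge0 z0 (mulr_ge0 K0 (divr_ge0 (mulr_ge0 (ler0n _ 8) (ler0n _ j)) (ltW NN))).
  have : K * z * 2^-1 <= K * z * (1 - 4 * z) ^+ j.
    by rewrite ler_wpM2l ?mulr_ge0//; lra.
  by rewrite /D in h3 *; move: h2 h4; rewrite -/z; lra.
have : 0 <= z * (4 * K * (1 - 4 * z) ^+ j) := mulr_ge0 z0 (mulr_ge0 (mulr_ge0 (ler0n _ 4) K0) y0).
have : K / N%:R <= z * (K * (8 * j%:R / N%:R)).
  have -> : z * (K * (8 * j%:R / N%:R)) = K / N%:R * (2 * (j%:R * (4 * z))).
    by field; rewrite gt_eqF.
  by rewrite ler_peMr ?divr_ge0 ?(ltW NN)//; lra.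
by rewrite mulrDr; move: h1; lra.
Qed.

Let exp_error_ge0 j N s : (0 < N)%N -> 0 <= s -> 0 <= exp_poly (exp_error j N) s.
Proof. by move=> N0 s0; apply: le_trans (exp_approx_error j N0 s0). Qed.

Lemma levy_class_curve w : levy_class (fun s => ip (phi s) w).
Proof.
split; last first.
  exists (K * `|w|) => s s0; apply: le_trans (cauchy_schwarz hip _ _) _.
  by rewrite mulrAC ler_wpM2r// phi_exp_bound.
suff cphi : {within `[0, +oo[, continuous phi}.
  by move=> s; apply: (cvg_ip hip); [exact: cphi|exact: cvg_cst].
apply/within_continuous_epsP => s; rewrite /= in_itv/= andbT => s0 e e0.
have C1 : 0 < C + 1 by rewrite ltr_wpDl.
exists (e / (C + 1)); first by rewrite divr_gt0.
move=> t; rewrite /= in_itv/= andbT => t0; rewrite ltr_pdivlMr// => st.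
apply: le_lt_trans (phi_lip s0 t0) (le_lt_trans _ st).
by rewrite mulrC ler_wpM2l// lerDl.
Qed.

(** The difference is tested against itself: the Cauchy-Schwarz inequality reduces
    the claim to [exp_approx_error] and the monotonicity of [L]. *)
Lemma exp_approx_functional L I j N : levy_functional L -> (0 < N)%N ->
  (forall w, ip I w = L (fun s => ip (phi s) w)) ->
  `|I - \sum_(k < (N ^ 2).+1)
       L (exp_poly (bernstein_quotient (N ^ 2) k)) *: f (k%:R / (N ^ 2)%:R)| <=
    L (exp_poly (exp_error j N)).
Proof.
move=> hL N0 hI; set J := \sum_(k < _) _; set E := L _.
have E0 : 0 <= E.
  rewrite -(levy_functional0 hL); apply: hL.2; first exact: levy_class0.
    exact: exp_poly_class.
  by move=> s; exact: exp_error_ge0.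
pose z := I - J; have [->|z0] := eqVneq (I - J) 0; first by rewrite normr0.
rewrite -/z in z0 *; have nz : 0 < `|z| by rewrite normr_gt0.
rewrite -(ler_pM2r nz) -expr2 (ip_sqrE hip) {1}/z (ipBl hip) hI /J (ip_suml hip).
under [X in _ - X]eq_bigr do rewrite (ipZl hip) mulrC.
pose a (k : 'I_(N ^ 2).+1) := ip (f (k%:R / (N ^ 2)%:R)) z.
pose h (k : 'I_(N ^ 2).+1) := exp_poly (bernstein_quotient (N ^ 2) k).
have ch k : levy_class (h k) by exact: exp_poly_class.
rewrite -/(h _) -(levy_functional_sum hL a ch).
have cs := levy_class_sum a ch; have cz := levy_class_curve z.
have c0 := @levy_class0 R; have ce := exp_poly_class (exp_error j N).
have -> : E * `|z| = L (fun s => `|z| * exp_poly (exp_error j N) s + 0).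
  by rewrite hL.1// (levy_functional0 hL) addr0 mulrC.
rewrite addrC -mulN1r -hL.1//; apply: hL.2; [exact: levy_classD|exact: levy_classD|].
move=> s s0; rewrite addr0 mulN1r addrC.
apply: (@le_trans _ _ (ip (phi s - exp_approx (N ^ 2) s) z)).
  rewrite (ipBl hip) /exp_approx (ip_suml hip) lerD2l lerN2 ler_sum// => k _.
  by rewrite (ipZl hip) mulrC.
apply: le_trans (ip_le hip _ _) _.
by rewrite mulrC ler_wpM2l// exp_approx_error.
Qed.

(** First [j] is chosen large, then [N] large against [j]. *)
Lemma exp_error_lt L : levy_functional L ->
  L (exp_poly ((1 - 2 *: 'X) ^+ (2 * j))) @[j --> \oo] --> 0 ->
  forall e, 0 < e -> exists j N, (0 < N)%N /\ L (exp_poly (exp_error j N)) < e.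
Proof.
move=> hL cL e e0; have e2 : 0 < e / 2 by rewrite divr_gt0.
have : 4 * K * L (exp_poly ((1 - 2 *: 'X) ^+ (2 * j))) @[j --> \oo] --> 4 * K * 0.
  exact: cvgMl_tmp.
rewrite mulr0 => /cvgrPdist_lt/(_ _ e2)[j _ /(_ j (leqnn j))] /=.
set b := L _; rewrite sub0r normrN => hb; exists j.
pose c := 8 * j%:R * K * L (exp_poly 1).
have cc1 : 0 < `|c| + 1 by rewrite ltr_wpDl.
have [N hN] := natSinv_lt (divr_gt0 e2 cc1).
exists N.+1; split=> //.
have -> : exp_poly (exp_error j N.+1) = fun s => K * (8 * j%:R / N.+1%:R) * exp_poly 1 s +
    (4 * K * exp_poly ((1 - 2 *: 'X) ^+ (2 * j)) s + 0).
  apply/funext => s; rewrite /exp_poly /exp_error hornerD hornerC hornerZ hornerC.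
  by rewrite addr0; ring.
have c0 := @levy_class0 R.
have c1 := exp_poly_class 1; have c2 := exp_poly_class ((1 - 2 *: 'X) ^+ (2 * j)).
rewrite hL.1//; last exact: levy_classD.
rewrite hL.1// (levy_functional0 hL) addr0 -/b.
have := ler_norm (4 * K * b); have := ler_norm c.
have -> : K * (8 * j%:R / N.+1%:R) * L (exp_poly 1) = c * N.+1%:R^-1.
  by rewrite /c; ring.
have := hN N (leqnn N); have : 0 < N.+1%:R^-1 :> R by rewrite invr_gt0.
move: (N.+1%:R^-1) => r r0; rewrite ltr_pdivlMr ?ltr_wpDl// => hr cc bb.
have : c * r <= `|c| * r by rewrite ler_wpM2r// ltW.
by lra.
Qed.

(** The approximants and the error bounds are both exponential polynomials, on
    which convergence is known. *)
Theorem levy_convergence (Lt : R -> (R -> R) -> R) L0 (It : R -> V) I0 :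
  (forall t, 0 < t -> levy_functional (Lt t)) -> levy_functional L0 ->
  (forall k, Lt t (exp_poly 'X^k) @[t --> 0^'+] --> L0 (exp_poly 'X^k)) ->
  L0 (exp_poly ((1 - 2 *: 'X) ^+ (2 * j))) @[j --> \oo] --> 0 ->
  (forall t w, 0 < t -> ip (It t) w = Lt t (fun s => ip (phi s) w)) ->
  (forall w, ip I0 w = L0 (fun s => ip (phi s) w)) ->
  It t @[t --> (0 : R)^'+] --> I0.
Proof.
move=> hLt hL0 hk hj hI hI0; apply/cvgrPdist_lt => e e0.
have e3 : 0 < e / 3 by rewrite divr_gt0.
have [j [N [N0 small]]] := exp_error_lt hL0 hj e3.
pose J L := \sum_(k < (N ^ 2).+1)
  L (exp_poly (bernstein_quotient (N ^ 2) k)) *: f (k%:R / (N ^ 2)%:R).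
have cJ : J (Lt t) @[t --> 0^'+] --> J L0.
  by apply: cvg_sum_ord => k; apply: cvgZr_tmp; exact: exp_poly_cvg.
have cE := exp_poly_cvg (p := exp_error j N) hLt hL0 hk.
have h0 := exp_approx_functional j hL0 N0 hI0.
near=> t.
have t0 : 0 < t by near: t; exact: nbhs_right_gt.
have h1 := exp_approx_functional j (hLt t t0) N0 (fun w => hI t w t0).
have h2 : Lt t (exp_poly (exp_error j N)) < e / 3.
  by near: t; exact: (cvgr_lt _ cE).
have h3 : `|J L0 - J (Lt t)| < e / 3.
  by near: t; move/cvgrPdist_lt: cJ; exact.
rewrite -/(J _) in h0 h1.
have -> : I0 - It t = (I0 - J L0) + ((J L0 - J (Lt t)) - (It t - J (Lt t))).
  by rewrite opprB !addrA !subrK.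
apply: le_lt_trans (ler_normD _ _) _.
have := ler_normB (J L0 - J (Lt t)) (It t - J (Lt t)).
by lra.
Unshelve. all: by end_near.
Qed.

End levy_convergence.

(** * Image measures and integrals with a density *)

Section image_measure.
Context d1 d2 (X : measurableType d1) (Y : measurableType d2) (R : realType).
Context (V : normedModType R).
Variables (phi : X -> Y) (mphi : measurable_fun setT phi).
Variables (mu : {measure set X -> \bar R}).

Definition image_measure : {measure set Y -> \bar R} :=
  measure_function_pushforward__canonical__measure_function_Measure mu mphi.

Lemma Bochner_integrable_pushforward (D : set Y) (f : Y -> V) : measurable D ->
  dist_measurable D f ->
  Bochner_integrable image_measure D f -> Bochner_integrable mu (phi @^-1` D) (f \o phi).
Proof.
move=> mD mf [sn [ssn asn isn]].
have mpre A : measurable A -> measurable (phi @^-1` A).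
  move=> mA; rewrite -[X in measurable X]setTI; exact: (mphi measurableT mA).
exists (fun n => sn n \o phi); split.
- move=> n; have [fs ms] := ssn n; split.
    by apply: sub_finite_set fs => _ [x Dx <-]; exists (phi x).
  by move=> v; have [m1 m2] := ms v; split; [exact: (mpre _ m1)|exact: m2].
- have [N [mN N0 hN]] := asn; exists (phi @^-1` N); split; [exact: (mpre _ mN)|exact: N0|].
  by move=> x hx; exact: (hN (phi x) hx).
- apply: cvg_trans isn; apply: near_eq_cvg; apply: nearW => n.
  rewrite (_ : (\int[image_measure]_(y in D) _)%E = (\int[pushforward mu phi]_(y in D) `|f y - sn n y|%:E)%E)//.
  rewrite ge0_integral_pushforward//.
  apply/measurable_EFinP; exact: (measurable_fun_dist_simple mD mf (ssn n)).
Qed.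
End image_measure.

Section weighted_integrals.
Context (R : realType) d (Y : measurableType d) (nu : {measure set Y -> \bar R}).
Context (pos : Y -> R) (D : set Y).
Hypothesis mD : measurable D.
Hypothesis mpos : measurable_fun D pos.
Hypothesis D_ge0 : forall y, D y -> 0 <= pos y.
Context (c : R) (g : Y -> R).
Hypotheses (c0 : 0 <= c) (g0 : forall y, D y -> 0 <= g y).
Hypothesis mg : measurable_fun D g.
Hypothesis ig : nu.-integrable D (EFin \o (fun y => (1 - expR (- pos y)) * g y)).
Implicit Types (h : R -> R).

(** The carrier [Y] and the coordinate [pos] cover the two Borel structures on the
    real line in use below. *)
Definition weighted_integral h : R := c * \int[nu]_(y in D) (h (pos y) * g y).

Lemma levy_class_measurable h : levy_class h ->
  measurable_fun D (fun y => h (pos y) * g y).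
Proof.
move=> [ch _]; apply: measurable_funM => //.
have mh : measurable_fun (`[0, +oo[%classic : set R) h.
  exact: subspace_continuous_measurable_fun.
apply: (measurable_comp _ _ mh mpos) => //.
by move=> _ [y Dy <-]; rewrite /= in_itv/= andbT D_ge0.
Qed.

Lemma levy_class_integrable h : levy_class h ->
  nu.-integrable D (EFin \o (fun y => h (pos y) * g y)).
Proof.
move=> lh; have [A hA] := lh.2.
have iA : nu.-integrable D (EFin \o (fun y => A * ((1 - expR (- pos y)) * g y))).
  exact: (integrableZl mD A ig).
apply: le_integrable iA => //.
  by apply/measurable_EFinP; exact: levy_class_measurable.
move=> y Dy; rewrite /= lee_fin normrM (ger0_norm (g0 Dy)).
by apply: le_trans (ler_norm _); rewrite mulrA ler_wpM2r ?g0// hA// D_ge0.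
Qed.

Lemma weighted_integral_levy : levy_functional weighted_integral.
Proof.
split=> [a h1 h2 l1 l2|h1 h2 l1 l2 h12]; rewrite /weighted_integral.
  have i1 := levy_class_integrable l1; have i2 := levy_class_integrable l2.
  rewrite mulrCA -mulrDr; congr (_ * _); rewrite -RintegralZl// -RintegralD//.
    by apply: eq_RintegralD => s _; ring.
  exact: (integrableZl mD a i1).
apply: ler_wpM2l => //; apply: le_Rintegral => //; do ?exact: levy_class_integrable.
by move=> y Dy; rewrite ler_wpM2r ?g0// h12// D_ge0.
Qed.

Hypothesis D_gt0 : forall y, D y -> 0 < pos y.

(** (1 - 2 r)^2 < 1 for 0 < r < 1: dominated convergence. *)
Lemma weighted_integral_peak :
  weighted_integral (exp_poly ((1 - 2 *: 'X) ^+ (2 * j))) @[j --> \oo] --> 0.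
Proof.
rewrite -(mulr0 c); apply: cvgMl_tmp.
pose r y := expR (- pos y).
pose u j y := exp_poly ((1 - 2 *: 'X) ^+ (2 * j)) (pos y) * g y.
have uE j y : u j y = (1 - r y) * ((1 - 2 * r y) ^+ 2) ^+ j * g y.
  rewrite /u /exp_poly.
  by rewrite !(hornerZ, horner_exp, hornerD, hornerN, hornerX, hornerC) -exprM.
suff : (\int[nu]_(y in D) (u j y)%:E @[j --> \oo] --> \int[nu]_(y in D) (cst 0%:E y))%E.
  by rewrite integral0 => /fine_cvg.
apply: (@dominated_cvg _ _ _ _ _ mD _ _ (fun y => ((1 - r y) * g y)%:E)).
- move=> j; apply/measurable_EFinP; apply: levy_class_measurable.
  exact: exp_poly_class.
- move=> y Dy; apply: cvg_EFin; first exact: nearW.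
  have r0 : 0 < r y by exact: expR_gt0.
  have r1 : r y < 1 by rewrite expR_lt1 oppr_lt0 D_gt0.
  rewrite (_ : fine \o _ = fun j => (1 - r y) * (((1 - 2 * r y) ^+ 2) ^+ j) * g y).
    rewrite -(mul0r (g y)) -(mulr0 (1 - r y)); apply: cvgMr_tmp; apply: cvgMl_tmp.
    apply: cvg_expr; rewrite ger0_norm ?sqr_ge0//; nra.
  by apply/funext => j /=; rewrite uE.
- by [].
- exact: ig.
- move=> j y Dy; rewrite lee_fin uE.
  have /andP[r0 r1] := expN_itv (D_ge0 Dy); rewrite -/(r y) in r0 r1.
  have y0 := sqr_ge0 (1 - 2 * r y).
  rewrite !normrM (ger0_norm (g0 Dy)) ler_wpM2r ?g0//.
  rewrite (ger0_norm (exprn_ge0 j y0)) ger0_norm ?subr_ge0//.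
  by rewrite ler_piMr ?subr_ge0// exprn_ile1//; nra.
Qed.

End weighted_integrals.

(** * Exponential moments *)

Section exponential_moments.
Context (R : realType).
Implicit Types (L : (R -> R) -> R) (k : nat).

Definition exp_gap k (s : R) : R := 1 - expR (- (k%:R * s)).

Lemma exp_gapS k : exp_gap k.+1 = fun s => 1 * exp_poly 'X^k s + exp_gap k s.
Proof.
apply/funext => s; rewrite /exp_gap /exp_poly hornerXn -expRM_natl -natr1.
rewrite mulrDl mul1r opprD expRD mulrN; ring.
Qed.

Lemma exp_gap_class k : levy_class (exp_gap k).
Proof.
elim: k => [|k IH].
  rewrite (_ : exp_gap 0 = fun=> 0); first exact: levy_class0.
  by apply/funext => s; rewrite /exp_gap mul0r oppr0 expR0 subrr.
by rewrite exp_gapS; apply: levy_classD => //; exact: exp_poly_class.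
Qed.

Lemma exp_poly_moment L k : levy_functional L ->
  L (exp_poly 'X^k) = L (exp_gap k.+1) - L (exp_gap k).
Proof.
move=> hL; have ck := exp_gap_class k; have cp := @exp_poly_class R 'X^k.
by rewrite exp_gapS hL.1// mul1r addrK.
Qed.

(** u exp(-u) <= 1 - exp(-u) <= u with u = t y. *)
Lemma exp_slope (y : R) : t^-1 * (1 - expR (- (t * y))) @[t --> 0^'+] --> y.
Proof.
have cE : y * expR (- (y * t)) @[t --> 0^'+] --> y * expR (- (y * 0)).
  apply: cvgMl_tmp; apply: cvg_within_filter; exact: (@continuous_expN R y 0).
rewrite mulr0 oppr0 expR0 mulr1 in cE.
apply: (squeeze_cvgr _ cE (cvg_cst y)).
near=> t; have t0 : 0 < t by near: t; exact: nbhs_right_gt.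
rewrite (mulrC y t); set u := t * y.
have h1 : (1 + u) * expR (- u) <= 1.
  by rewrite expRN ler_pdivrMr ?expR_gt0// mul1r expR_ge1Dx.
have h2 := expR_ge1Dx (- u).
have tt : t^-1 * t = 1 by rewrite mulVf// gt_eqF.
apply/andP; split.
  have -> : y * expR (- u) = t^-1 * (u * expR (- u)) by rewrite /u !mulrA tt mul1r.
  by rewrite ler_pM2l ?invr_gt0//; lra.
by rewrite ler_pdivrMl// -/u; lra.
Unshelve. all: by end_near.
Qed.

End exponential_moments.

(** * The Levy measure of the stable subordinator *)

Section stable_levy_measure.
Context (R : realType) (alpha : R).
Hypotheses (alpha0 : 0 < alpha) (alpha1 : alpha < 1).
Local Notation leb := (@lebesgue_measure R).

Definition stable_levy : (R -> R) -> R :=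
  weighted_integral leb (fun s => s) `]0, +oo[ (alpha / Gamma (1 - alpha)) (fun s => s `^ (- (1 + alpha))).

Let c0 : 0 <= alpha / Gamma (1 - alpha).
Proof. by rewrite divr_ge0 ?(ltW alpha0) ?(ltW (Gamma_gt0 _ _)). Qed.

Let mD : measurable (`]0, +oo[%classic : set (measurableTypeR R)).
Proof. exact: measurable_itv. Qed.

Let mpos : measurable_fun (`]0, +oo[%classic : set (measurableTypeR R)) (fun s => s : R).
Proof. exact: measurable_id. Qed.

Let D_gt0 s : (`]0, +oo[%classic : set R) s -> 0 < s.
Proof. by rewrite /= in_itv/= andbT. Qed.

Let D_ge0 s : (`]0, +oo[%classic : set R) s -> 0 <= s.
Proof. by move=> /D_gt0/ltW. Qed.

Let g0 s : (`]0, +oo[%classic : set R) s -> 0 <= s `^ (- (1 + alpha)).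
Proof. by rewrite powR_ge0. Qed.

Lemma stable_density_measurable :
  measurable_fun (`]0, +oo[ : set (measurableTypeR R)) (fun s => s `^ (- (1 + alpha))).
Proof. by apply: half_line_measurable => s; exact: continuous_powR_pos. Qed.

Lemma stable_gap_integrable x : 0 < x -> leb.-integrable `]0, +oo[
  (EFin \o (fun s => (1 - expR (- (x * s))) * s `^ (- (1 + alpha)))).
Proof.
move=> x0; apply/integrableP; split.
  apply/measurable_EFinP; apply: half_line_measurable => s s0.
  apply: cvgM; last exact: continuous_powR_pos.
  by apply: cvgB; [exact: cvg_cst|exact: continuous_expN].
rewrite (_ : (\int[_]_(s in _) _)%E = (x `^ alpha * Gamma (1 - alpha) / alpha)%:E) ?ltry//.
rewrite -fractional_integral//; apply: eq_integral => s /set_mem /=.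
rewrite in_itv/= andbT => s0; rewrite ger0_norm// mulr_ge0 ?powR_ge0// subr_ge0.
by rewrite expR_le1 oppr_le0 mulr_ge0// ltW.
Qed.

Lemma stable_integrable : leb.-integrable `]0, +oo[
  (EFin \o (fun s => (1 - expR (- s)) * s `^ (- (1 + alpha)))).
Proof.
by apply: integrable_eqR (stable_gap_integrable ltr01) => // s _; rewrite mul1r.
Qed.

Lemma stable_levy_functional : levy_functional stable_levy.
Proof.
rewrite /stable_levy; apply: (weighted_integral_levy mD mpos D_ge0 c0 g0 stable_density_measurable).
exact: stable_integrable.
Qed.

Lemma stable_levy_gap k : stable_levy (exp_gap k) = k%:R `^ alpha.
Proof.
case: k => [|k].
  rewrite powR0 ?gt_eqF// (_ : exp_gap 0 = fun=> 0).
    exact: levy_functional0 stable_levy_functional.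
  by apply/funext => s; rewrite /exp_gap mul0r oppr0 expR0 subrr.
rewrite /stable_levy /weighted_integral /Rintegral /exp_gap fractional_integral//=.
by field; rewrite !gt_eqF ?Gamma_gt0.
Qed.

Lemma stable_levy_peak :
  stable_levy (exp_poly ((1 - 2 *: 'X) ^+ (2 * j))) @[j --> \oo] --> 0.
Proof.
exact: (weighted_integral_peak mD mpos D_ge0 _ g0 stable_density_measurable stable_integrable D_gt0).
Qed.

End stable_levy_measure.

(** * The measures of the stable subordinator *)

Section subordinator_functional.
Context (R : realType) (alpha : R) (mu : R -> probability R R).
Hypotheses (alpha0 : 0 < alpha).
Hypothesis cmu : convolution_semigroup mu.
Hypothesis amu : associated_to mu (fun x => x `^ alpha).

Let D : set R := `[0, +oo[%classic.

Let mD : measurable D.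
Proof. exact: measurable_itv. Qed.

Lemma subordinator_mass t : 0 <= t -> mu t D = 1%E.
Proof. by case: cmu => h _ _; exact: h. Qed.

Lemma subordinator_integrable_cst t c : (mu t).-integrable D (EFin \o (fun=> c : R)).
Proof. exact: finite_measure_integrable_cst. Qed.

Lemma subordinator_integral_cst t c : 0 <= t -> \int[mu t]_(s in D) c = c.
Proof. by move=> t0; rewrite Rintegral_cst//= subordinator_mass// mulr1. Qed.

Lemma subordinator_integrable_exp t x : 0 <= x ->
  (mu t).-integrable D (EFin \o (fun s => expR (- (s * x)))).
Proof.
move=> x0; apply: le_integrable (subordinator_integrable_cst t 1) => //.
  apply/measurable_EFinP; apply: subspace_continuous_measurable_fun => //.
  apply: continuous_subspaceT; rewrite (_ : (fun s => _) = fun s => expR (- (x * s))).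
    exact: continuous_expN.
  by apply/funext => s; rewrite mulrC.
move=> s; rewrite /D /= in_itv/= andbT => s0.
by rewrite lee_fin normr1 ger0_norm ?expR_ge0// expR_le1 oppr_le0 mulr_ge0.
Qed.

Definition subordinator_functional t : (R -> R) -> R :=
  weighted_integral (mu t) (fun s => s) D t^-1 (fun=> 1).

Lemma subordinator_levy t : 0 < t -> levy_functional (subordinator_functional t).
Proof.
move=> t0; have ti : 0 <= t^-1 by rewrite invr_ge0 ltW.
apply: weighted_integral_levy => //; first by move=> s; rewrite /D /= in_itv/= andbT.
have i1 := integrableB mD (subordinator_integrable_cst t 1) (subordinator_integrable_exp t ler01).
by apply: integrable_eqR i1 => // s _; rewrite !mulr1.
Qed.

Lemma subordinator_gap t k : 0 < t ->
  subordinator_functional t (exp_gap k) = t^-1 * (1 - expR (- (t * k%:R `^ alpha))).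
Proof.
move=> t0; rewrite /subordinator_functional /weighted_integral; congr (_ * _).
rewrite -(amu (ltW t0) (ler0n _ k)) -[X in _ = X - _](subordinator_integral_cst 1 (ltW t0)).
rewrite -RintegralB//; [|exact: subordinator_integrable_cst|exact: subordinator_integrable_exp].
by apply: eq_RintegralD => // s _; rewrite mulr1 /exp_gap mulrC.
Qed.

Lemma subordinator_moment_cvg k : alpha < 1 ->
  subordinator_functional t (exp_poly 'X^k) @[t --> 0^'+] -->
  stable_levy alpha (exp_poly 'X^k).
Proof.
move=> alpha1; have hL := stable_levy_functional alpha0 alpha1.
rewrite (exp_poly_moment k hL) !stable_levy_gap//.
have h : t^-1 * (1 - expR (- (t * k.+1%:R `^ alpha))) -
    t^-1 * (1 - expR (- (t * k%:R `^ alpha))) @[t --> 0^'+] -->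
    k.+1%:R `^ alpha - k%:R `^ alpha.
  by apply: cvgB; exact: exp_slope.
apply: cvg_trans h; apply: near_eq_cvg; near=> t.
have t0 : 0 < t by near: t; exact: nbhs_right_gt.
by rewrite (exp_poly_moment k (subordinator_levy t0)) !subordinator_gap.
Unshelve. all: by end_near.
Qed.

(** The function (exp(-s) - exp(-a))^2 has integral
    exp(-2 a) - 2 exp(-a) exp(-a) + exp(-2 a) = 0. *)
Lemma subordinator_dirac t a : 0 <= t ->
  \int[mu t]_(s in D) expR (- (s * 1)) = expR (- a) ->
  \int[mu t]_(s in D) expR (- (s * 2)) = expR (- (a * 2)) ->
  {ae mu t, forall s, D s -> s = a}.
Proof.
move=> t0 e1 e2; pose b : R := - 2 * expR (- a).
have dbl (s : R) : expR (- (s * 2)) = expR (- s) ^+ 2.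
  by rewrite -mulNr mulrC -natr1 mulrDl mul1r expRD -expr2.
pose q (s : R) := (expR (- s) - expR (- a)) ^+ 2.
have qE s : expR (- (s * 2)) + b * expR (- (s * 1)) + expR (- (a * 2)) = q s.
  by rewrite !dbl mulr1 /q /b; ring.
have i1 := @subordinator_integrable_exp t 1 ler01.
have i2 := @subordinator_integrable_exp t 2 (ler0n _ 2).
have ic := subordinator_integrable_cst t (expR (- (a * 2))).
have ib : (mu t).-integrable D (EFin \o (fun s => b * expR (- (s * 1)))).
  exact: (integrableZl mD b i1).
have i2b : (mu t).-integrable D
    (EFin \o (fun s => expR (- (s * 2)) + b * expR (- (s * 1)))).
  exact: (integrableD mD i2 ib).
have iq : (mu t).-integrable D (EFin \o q).
  by apply: (integrable_eqR mD _ (integrableD mD i2b ic)) => s _; rewrite qE.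
have q0 : \int[mu t]_(s in D) q s = 0.
  transitivity (\int[mu t]_(s in D)
      (expR (- (s * 2)) + b * expR (- (s * 1)) + expR (- (a * 2)))).
    by apply: eq_RintegralD => s _; rewrite qE.
  rewrite RintegralD// RintegralD// RintegralZl//.
  by rewrite e1 e2 subordinator_integral_cst// !dbl /b; ring.
have : (\int[mu t]_(s in D) `|(q s)%:E| = 0)%E.
  rewrite -[RHS]/(0%:E) -q0 /Rintegral fineK; last exact: integrable_fin_num.
  by apply: eq_integral => s _; rewrite /= ger0_norm// sqr_ge0.
move/(ae_eq_integral_abs (mu t) mD (measurable_int _ iq)).
apply: filterS => s h Ds; have /= := h Ds.
move=> [] /eqP; rewrite sqrf_eq0 subr_eq0 => /eqP/expR_inj/eqP.
by rewrite eqr_opp => /eqP.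
Qed.

End subordinator_functional.

(** * Subordination of nonlinear semigroups *)

Section nonlinear_subordination.
Context (R : realType) (V : normedModType R) (ip : V -> V -> R).
Hypotheses (hip : inner_product ip) (hV : seq_complete V).
Context (T : R -> V -> V) (A : V -> set V) (mu : R -> probability R R) (alpha : R).
Hypothesis hT : nonexpansive_semigroup T.
Hypothesis hA : generator ip T A.
Hypothesis bT : bounded_orbit T.
Hypotheses (alpha0 : 0 < alpha) (alpha1 : alpha <= 1).
Hypothesis cmu : convolution_semigroup mu.
Hypothesis amu : associated_to mu (fun x => x `^ alpha).
Implicit Types (u v w : V) (s t : R).

Local Notation leb := (@lebesgue_measure R).
Local Notation D := (`[0, +oo[%classic : set R).
Local Notation S := (subordination mu T).
Local Notation ipE := (ipDl hip, ipDr hip, ipNl hip, ipNr hip, ipZl hip, ipZr hip).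

Let D_ge0 s : D s -> 0 <= s. Proof. by rewrite /= in_itv/= andbT. Qed.
Let mD : measurable D. Proof. exact: measurable_itv. Qed.

Lemma orbit_bounded u : exists2 M, 0 <= M & forall s, 0 <= s -> `|T s u| <= M.
Proof.
have [v [M hM]] := bT; have [_ _ _ nT] := hT.
have M0 : 0 <= M.
  apply: le_trans (normr_ge0 (T 0 v)) _; apply: hM; exists 0 => //.
  by rewrite /= in_itv/= lexx.
exists (M + `|u - v|); first by rewrite addr_ge0.
move=> s s0; rewrite -[T s u](subrK (T s v)) addrC.
apply: le_trans (ler_normD _ _) _; rewrite lerD ?nT//.
by apply: hM; exists s => //; rewrite /= in_itv/= s0.
Qed.

Let hB : maximal_monotone ip A. Proof. by case: hA. Qed.
Let dA : closure (dom A) = setT. Proof. by case: hA. Qed.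

(** This identification transfers to [T] the Lipschitz bound and the right
    derivative of the constructed semigroup. *)
Lemma generated_semigroupE t u : 0 <= t -> T t u = semigroup A t u.
Proof.
move=> t0; have h1 := semigroup_nonexpansive hip hV hB dA.
have h2 := semigroup_generator hip hV hB dA.
exact: (semigroup_unique hip dA h1 hT h2 hA u t0).
Qed.

Lemma orbit_lipschitz u : dom A u -> exists2 C, 0 <= C &
  forall s t, 0 <= s -> 0 <= t -> `|T s u - T t u| <= C * `|s - t|.
Proof.
move=> [v Auv]; exists `|v| => // s t s0 t0.
rewrite !generated_semigroupE//; exact: (semigroup_lip hip hV hB dA Auv).
Qed.

Lemma orbit_right_derivative u : dom A u ->
  t^-1 *: (u - T t u) @[t --> 0^'+] --> min_section A u.
Proof.
move=> Du; have h := semigroup_right_derivative hip hV hB dA Du.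
apply: cvg_trans h; apply: near_eq_cvg; near=> t.
by rewrite generated_semigroupE//; near: t; exact: nbhs_right_ge.
Unshelve. all: by end_near.
Qed.

Lemma orbit_continuous u : {within D, continuous (T^~ u)}.
Proof. by case: hT. Qed.

Lemma orbit_dist_measurable u : dist_measurable D (T^~ u).
Proof. exact: (dist_measurable_continuous mD (@orbit_continuous u)). Qed.

Lemma orbit_Bochner_integrable t u : Bochner_integrable (mu t) D (T^~ u).
Proof.
have [M M0 hM] := orbit_bounded u.
(* The two Borel structures on the line have the same measurable sets; the
   identity transports the measure from one to the other. *)
have mid : measurable_fun setT (fun s : R => s : measurableTypeR R).
  by move=> _ B mB; rewrite setTI.
pose nu := image_measure mid (mu t).
have fin E : measurable E -> (nu E < +oo)%E.
  move=> mE; apply: (@le_lt_trans _ _ 1%E); last exact: ltry.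
  exact: (@probability_le1 _ _ _ (mu t) E mE).
apply: (@Bochner_integrable_pushforward _ _ _ _ _ _ _ mid (mu t) D (T^~ u)) => //.
  exact: orbit_dist_measurable.
apply: (@Bochner_integrable_continuous R V nu D _ _ _ _ _ (fun=> M)) => //.
- move=> y z /D_ge0 y0 yz; rewrite /= in_itv/= andbT; exact: le_trans yz.
- by move=> n; apply: fin; apply: measurableI => //; exact: measurable_itv.
- exact: orbit_continuous.
- by move=> y z /D_ge0 y0 yz; apply: hM; exact: le_trans yz.
- apply/integrableP; split; first exact/measurable_EFinP/measurable_cst.
  rewrite (_ : (\int[_]_(x in _) _)%E = (`|M|%:E * nu D)%E).
    rewrite lte_mul_pinfty//; exact: fin.
  by rewrite -integral_cst//.
Qed.

Lemma subordination_weak t u w :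
  (mu t).-integrable D (EFin \o (fun s => ip (T s u) w)) /\
  ip (S t u) w = \int[mu t]_(s in D) ip (T s u) w.
Proof.
apply: (Bochner_integral_weak hip hV mD w); first exact: orbit_dist_measurable.
exact: orbit_Bochner_integrable.
Qed.

(** The difference is tested against itself; the total mass is 1. *)
Lemma subordination_nonexpansive t u v : 0 <= t -> `|S t u - S t v| <= `|u - v|.
Proof.
move=> t0; set z := S t u - S t v.
have [->|nz] := eqVneq z 0; first by rewrite normr0.
have z0 : 0 < `|z| by rewrite normr_gt0.
rewrite -(ler_pM2r z0) -expr2 (ip_sqrE hip) {1}/z (ipBl hip).
have [iu ->] := subordination_weak t u z; have [iv ->] := subordination_weak t v z.
rewrite -RintegralB// -(subordinator_integral_cst cmu (`|u - v| * `|z|) t0).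
apply: le_Rintegral => //; [exact: (integrableB mD iu iv)|exact: subordinator_integrable_cst|].
move=> s /D_ge0 s0; rewrite -(ipBl hip); apply: le_trans (ip_le hip _ _) _.
by case: hT => _ _ _ nT; rewrite ler_wpM2r// nT.
Qed.

Lemma subordination_dirac t a u : 0 <= t -> 0 <= a ->
  (forall x, 0 <= x -> \int[mu t]_(s in D) expR (- (s * x)) = expR (- (a * x))) ->
  S t u = T a u.
Proof.
move=> t0 a0 hx; have ae : {ae mu t, forall s, D s -> s = a}.
  by apply: (subordinator_dirac cmu t0); rewrite hx// mulr1.
apply/eqP; rewrite -subr_eq0; apply/eqP; apply: (ip_inj hip) => w; rewrite (ipBl hip).
have [iu ->] := subordination_weak t u w.
rewrite -(subordinator_integral_cst cmu (ip (T a u) w) t0); apply/eqP; rewrite subr_eq0; apply/eqP.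
rewrite /Rintegral; congr fine; apply: ae_eq_integral => //.
- exact: measurable_int iu.
- by apply: filterS ae => s sa Ds; rewrite sa.
Qed.

Lemma subordination0 u : S 0 u = u.
Proof.
have [T0 _ _ _] := hT; rewrite (@subordination_dirac 0 0)// => x x0.
by rewrite amu// !mul0r.
Qed.

Lemma subordination_identity t u : alpha = 1 -> 0 <= t -> S t u = T t u.
Proof.
move=> a1 t0; apply: subordination_dirac => // x x0.
by rewrite amu// a1 powRr1.
Qed.

Lemma displacement_bounds u : dom A u -> exists C M, [/\ 0 <= C, 0 <= M,
  forall s t, 0 <= s -> 0 <= t -> `|(u - T s u) - (u - T t u)| <= C * `|s - t| &
  forall s, 0 <= s -> `|u - T s u| <= M].
Proof.
move=> Du; have [M M0 hM] := orbit_bounded u; have [C C0 hC] := orbit_lipschitz Du.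
exists C, (`|u| + M); split=> //; first by rewrite addr_ge0.
  by move=> s t s0 t0; rewrite opprB addrC addrA subrK distrC; exact: hC.
by move=> s s0; apply: le_trans (ler_normB _ _) _; rewrite lerD2l hM.
Qed.

Definition increment u s : V := (s `^ (1 + alpha))^-1 *: (u - T s u).

Definition fractional_power u : V := (alpha / Gamma (1 - alpha)) *:
  Bochner_integral leb `]0, +oo[ (increment u).

Let P : set R := `]0, +oo[%classic.
Let P_gt0 s : P s -> 0 < s. Proof. by rewrite /P /= in_itv/= andbT. Qed.
Let mP : measurable (P : set (measurableTypeR R)). Proof. exact: measurable_itv. Qed.

Lemma increment_continuous u : {within P, continuous (increment u)}.
Proof.
apply: continuous_in_subspaceT => s; rewrite inE => /P_gt0 s0.
apply: cvgZ.
  have p0 : s `^ (1 + alpha) != 0 by rewrite gt_eqF// powR_gt0.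
  by apply: (cvgV p0); exact: continuous_powR_pos.
apply: cvgB; first exact: cvg_cst.
have := @orbit_continuous u => /continuous_within_itvcyP[cT _].
by apply: cT; rewrite in_itv/= andbT.
Qed.

(** The increment is bounded by K s^(-alpha) / (1 + s), which is nonincreasing and,
    since s / (1 + s) <= 1 - exp(-s), integrable. *)
Lemma increment_Bochner_integrable u : alpha < 1 -> dom A u ->
  Bochner_integrable leb P (increment u).
Proof.
move=> a1 Du; have [C [M [C0 M0 lip bM]]] := displacement_bounds Du.
have [T0 _ _ _] := hT.
pose K := C + M; have K0 : 0 <= K by rewrite addr_ge0.
have bnd s : 0 <= s -> `|u - T s u| <= K * (s / (1 + s)).
  move=> s0; apply: (@phi_bound _ _ (fun s => u - T s u) C M) => //.
  by rewrite T0 subrr.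
pose g s := K * (s `^ (- alpha) / (1 + s)).
have gE s : 0 < s -> g s = K * (s / (1 + s)) * s `^ (- (1 + alpha)).
  move=> s0; rewrite /g opprD powRD ?(gt_eqF s0) ?implybT// powR_inv1 ?(ltW s0)//.
  by field; rewrite !gt_eqF// ltr_wpDr// ltW.
apply: (@Bochner_integrable_continuous R V leb P mP _ _ _ _ g).
- by move=> y /P_gt0/ltW.
- by move=> y z /P_gt0 y0 yz; rewrite /P /= in_itv/= andbT; exact: lt_le_trans yz.
- move=> n; apply: (@le_lt_trans _ _ (leb `[0%R, n%:R[%classic)).
    by apply: le_measure; rewrite ?inE//; exact: measurableI.
  by rewrite lebesgue_measure_itv/=; case: ifP => _; rewrite ltry.
- exact: increment_continuous.
- move=> y z /P_gt0 y0 yz; have z0 : 0 < z by exact: lt_le_trans yz.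
  apply: (@le_trans _ _ (g z)).
    rewrite gE// normrZ ger0_norm ?invr_ge0 ?powR_ge0// -powRN mulrC ler_wpM2r ?powR_ge0//.
    by rewrite bnd// ltW.
  have y1 : 0 < 1 + y by rewrite ltr_wpDr// ltW.
  have z1 : 0 < 1 + z by rewrite ltr_wpDr// ltW.
  rewrite /g ler_wpM2l// ler_pM ?powR_ge0 ?invr_ge0 ?(ltW z1)//.
    rewrite !powRN lef_pV2 ?posrE ?powR_gt0//.
    by apply: ge0_ler_powR => //; rewrite ?nnegrE; apply: ltW.
  by rewrite lef_pV2 ?posrE// lerD2l.
- apply: le_integrable (integrableZl mP K (stable_integrable alpha0 a1)) => //.
    apply/measurable_EFinP; apply: half_line_measurable => s s0.
    apply: cvgM; first exact: cvg_cst.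
    apply: cvgM; first exact: continuous_powR_pos.
    have s1 : 1 + s != 0 by rewrite gt_eqF// ltr_wpDr// ltW.
    by apply: (cvgV s1); apply: cvgD; [exact: cvg_cst|exact: cvg_id].
  move=> s /P_gt0 s0; have s1 : 0 < 1 + s by rewrite ltr_wpDr// ltW.
  rewrite /= lee_fin gE//.
  have e1 : s / (1 + s) <= 1 - expR (- s) by apply: ratio_le_1BexpN; exact: ltW.
  have e0 : 0 <= s / (1 + s) by rewrite divr_ge0 ?(ltW s0) ?(ltW s1).
  apply: le_trans (ler_norm _); rewrite -mulrA.
  rewrite (ger0_norm (mulr_ge0 K0 (mulr_ge0 e0 (powR_ge0 _ _)))).
  by rewrite ler_wpM2l// ler_wpM2r ?powR_ge0.
Qed.

(** [levy_convergence] for the displacement u - T_s u. *)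
Lemma fractional_power_limit u : alpha < 1 -> dom A u ->
  t^-1 *: (u - S t u) @[t --> (0 : R)^'+] --> fractional_power u.
Proof.
move=> a1 Du; have [C [M [C0 M0 lip bM]]] := displacement_bounds Du.
have [T0 _ _ _] := hT.
apply: (@levy_convergence _ _ ip hip (fun s => u - T s u) C M C0 M0 _ lip bM
  (subordinator_functional mu) (stable_levy alpha)) => //.
- by rewrite T0 subrr.
- by move=> t t0; exact: subordinator_levy.
- exact: stable_levy_functional.
- by move=> k; exact: subordinator_moment_cvg.
- exact: stable_levy_peak.
- move=> t w t0; rewrite ipZl// ipBl//; have [iT ->] := subordination_weak t u w.
  rewrite /subordinator_functional /weighted_integral; congr (_ * _).
  rewrite -[X in X - _](subordinator_integral_cst cmu (ip u w) (ltW t0)) -RintegralB//.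
    by apply: eq_RintegralD => s _; rewrite mulr1 ipBl.
  exact: subordinator_integrable_cst.
- move=> w; rewrite ipZl// /stable_levy /weighted_integral; congr (_ * _).
  have mi : @dist_measurable _ (measurableTypeR R) R V P (increment u).
    exact: (dist_measurable_continuous mP (@increment_continuous u)).
  have [_ ->] := Bochner_integral_weak hip hV mP w mi (increment_Bochner_integrable a1 Du).
  by apply: eq_RintegralD => s _; rewrite ipZl// mulrC powRN.
Qed.

Local Notation Aalpha := (subordinated_generator S).

Lemma subordinated_generator_cvg u : dom A u ->
  t^-1 *: (u - S t u) @[t --> (0 : R)^'+] --> Aalpha u.
Proof.
move=> Du; have [l hl] : exists l : V, t^-1 *: (u - S t u) @[t --> (0 : R)^'+] --> l.
  move: (alpha1); rewrite le_eqVlt => /predU1P[a1|a1]; last first.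
    by exists (fractional_power u); exact: fractional_power_limit.
  exists (min_section A u); have h := orbit_right_derivative Du.
  apply: cvg_trans h; apply: near_eq_cvg; near=> t.
  by rewrite subordination_identity//; near: t; exact: nbhs_right_ge.
by rewrite /subordinated_generator (cvg_lim (@norm_hausdorff _ _) hl).
Unshelve. all: by end_near.
Qed.

Lemma subordinated_generatorE u : alpha < 1 -> dom A u ->
  Aalpha u = fractional_power u.
Proof.
move=> a1 Du; apply: (cvg_lim (@norm_hausdorff _ _)).
exact: fractional_power_limit.
Qed.

(** (u - S_t u - (v - S_t v), u - v) >= |u - v|^2 - |S_t u - S_t v| |u - v| >= 0. *)
Lemma subordinated_generator_monotone : monotone_op ip (single_valued (dom A) Aalpha).
Proof.
move=> u v _ _ [Du ->] [Dv ->].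
have cu := subordinated_generator_cvg Du; have cv := subordinated_generator_cvg Dv.
have c : ip (t^-1 *: (u - S t u) - t^-1 *: (v - S t v)) (u - v) @[t --> (0 : R)^'+] -->
    ip (Aalpha u - Aalpha v) (u - v).
  have cB : t^-1 *: (u - S t u) - t^-1 *: (v - S t v) @[t --> (0 : R)^'+] -->
      Aalpha u - Aalpha v by apply: (cvgB cu cv).
  have c1 : (fun=> u - v) @ (0 : R)^'+ --> u - v by exact: cvg_cst.
  exact: (cvg_ip hip _ cB c1).
apply: (cvgr_to_ge c); near=> t.
have t0 : 0 < t by near: t; exact: nbhs_right_gt.
rewrite -scalerBr (ipZl hip) mulr_ge0 ?invr_ge0 ?(ltW t0)//.
have -> : u - S t u - (v - S t v) = (u - v) - (S t u - S t v).
  by rewrite !opprB -!addrA; congr (_ + _); rewrite addrCA [RHS]addrCA [in LHS](addrC (- _)).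
rewrite (ipBl hip) -(ip_sqrE hip) subr_ge0; apply: le_trans (ip_le hip _ _) _.
by rewrite expr2 ler_wpM2r// subordination_nonexpansive// ltW.
Unshelve. all: by end_near.
Qed.

End nonlinear_subordination.

Theorem theorem4p5 (R : realType) (d : measure_display) (X : measurableType d)
  (m : {measure set X -> \bar R})
  (T : R -> LspaceType2 m -> LspaceType2 m)
  (A : LspaceType2 m -> set (LspaceType2 m))
  (alpha : R) (mu : R -> probability R R) :
  nonexpansive_semigroup T ->
  generator (@L2_inner _ X R m) T A ->
  bounded_orbit T ->
  0 < alpha -> alpha <= 1 ->
  convolution_semigroup mu ->
  associated_to mu (fun x => x `^ alpha) ->
  let S := subordination mu T in
  let Aalpha := subordinated_generator S in
  let increment u (s : R) := (s `^ (1 + alpha))^-1 *: (u - T s u) in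
  (forall (t : R) u, 0 <= t -> Bochner_integrable (mu t) `[0, +oo[ (T^~ u)) /\
  (forall u, dom A u ->
     cvg (t^-1 *: (S t u - S 0 u) @[t --> 0^'+]) /\
     t^-1 *: (u - S t u) @[t --> 0^'+] --> Aalpha u) /\
  (alpha < 1 -> forall u, dom A u ->
     Bochner_integrable (@lebesgue_measure R) `]0, +oo[ (increment u) /\
     Aalpha u = (alpha / Gamma (1 - alpha)) *:
       Bochner_integral (@lebesgue_measure R) `]0, +oo[ (increment u)) /\
  monotone_op (@L2_inner _ X R m) (single_valued (dom A) Aalpha) /\
  (exists B, maximal_monotone (@L2_inner _ X R m) B /\
             extends (single_valued (dom A) Aalpha) B) /\
  (forall B, maximal_monotone (@L2_inner _ X R m) B ->
     extends (single_valued (dom A) Aalpha) B ->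
     exists Talpha,
       [/\ nonexpansive_semigroup Talpha,
           generator (@L2_inner _ X R m) Talpha B &
           forall T', nonexpansive_semigroup T' ->
             generator (@L2_inner _ X R m) T' B ->
             forall (t : R) u, 0 <= t -> T' t u = Talpha t u]).
Proof.
move=> hT hA bT alpha0 alpha1 cmu amu S Aalpha increment.
have hip := @L2_inner_product _ X R m; have hV := @L2_complete _ X R m.
have [_ dA _] := hA.
have S0 u : S 0 u = u by exact: (subordination0 hip hV hT bT cmu amu).
have cA u : dom A u -> t^-1 *: (u - S t u) @[t --> (0 : R)^'+] --> Aalpha u.
  exact: (subordinated_generator_cvg hip hV hT hA bT alpha0 alpha1 cmu amu).
split; first by move=> t u _; exact: orbit_Bochner_integrable.
split.
  move=> u Du; split; last exact: cA.
  apply/cvg_ex; exists (- Aalpha u).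
  have h : - (t^-1 *: (u - S t u)) @[t --> (0 : R)^'+] --> - Aalpha u.
    by apply: cvgN; exact: cA.
  rewrite (_ : (fun t => _) = (fun t => - (t^-1 *: (u - S t u))))//.
  by apply/funext => t; rewrite S0 -scalerN opprB.
split.
  move=> a1 u Du; split; first exact: (increment_Bochner_integrable hip hV hT hA bT alpha0 a1 Du).
  exact: (subordinated_generatorE hip hV hT hA bT alpha0 cmu amu a1 Du).
have mon : monotone_op (@L2_inner _ X R m) (single_valued (dom A) Aalpha).
  exact: (subordinated_generator_monotone hip hV hT hA bT alpha0 alpha1 cmu amu).
split; first exact: mon.
split; first exact: (maximal_monotone_extension mon).
move=> B hB AB.
have dB : closure (dom B) = setT.
  apply/seteqP; split=> // u _; have : closure (dom A) u by rewrite dA.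
  by apply: closureS => v Dv; exists (Aalpha v); exact: AB.
exists (semigroup B); split.
- exact: (semigroup_nonexpansive hip hV hB dB).
- exact: (semigroup_generator hip hV hB dB).
- move=> T' hT' gT' t u t0.
  apply: (semigroup_unique hip dB _ hT' _ gT' _ t0).
    exact: (semigroup_nonexpansive hip hV hB dB).
  exact: (semigroup_generator hip hV hB dB).
Qed.
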